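(* Let $(X,\mu)$ be a $\sigma$-finite measure space and let $p$ be a pointwise consistent $\mu$-heat kernel with associated self-adjoint operator $H_p\ge 0$ in $\mathsf{L}^2(X,\mathrm{d}\mu)$. Assume that there exist measurable functions $F_1:X\to(0,\infty)$ and $F_2:(0,\infty)\to(0,\infty)$ such that for some $q\geq 1$ $$p(t,x,x)\leq F_1(x)F_2(t)\quad\text{for all }t>0,\ x\in X,\qquad \int_0^\infty \mathrm{e}^{-t}F_2(t)^{\frac{1}{2q}}\,\mathrm{d}t<\infty.$$ Then for any measurable potential $V:X\to\mathbb{R}$ of the form $V=V_1+V_2$, the operator $V(H_p+1)^{-1}$ is compact in $\mathsf{L}^2(X,\mathrm{d}\mu)$ if one of the following two conditions holds: (i) $q=1$, $V_1\in\mathsf{L}^2(X,F_1\mathrm{d}\mu)$, and $V_2\in\mathsf{L}^\infty_\infty(X,\mathrm{d}\mu)\cap\mathsf{L}_\infty(X,F_1\mathrm{d}\mu)$; (ii) $q>1$, $F_1\equiv1$, $V_1\in\mathsf{L}^{2q}(X,\mathrm{d}\mu)$, and $V_2\in\mathsf{L}^\infty_\infty(X,\mathrm{d}\mu)$.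
   Context: Let $(X,\mu)$ be a $\sigma$-finite measure space (not necessarily complete). A measurable map $p:(0,\infty)\times X\times X\to[0,\infty)$ is called a pointwise consistent $\mu$-heat kernel if (1) $p(t+s,x,y)=\int_X p(t,x,z)p(s,z,y)\,\mathrm{d}\mu(z)$ for all $t,s>0$, $x,y\in X$; (2) $p(t,x,y)=p(t,y,x)$ for all $t>0$, $x,y\in X$; (3) $\int_X p(t,x,y)\,\mathrm{d}\mu(y)\le1$ for all $t>0$, $x\in X$; (4) with $P_tf(x):=\int_X p(t,x,y)f(y)\,\mathrm{d}\mu(y)$, $t>0$, $f\in\mathsf{L}^2(X,\mathrm{d}\mu)$, one has $\lim_{t\to0+}\|P_tf-f\|_{\mathsf{L}^2(X,\mathrm{d}\mu)}=0$. With $P_0:=\mathrm{id}$, the family $(P_t)_{t\ge0}$ is then a strongly continuous contraction semigroup of self-adjoint operators in $\mathsf{L}^2(X,\mathrm{d}\mu)$, and $H_p$ denotes the unique self-adjoint nonnegative operator with $\mathrm{e}^{-tH_p}=P_t$ for all $t\ge0$. For a measurable $F:X\to[0,\infty)$, $F\mathrm{d}\mu$ denotes the measure with density $F$ with respect to $\mu$. For a measure $\nu$ on $X$, $\mathsf{L}_\infty(X,\mathrm{d}\nu)$ denotes the set of $\nu$-equivalence classes of measurable functions $h:X\to\mathbb{C}$ that vanish $\nu$-weakly at $\infty$, i.e. $\nu\{|h|\ge c\}<\infty$ for all $c>0$, and $\mathsf{L}^\infty_\infty(X,\mathrm{d}\nu):=\mathsf{L}^\infty(X,\mathrm{d}\nu)\cap\mathsf{L}_\infty(X,\mathrm{d}\nu)$.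 In $V(H_p+1)^{-1}$ the function $V$ is identified with its maximally defined multiplication operator in $\mathsf{L}^2(X,\mathrm{d}\mu)$, with domain $\{f\in\mathsf{L}^2(X,\mathrm{d}\mu): Vf\in\mathsf{L}^2(X,\mathrm{d}\mu)\}$. *)

(* Defs.v *)
From HB Require Import structures.
From mathcomp Require Import all_boot all_order all_algebra.
From mathcomp Require Import all_classical all_reals all_analysis.
From mathcomp Require Import measurable_realfun complex.

Set Implicit Arguments.
Unset Strict Implicit.
Unset Printing Implicit Defensive.
Import Order.TTheory GRing.Theory Num.Theory.
Import numFieldTopology.Exports numFieldNormedType.Exports.

Local Open Scope classical_set_scope.
Local Open Scope ring_scope.

Notation normc := ComplexField.Normc.normc.

Section density.
Context {d : measure_display} {X : measurableType d} {R : realType}.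
Variables (mu : {measure set X -> \bar R}) (F : X -> R).

(* The measure [F dmu]; the two proof arguments are what makes it a measure. *)
Definition density (mF : measurable_fun setT F) (F0 : forall x, 0 <= F x)
    (A : set X) : \bar R :=
  (\int[mu]_(x in A) (F x)%:E)%E.

Variables (mF : measurable_fun setT F) (F0 : forall x, 0 <= F x).

Let density0 : density mF F0 set0 = 0%E.
Proof. by rewrite /density integral_set0. Qed.

Let density_ge0 A : (0 <= density mF F0 A)%E.
Proof. by apply: integral_ge0 => x _; rewrite lee_fin. Qed.

Let density_sigma_additive : semi_sigma_additive (density mF F0).
Proof.
move=> A mA tA mUA; rewrite /density ge0_integral_bigcup//=.
- apply: is_cvg_ereal_nneg_natsum_cond => n _ _.
  by apply: integral_ge0 => x _; rewrite lee_fin.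
- by apply/measurable_EFinP; apply: measurable_funS mF.
- by move=> x _; rewrite lee_fin.
Qed.

HB.instance Definition _ := isMeasure.Build _ _ _ (density mF F0)
  density0 density_ge0 density_sigma_additive.

End density.

Section complex_function_spaces.
Context {d : measure_display} {X : measurableType d} {R : realType}.
Local Notation C := R[i].
Implicit Types (mu : {measure set X -> \bar R}) (f g : X -> C).

Definition cmeasurable f : Prop :=
  measurable_fun setT (fun x => complex.Re (f x)) /\
  measurable_fun setT (fun x => complex.Im (f x)).

Definition cLnorm mu (p : \bar R) f : \bar R :=
  Lnorm mu p (fun x => (normc (f x))%:E).

(* Elements of L^p are handled through representatives; equality in L^p is
   equality mu-almost everywhere. *)
Definition in_Lp mu (p : \bar R) f : Prop :=
  cmeasurable f /\ (cLnorm mu p f < +oo)%E.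

Definition vanishes_weakly mu f : Prop :=
  cmeasurable f /\
  forall c : R, 0 < c -> (mu [set x | (c <= normc (f x))%R] < +oo)%E.

Definition cintegral mu f : C :=
  ((\int[mu]_x complex.Re (f x)) +i* (\int[mu]_x complex.Im (f x)))%C.

Definition L2 mu f : Prop := in_Lp mu 2%:E f.

Definition L2norm mu f : \bar R := cLnorm mu 2%:E f.

Definition L2inner mu f g : C := cintegral mu (fun x => f x * (g x)^*%C).

End complex_function_spaces.

Section operators.
Context {d : measure_display} {X : measurableType d} {R : realType}.
Variable mu : {measure set X -> \bar R}.
Local Notation C := R[i].

(* A possibly unbounded operator in L^2(X, mu) is given by its graph, a
   relation between representatives: [T f g] means that f belongs to the domain
   of T and that T f = g. *)
Definition graph := (X -> C) -> (X -> C) -> Prop.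
Implicit Types T S : graph.

(* In [operator_ae], membership of f' and g' in L^2 has to be assumed because mu
   need not be complete: a function that equals a measurable one almost
   everywhere may fail to be measurable. *)
Record operator T : Prop := {
  operator_L2 : forall f g, T f g -> L2 mu f /\ L2 mu g;
  operator_ae : forall f g f' g', T f g -> L2 mu f' -> L2 mu g' ->
    f = f' %[ae mu] -> g = g' %[ae mu] -> T f' g';
  operator_fun : forall f g g', T f g -> T f g' -> g = g' %[ae mu];
  operator0 : T (fun=> 0) (fun=> 0);
  operator_linear : forall (a : C) f g f' g', T f g -> T f' g' ->
    T (fun x => a * f x + f' x) (fun x => a * g x + g' x)
}.

Definition densely_defined T : Prop :=
  forall f, L2 mu f -> forall e : R, 0 < e ->
  exists g h, T g h /\ (L2norm mu (fun x => (f x - g x)%R) < e%:E)%E.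

Definition adjoint T : graph := fun f g =>
  [/\ L2 mu f, L2 mu g & forall u v, T u v -> L2inner mu v f = L2inner mu u g].

Definition self_adjoint T : Prop :=
  [/\ operator T, densely_defined T & forall f g, T f g <-> adjoint T f g].

(* The order of [R[i]] is such that [0 <= z] says that z is real and
   nonnegative. *)
Definition nonnegative T : Prop :=
  forall f g, T f g -> 0 <= L2inner mu g f.

Definition plus_id T : graph := fun f g => T f (fun x => g x - f x).

Definition inverse T : graph := fun f g => T g f.

Definition compose T S : graph := fun f h => exists g, S f g /\ T g h.

Definition multiplication (V : X -> R) : graph := fun f g =>
  [/\ L2 mu f, L2 mu g & g = (fun x => (V x)%:C%C * f x) %[ae mu]].

Definition compact_operator T : Prop :=
  [/\ operator T,
      forall f, L2 mu f -> exists g, T f g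
    & forall u v : nat -> X -> C,
      (forall n, T (u n) (v n)) ->
      (exists M : R, forall n, (L2norm mu (u n) <= M%:E)%E) ->
      exists (s : nat -> nat) (g : X -> C),
        [/\ {homo s : m n / (m < n)%N}, L2 mu g
          & L2norm mu (fun x => (v (s n) x - g x)%R) @[n --> \oo] --> 0%E]].

End operators.

Section spectral_calculus.
Context {d : measure_display} {X : measurableType d} {R : realType}.
Variable mu : {measure set X -> \bar R}.
Local Notation C := R[i].

(* A projection-valued measure E on the Borel sets of R, together with its
   scalar measures [nu f : A |-> <E(A) f, f>].  That each [nu f] is a measure is
   the (weak, hence strong) countable additivity of E. *)
Record spectral_measure (E : set R -> (X -> C) -> X -> C)
    (nu : (X -> C) -> {measure set R -> \bar R}) : Prop := {
  spectral_L2 : forall (A : set R) f, measurable A -> L2 mu f -> L2 mu (E A f);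
  spectral_ae : forall (A : set R) f g, measurable A -> L2 mu f -> L2 mu g ->
    f = g %[ae mu] -> E A f = E A g %[ae mu];
  spectral_linear : forall (A : set R) (a : C) f g, measurable A -> L2 mu f -> L2 mu g ->
    E A (fun x => a * f x + g x) = (fun x => a * E A f x + E A g x) %[ae mu];
  spectral_symmetric : forall (A : set R) f g, measurable A -> L2 mu f -> L2 mu g ->
    L2inner mu (E A f) g = L2inner mu f (E A g);
  spectralI : forall (A B : set R) f, measurable A -> measurable B -> L2 mu f ->
    E (A `&` B) f = E A (E B f) %[ae mu];
  spectralT : forall f, L2 mu f -> E setT f = f %[ae mu];
  spectral_scalar : forall (A : set R) f, measurable A -> L2 mu f ->
    nu f A = (complex.Re (L2inner mu (E A f) f))%:E
}.

(* [polar_integral nu phi f h] is the integral of phi with respect to the complex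
   measure [A |-> <E(A) f, h>], written with the polarization identity (the
   inner product being linear in its first argument). *)
Definition polar_integral (nu : (X -> C) -> {measure set R -> \bar R})
    (phi : R -> R) (f h : X -> C) : C :=
  4%:R^-1 * \sum_(k < 4) 'i%C ^+ k *
    (\int[nu (fun x => f x + 'i%C ^+ k * h x)]_l phi l)%:C%C.

(* The operator [int phi dE], with its domain of all f such that
   [int phi^2 d<E f, f>] is finite.  As this domain is dense, testing against
   its elements h determines g, and for these h the function phi is integrable
   with respect to the four measures in [polar_integral nu phi f h]. *)
Definition spectral_integral (nu : (X -> C) -> {measure set R -> \bar R})
    (phi : R -> R) : @graph d X R := fun f g =>
  [/\ L2 mu f, L2 mu g, (\int[nu f]_l ((phi l) ^+ 2)%:E < +oo)%E
    & forall h, L2 mu h -> (\int[nu h]_l ((phi l) ^+ 2)%:E < +oo)%E ->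
      L2inner mu g h = polar_integral nu phi f h].

(* [P t = exp (- t H)] for all t >= 0, by the spectral calculus: E is the
   spectral resolution of H, and [P t] is the integral of [exp (- t l)] with
   respect to E. *)
Definition is_exp_semigroup (H : @graph d X R)
    (P : R -> (X -> C) -> X -> C) : Prop :=
  exists E nu, [/\ spectral_measure E nu,
    forall f g, H f g <-> spectral_integral nu (fun l => l) f g
  & forall (t : R) f, 0 <= t -> L2 mu f ->
    spectral_integral nu (fun l => expR (- (t * l))) f (P t f)].

End spectral_calculus.

Section heat_kernels.
Context {d : measure_display} {X : measurableType d} {R : realType}.
Variables (mu : {measure set X -> \bar R}) (p : R -> X -> X -> R).
Local Notation C := R[i].

Definition heat_op (t : R) (f : X -> C) : X -> C :=
  if t == 0 then f
  else fun x => cintegral mu (fun y => (p t x y)%:C%C * f y).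

(* Only the values of p at positive times are relevant. *)
Record heat_kernel : Prop := {
  heat_kernel_measurable :
    measurable_fun [set z : R * X * X | 0 < z.1.1]
      (fun z : R * X * X => p z.1.1 z.1.2 z.2);
  heat_kernel_ge0 : forall (t : R) x y, 0 < t -> 0 <= p t x y;
  heat_kernel_semigroup : forall (t s : R) x y, 0 < t -> 0 < s ->
    ((p (t + s) x y)%:E = \int[mu]_z (p t x z * p s z y)%:E)%E;
  heat_kernel_sym : forall (t : R) x y, 0 < t -> p t x y = p t y x;
  heat_kernel_le1 : forall (t : R) x, 0 < t -> (\int[mu]_y (p t x y)%:E <= 1)%E;
  heat_kernel_continuous : forall f, L2 mu f ->
    L2norm mu (fun x => (heat_op t f x - f x)%R) @[t --> 0^'+] --> 0%E
}.

(* H is the operator H_p associated with p. *)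
Definition heat_operator (H : @graph d X R) : Prop :=
  [/\ self_adjoint mu H, nonnegative mu H & is_exp_semigroup mu H heat_op].

End heat_kernels.

(* Main.v *)
From HB Require Import structures.
Require Import Defs.
From mathcomp Require Import all_boot all_order all_algebra.
From mathcomp Require Import all_classical all_reals all_analysis.
From mathcomp Require Import measurable_realfun ess_sup_inf complex.
From mathcomp Require Import ring lra.

(* Write G for the resolvent (H + 1)^-1 and P_t for exp(-tH).  G is the integral
   operator whose kernel is the Laplace transform at 1 of the heat kernel: with the
   spectral calculus, (u - P_t u)/t tends weakly to H u on the domain of H, while
   (G f - P_t G f)/t tends to f - G f for every f, so that <H u, G f> = <u, f - G f>,
   and self-adjointness puts G f in the domain of H with H (G f) = f - G f.

   The semigroup identity gives (P_t f (x))^2 <= p t x x |f|^2 <= F1 x F2 t |f|^2.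
   Interpolating with the contraction |P_t f| <= |f| and integrating against e^-t, one
   gets |U G f|^2 <= K (\int |U|^(2q) F1)^(1/q) |f|^2, which covers both cases (i) and
   (ii).  Hence V G is a limit in operator norm of operators W G with W bounded and
   \int W^2 F1 finite.  Since |G - P_t G| = O(t), W G is in turn a limit of W P_t G,
   and W P_t is compact: it maps weakly convergent sequences to pointwise convergent
   ones that are dominated by a multiple of |W| F1^(1/2). *)

Set Implicit Arguments.
Unset Strict Implicit.
Unset Printing Implicit Defensive.
Import Order.TTheory GRing.Theory Num.Theory.
Import numFieldTopology.Exports numFieldNormedType.Exports.

Local Open Scope classical_set_scope.
Local Open Scope ring_scope.

(** * Real L^2 functions *)

(** The kernels and the potential are real, so the analysis is done for real functions and then
    applied to real and imaginary parts. The spectral calculus is accessible only through the scalar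
    measures [nu f], by polarization. To compute <H u, G f> in this way, G f must already satisfy
    \int l^2 d nu(G f) < oo: this is a second use of the bound |G f - P_t G f| <= 3 t |f|, through
    Fatou's lemma applied to ((1 - exp(-t l))/t)^2. The measures are on the whole line, so
    dominating functions must also control exp(-t l) for negative l.

    The exponent 1/(2q) comes from weighting Jensen's inequality in t: the estimate of |U P_t f|^2
    carries F2(t)^(1/q), and dividing by the weight F2(t)^(1/(2q)) leaves F2(t)^(1/(2q)), which is
    integrable against exp(-t).

    The subsequence is extracted once, for the weak convergence of G u_n, before V is approximated;
    the approximations only show that V G u_n is Cauchy along it, and completeness of L^2
    concludes. *)

Section real_L2.
Context {d : measure_display} {X : measurableType d} {R : realType}.
Variable mu : {measure set X -> \bar R}.
Implicit Types (f g h : X -> R) (c : R).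

Definition rL2 f : Prop :=
  measurable_fun setT f /\ (\int[mu]_x ((f x) ^+ 2)%:E < +oo)%E.

Definition ip f g : R := \int[mu]_x (f x * g x).

Definition nrm f : R := Num.sqrt (ip f f).

Lemma measurable_sqr f : measurable_fun setT f ->
  measurable_fun setT (fun x => ((f x) ^+ 2)%:E).
Proof. by move=> mf; apply/measurable_EFinP; exact: measurable_funX. Qed.

Lemma integrable_mul f g : rL2 f -> rL2 g ->
  mu.-integrable setT (EFin \o (fun x => f x * g x)).
Proof.
move=> [mf f2] [mg g2].
have mfg : measurable_fun setT (fun x => ((f x) ^+ 2 + (g x) ^+ 2)%:E).
  by apply/measurable_EFinP; apply: measurable_funD; exact: measurable_funX.
apply: (@le_integrable _ _ _ _ _ _ _
  (EFin \o (fun x => (f x) ^+ 2 + (g x) ^+ 2))) => //.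
- by apply/measurable_EFinP; exact: measurable_funM.
- move=> x _ /=; rewrite lee_fin.
  rewrite [X in _ <= X]ger0_norm ?addr_ge0 ?sqr_ge0//.
  have := sqr_ge0 (f x - g x); have := sqr_ge0 (f x + g x).
  by rewrite ler_norml => ? ?; apply/andP; split; nra.
- apply/integrableP; split => //=.
  under eq_integral do rewrite ger0_norm ?addr_ge0 ?sqr_ge0//= EFinD.
  rewrite ge0_integralD//; first by rewrite lte_add_pinfty.
  + by move=> x _; rewrite lee_fin sqr_ge0.
  + exact: measurable_sqr.
  + by move=> x _; rewrite lee_fin sqr_ge0.
  + exact: measurable_sqr.
Qed.

Lemma integral_sqrE f : rL2 f -> (\int[mu]_x ((f x) ^+ 2)%:E)%E = (ip f f)%:E.
Proof.
move=> [mf f2]; rewrite /ip /Rintegral fineK.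
  by apply: eq_integral => x _; rewrite expr2.
under eq_integral do rewrite -expr2.
by rewrite ge0_fin_numE// integral_ge0// => x _; rewrite lee_fin sqr_ge0.
Qed.

Lemma rL2_leW f (r : R) : measurable_fun setT f ->
  (\int[mu]_x ((f x) ^+ 2)%:E <= r%:E)%E -> rL2 f.
Proof. by move=> mf h; split => //; exact: le_lt_trans h (ltry _). Qed.

Lemma rL2_le f (r : R) : rL2 f ->
  (\int[mu]_x ((f x) ^+ 2)%:E <= r%:E)%E -> ip f f <= r.
Proof. by move=> f2; rewrite integral_sqrE// lee_fin. Qed.

Lemma rL2Z c f : rL2 f -> rL2 (fun x => c * f x).
Proof.
move=> [mf f2]; split; first exact: measurable_funM.
under eq_integral do rewrite exprMn EFinM.
rewrite ge0_integralZl_EFin ?sqr_ge0//; last exact: measurable_sqr.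
  by rewrite lte_mul_pinfty ?lee_fin ?sqr_ge0.
by move=> x _; rewrite lee_fin sqr_ge0.
Qed.

Lemma rL2D f g : rL2 f -> rL2 g -> rL2 (fun x => f x + g x).
Proof.
move=> f2 g2; have [mf _] := f2; have [mg _] := g2.
split; first exact: measurable_funD.
have /integrable_lty := integrableD measurableT (integrable_mul f2 f2) (integrable_mul g2 g2).
move=> /(_ measurableT) h.
apply: (@le_lt_trans _ _ (\int[mu]_x (2 * (f x ^+ 2 + g x ^+ 2))%:E)%E).
  apply: ge0_le_integral => //.
  - by move=> x _; rewrite lee_fin sqr_ge0.
  - by apply: measurable_sqr; exact: measurable_funD.
  - apply/measurable_EFinP; apply: measurable_funM => //.
    by apply: measurable_funD; exact: measurable_funX.
  - move=> x _; rewrite lee_fin; have := sqr_ge0 (f x - g x); nra.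
under eq_integral do rewrite EFinM.
rewrite ge0_integralZl_EFin//.
- by rewrite lte_mul_pinfty//; under eq_integral do rewrite !expr2 EFinD.
- by move=> x _; rewrite lee_fin addr_ge0 ?sqr_ge0.
- by apply/measurable_EFinP/measurable_funD; exact: measurable_funX.
Qed.

Lemma rL2N f : rL2 f -> rL2 (fun x => - f x).
Proof.
move=> [mf f2]; split; first exact: measurableT_comp.
by under eq_integral do rewrite sqrrN.
Qed.

Lemma rL2B f g : rL2 f -> rL2 g -> rL2 (fun x => f x - g x).
Proof. by move=> f2 g2; apply: rL2D => //; exact: rL2N. Qed.

Lemma rL20 : rL2 (fun=> 0).
Proof.
by split => //; under eq_integral do rewrite expr0n/=; rewrite integral0.
Qed.

Lemma ipC f g : ip f g = ip g f.
Proof. by apply: eq_Rintegral => x _; rewrite mulrC. Qed.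

Lemma ipDl f g h : rL2 f -> rL2 g -> rL2 h ->
  ip (fun x => f x + g x) h = ip f h + ip g h.
Proof.
move=> f2 g2 h2; rewrite /ip -RintegralD//; try exact: integrable_mul.
by apply: eq_Rintegral => x _; rewrite mulrDl.
Qed.

Lemma ipZl c f g : rL2 f -> rL2 g -> ip (fun x => c * f x) g = c * ip f g.
Proof.
move=> f2 g2; rewrite /ip -RintegralZl//; last exact: integrable_mul.
by apply: eq_Rintegral => x _; rewrite mulrA.
Qed.

Lemma ipNl f g : rL2 f -> rL2 g -> ip (fun x => - f x) g = - ip f g.
Proof.
by move=> f2 g2; rewrite -mulN1r -ipZl//; apply: eq_Rintegral => x _; rewrite mulN1r.
Qed.

Lemma ipBl f g h : rL2 f -> rL2 g -> rL2 h ->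
  ip (fun x => f x - g x) h = ip f h - ip g h.
Proof.
by move=> f2 g2 h2; rewrite -ipNl// -ipDl//; exact: rL2N.
Qed.

Lemma ipDr f g h : rL2 f -> rL2 g -> rL2 h ->
  ip h (fun x => f x + g x) = ip h f + ip h g.
Proof. by move=> f2 g2 h2; rewrite ipC ipDl// ![ip _ h]ipC. Qed.

Lemma ipBr f g h : rL2 f -> rL2 g -> rL2 h ->
  ip h (fun x => f x - g x) = ip h f - ip h g.
Proof. by move=> f2 g2 h2; rewrite ipC ipBl// ![ip _ h]ipC. Qed.

Lemma ipZr c f g : rL2 f -> rL2 g -> ip f (fun x => c * g x) = c * ip f g.
Proof. by move=> f2 g2; rewrite ipC ipZl// ipC. Qed.

Lemma ip_ge0 f : 0 <= ip f f.
Proof. by apply: Rintegral_ge0 => x _; rewrite -expr2 sqr_ge0. Qed.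

Lemma nrm_ge0 f : 0 <= nrm f. Proof. exact: sqrtr_ge0. Qed.

Lemma nrm_sqr f : nrm f ^+ 2 = ip f f.
Proof. by rewrite sqr_sqrtr// ip_ge0. Qed.

(** The quadratic polynomial t -> [ip (f + t g) (f + t g)] is nonnegative; it is evaluated at its
    minimum [- ip f g / ip g g]. *)
Lemma cauchy_schwarz f g : rL2 f -> rL2 g -> `|ip f g| <= nrm f * nrm g.
Proof.
move=> f2 g2; rewrite -(@ler_pXn2r _ 2)//= ?nnegrE ?mulr_ge0 ?nrm_ge0//.
rewrite exprMn !nrm_sqr real_normK ?num_real//.
have q t : 0 <= ip f f + 2 * t * ip f g + t ^+ 2 * ip g g.
  have := ip_ge0 (fun x => f x + t * g x).
  have tg := rL2Z t g2; rewrite ipDl ?ipDr ?ipZl ?ipZr//; last exact: rL2D.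
  rewrite (ipC g f); move/le_trans; apply; lra.
have := ip_ge0 g; rewrite le_eqVlt => /predU1P[g0|g0].
  suff : ip f g = 0 by move=> ->; rewrite expr0n/= -g0 mulr0.
  apply/eqP/negPn/negP => fg0.
  (* With [ip g g = 0] the polynomial is affine, and a nonzero slope would let it take the value
     -1. *)
  have := q (- (ip f f + 1) / (2 * ip f g)); rewrite -g0 mulr0 addr0.
  rewrite (_ : _ + _ = -1) ?ler0N1//; by field.
have := q (- ip f g / ip g g).
rewrite (_ : _ + _ = (ip f f * ip g g - ip f g ^+ 2) / ip g g); last by field; rewrite gt_eqF.
by rewrite pmulr_lge0 ?invr_gt0// subr_ge0.
Qed.

Lemma nrm_le f (r : R) : 0 <= r -> ip f f <= r ^+ 2 -> nrm f <= r.
Proof.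
by move=> r0 h; rewrite -(@ler_pXn2r _ 2)//= ?nnegrE ?nrm_ge0// nrm_sqr.
Qed.

Lemma eq_ae_ip f f' g g' : measurable_fun setT f -> measurable_fun setT f' ->
  measurable_fun setT g -> measurable_fun setT g' ->
  f = f' %[ae mu] -> g = g' %[ae mu] -> ip f g = ip f' g'.
Proof.
move=> mf mf' mg mg' ff' gg'; congr fine; apply: ae_eq_integral => //.
- by apply/measurable_EFinP; exact: measurable_funM.
- by apply/measurable_EFinP; exact: measurable_funM.
- by apply: filterS2 ff' gg' => x /= ff' gg' _; rewrite ff' // gg'.
Qed.

Lemma ip_eq0 f : rL2 f -> ip f f = 0 -> f = (fun=> 0) %[ae mu].
Proof.
move=> f2 f0; have [mf _] := f2.
have := ae_eq_integral_abs mu measurableT (measurable_sqr mf).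
under eq_integral do rewrite gee0_abs ?lee_fin ?sqr_ge0//.
rewrite integral_sqrE// f0 => -[+ _] => /(_ erefl).
apply: filterS => x /= /(_ Logic.I) [] /eqP; rewrite expf_eq0/= => /eqP h _; exact: h.
Qed.

Lemma nrmD f g : rL2 f -> rL2 g -> nrm (fun x => f x + g x) <= nrm f + nrm g.
Proof.
move=> f2 g2; apply: nrm_le; first by rewrite addr_ge0 ?nrm_ge0.
have := cauchy_schwarz f2 g2; rewrite ler_norml => /andP[_ fg].
rewrite ipDl ?ipDr//; last exact: rL2D.
by rewrite sqrrD !nrm_sqr (ipC g f) -mulr_natr; lra.
Qed.

Lemma nrmN f : rL2 f -> nrm (fun x => - f x) = nrm f.
Proof.
move=> f2; congr Num.sqrt; apply: eq_Rintegral => x _; by rewrite mulrNN.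
Qed.

Lemma nrmB f g : rL2 f -> rL2 g -> nrm (fun x => f x - g x) <= nrm f + nrm g.
Proof. by move=> f2 g2; rewrite -(nrmN g2) nrmD//; exact: rL2N. Qed.

Lemma rL2_norm f : rL2 f -> rL2 (fun x => `|f x|).
Proof.
move=> [mf f2]; split; first exact: measurableT_comp.
by under eq_integral do rewrite real_normK ?num_real//.
Qed.

Lemma nrm_norm f : nrm (fun x => `|f x|) = nrm f.
Proof.
by congr Num.sqrt; apply: eq_Rintegral => x _; rewrite -!expr2 real_normK ?num_real.
Qed.

End real_L2.

Lemma norm_le_sqr {R : realType} (t : R) : `|t| <= 1 + t ^+ 2.
Proof.
have := sqr_ge0 (`|t| - 1); rewrite -[t ^+ 2]real_normK ?num_real//.
by have := normr_ge0 t; nra.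
Qed.

(** * Integrability of real-valued functions *)

Section Rintegrable.
Context {d : measure_display} {T : measurableType d} {R : realType}.
Variables (m : {measure set T -> \bar R}) (D : set T).
Hypothesis mD : measurable D.
Implicit Types f g : T -> R.

Lemma RintegrableZl r f : m.-integrable D (EFin \o f) ->
  m.-integrable D (EFin \o (fun x => r * f x)).
Proof. by move=> /(integrableZl mD r). Qed.

Lemma RintegrableD f g : m.-integrable D (EFin \o f) -> m.-integrable D (EFin \o g) ->
  m.-integrable D (EFin \o (fun x => f x + g x)).
Proof. by move=> /(integrableD mD) h /h. Qed.

Lemma RintegrableB f g : m.-integrable D (EFin \o f) -> m.-integrable D (EFin \o g) ->
  m.-integrable D (EFin \o (fun x => f x - g x)).
Proof. by move=> /(integrableB mD) h /h. Qed.

Lemma le_Rintegrable f g : measurable_fun D f -> (forall x, D x -> `|f x| <= g x) ->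
  m.-integrable D (EFin \o g) -> m.-integrable D (EFin \o f).
Proof.
move=> mf fg; apply: le_integrable => //; first exact/measurable_EFinP.
by move=> x Dx /=; rewrite lee_fin (le_trans (fg x Dx)) ?ler_norm.
Qed.

Lemma ge0_Rintegrable f : measurable_fun D f -> (forall x, D x -> 0 <= f x) ->
  (\int[m]_(x in D) (f x)%:E < +oo)%E -> m.-integrable D (EFin \o f).
Proof.
move=> mf f0 fy; apply/integrableP; split; first exact/measurable_EFinP.
rewrite (eq_integral (fun x => (f x)%:E)) // => x; rewrite inE => Dx /=.
by rewrite ger0_norm ?f0.
Qed.

Lemma EFin_Rintegral f : m.-integrable D (EFin \o f) ->
  (\int[m]_(x in D) f x)%:E = (\int[m]_(x in D) (f x)%:E)%E.
Proof. by move=> fi; rewrite fineK//; exact: integrable_fin_num. Qed.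

End Rintegrable.

(** * Jensen's inequality for a weight of mass at most 1 *)

Section jensen.
Context {d : measure_display} {T : measurableType d} {R : realType}.
Variable m : {measure set T -> \bar R}.

Lemma integrable_weighted (w f : T -> R) :
  measurable_fun setT w -> measurable_fun setT f -> (forall x, 0 <= w x) ->
  (\int[m]_x (w x)%:E < +oo)%E -> (\int[m]_x (w x * f x ^+ 2)%:E < +oo)%E ->
  m.-integrable setT (EFin \o (fun x => w x * `|f x|)).
Proof.
move=> mw mf w0 wy wf.
have iw : m.-integrable setT (EFin \o w) by exact: ge0_Rintegrable.
have iwf2 : m.-integrable setT (EFin \o (fun x => w x * f x ^+ 2)).
  apply: ge0_Rintegrable => //.
    by apply: measurable_funM => //; exact: measurable_funX.
  by move=> x _; rewrite mulr_ge0 ?sqr_ge0.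
apply: le_Rintegrable (RintegrableD measurableT iw iwf2) => //.
  by apply: measurable_funM => //; exact: measurableT_comp.
move=> x _; rewrite normrM normr_id (ger0_norm (w0 x)).
by apply: le_trans (ler_wpM2l (w0 x) (norm_le_sqr (f x))) _; rewrite mulrDr mulr1.
Qed.

(* Jensen's inequality for the square: with [a := \int w |f|], integrate
   [2 a |f| <= a ^+ 2 + f ^+ 2] against [w]. *)
Lemma sqr_Rintegral_le (w f : T -> R) :
  measurable_fun setT w -> measurable_fun setT f -> (forall x, 0 <= w x) ->
  (\int[m]_x (w x)%:E <= 1)%E ->
  (((\int[m]_x (w x * f x)) ^+ 2)%:E <= \int[m]_x (w x * f x ^+ 2)%:E)%E.
Proof.
move=> mw mf w0 w1.
have [->|] := eqVneq (\int[m]_x (w x * f x ^+ 2)%:E)%E +oo%E; first exact: leey.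
rewrite -ltey => wf.
have wy : (\int[m]_x (w x)%:E < +oo)%E by exact: le_lt_trans w1 (ltry _).
have iw : m.-integrable setT (EFin \o w) by exact: ge0_Rintegrable.
have iwf := integrable_weighted mw mf w0 wy wf.
have iwf2 : m.-integrable setT (EFin \o (fun x => w x * f x ^+ 2)).
  apply: ge0_Rintegrable => //.
    by apply: measurable_funM => //; exact: measurable_funX.
  by move=> x _; rewrite mulr_ge0 ?sqr_ge0.
pose a := \int[m]_x (w x * `|f x|).
have a0 : 0 <= a by apply: Rintegral_ge0 => x _; rewrite mulr_ge0.
have wfa : `|\int[m]_x (w x * f x)| <= a.
  have iwf' : m.-integrable setT (EFin \o (fun x => w x * f x)).
    apply: le_Rintegrable iwf => //; first exact: measurable_funM.
    by move=> x _; rewrite normrM (ger0_norm (w0 x)).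
  apply: le_trans (le_normr_Rintegral _ iwf') _ => //.
  by apply: le_Rintegral => //; [exact: integrable_norm|
    move=> x _; rewrite normrM (ger0_norm (w0 x))].
rewrite -(EFin_Rintegral measurableT iwf2) lee_fin.
have W1 : \int[m]_x w x <= 1 by rewrite -lee_fin EFin_Rintegral.
have aE : a = \int[m]_x (w x * `|f x|) by [].
clearbody a; have key : 2 * a * a <= a ^+ 2 * \int[m]_x w x + \int[m]_x (w x * f x ^+ 2).
  have iaw := RintegrableZl measurableT (a ^+ 2) iw.
  have -> : 2 * a * a = \int[m]_x (2 * a * (w x * `|f x|)).
    by rewrite RintegralZl// -aE.
  rewrite -RintegralZl// -RintegralD//.
  apply: le_Rintegral => //; [exact: RintegrableZl|exact: RintegrableD|].
  move=> x _; have := sqr_ge0 (a - `|f x|); rewrite -(@real_normK _ (f x)) ?num_real//.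
  move=> /(mulr_ge0 (w0 x)). nra.
apply: (@le_trans _ _ (a ^+ 2)).
  by rewrite -real_normK ?num_real// lerXn2r ?nnegrE.
have := mulr_ge0 (sqr_ge0 a) (_ : 0 <= 1 - \int[m]_x w x); rewrite subr_ge0 => /(_ W1).
lra.
Qed.

End jensen.

Section parametric_integral.
Context {d1 d2 : measure_display} {T1 : measurableType d1} {T2 : measurableType d2}
  {R : realType}.

(** The slices need not be integrable: the integral is a difference of two Tonelli integrals, each
    measurable with values in the extended reals, and [fine] keeps measurability. *)
Lemma measurable_Rintegral (m2 : {sigma_finite_measure set T2 -> \bar R})
    (F : T1 * T2 -> R) : measurable_fun setT F ->
  measurable_fun setT (fun x => \int[m2]_y F (x, y)).
Proof.
move=> mF; have mEF : measurable_fun setT (EFin \o F) by exact/measurable_EFinP.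
have -> : (fun x => \int[m2]_y F (x, y)) =
    (fun x => fine ((\int[m2]_y (EFin \o F)^\+ (x, y)) -
                    (\int[m2]_y (EFin \o F)^\- (x, y)))%E).
  apply/funext => x; congr fine; rewrite integralE; congr (_ - _)%E.
    by apply: eq_integral => y _; rewrite !funeposE.
  by apply: eq_integral => y _; rewrite !funenegE.
apply: measurableT_comp => //; apply: emeasurable_funB.
  by apply: measurable_fun_fubini_tonelli_F => //; exact: measurable_funepos.
by apply: measurable_fun_fubini_tonelli_F => //; exact: measurable_funeneg.
Qed.

End parametric_integral.

(** * Symmetric sub-Markov kernels *)

(* In the library the sigma-finiteness of [m1 \x m2] is only inferable for
   subprobabilities. *)
Section square_measure.
Context {d : measure_display} {X : measurableType d} {R : realType}.
Variable mu : {sigma_finite_measure set X -> \bar R}.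

Definition sqm : set (X * X) -> \bar R := (mu \x mu)%E.

HB.instance Definition _ := Measure.copy sqm (mu \x mu)%E.

Let sqm_sigma_finite : sigma_finite setT sqm.
Proof.
have /sigma_finiteP[F [TF ndF Foo]] := sigma_finiteT mu.
exists (fun n => F n `*` F n).
  apply/seteqP; split=> [[x y] _|//].
  have [[i _ Fx] [j _ Fy]] : (\bigcup_i F i) x /\ (\bigcup_i F i) y by rewrite -TF.
  by exists (maxn i j) => //; split; [move: x Fx|move: y Fy];
    apply/subsetPset/ndF; rewrite ?leq_maxl ?leq_maxr.
move=> n; have [mF Fn] := Foo n; split; first exact: measurableX.
by rewrite /sqm product_measure1E// lte_mul_pinfty// ge0_fin_numE.
Qed.

HB.instance Definition _ := Measure_isSigmaFinite.Build _ _ _ sqm sqm_sigma_finite.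

End square_measure.

Section kernels.
Context {d : measure_display} {X : measurableType d} {R : realType}.
Variable mu : {sigma_finite_measure set X -> \bar R}.
Implicit Types (k : X -> X -> R) (f g h : X -> R).

(** Common frame for the heat kernel at a fixed time and for its Laplace transform. The conditions
    hold at every point, so that slices [k x] can be used for each [x]. *)
Record subker k : Prop := {
  subker_measurable : measurable_fun setT (fun z : X * X => k z.1 z.2);
  subker_ge0 : forall x y, 0 <= k x y;
  subker_sym : forall x y, k x y = k y x;
  subker_le1 : forall x, (\int[mu]_y (k x y)%:E <= 1)%E
}.

(** Where [k x y * f y] is not integrable in [y], the value is the default 0; for [f] in L^2 this
    can only happen on a null set of [x]. *)
Definition kop k f : X -> R := fun x => \int[mu]_y (k x y * f y).

Lemma subker_slice k x : subker k -> measurable_fun setT (k x).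
Proof.
by move=> hk; exact: (measurableT_comp (subker_measurable hk) (pair1_measurable x)).
Qed.

Lemma measurable_kopF k f : subker k -> measurable_fun setT f ->
  measurable_fun setT (fun z : X * X => k z.1 z.2 * f z.2).
Proof.
move=> hk mf; apply: measurable_funM; first exact: subker_measurable.
exact: measurableT_comp mf measurable_snd.
Qed.

Lemma measurable_kop k f : subker k -> measurable_fun setT f ->
  measurable_fun setT (kop k f).
Proof.
by move=> hk mf; apply: (measurable_Rintegral mu (measurable_kopF hk mf)).
Qed.

Lemma sqr_kop_le k f x : subker k -> measurable_fun setT f ->
  ((kop k f x ^+ 2)%:E <= \int[mu]_y (k x y * f y ^+ 2)%:E)%E.
Proof.
move=> hk mf; apply: sqr_Rintegral_le => //.
- exact: subker_slice.
- exact: subker_ge0.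
- exact: subker_le1.
Qed.

Lemma measurable_kop_sqr k f : subker k -> measurable_fun setT f ->
  measurable_fun setT (fun z : X * X => (k z.1 z.2 * f z.2 ^+ 2)%:E).
Proof.
move=> hk mf; apply/measurable_EFinP.
by apply: (measurable_kopF hk (f := fun y => f y ^+ 2)); exact: measurable_funX.
Qed.

Lemma kop_sqr_ge0 k f x y : subker k -> (0 <= (k x y * f y ^+ 2)%:E)%E.
Proof. by move=> hk; rewrite lee_fin mulr_ge0 ?sqr_ge0// subker_ge0. Qed.

(** After Tonelli the inner integral runs over the first variable; symmetry turns the bound on row
    masses into one on column masses. With [sqr_kop_le] this is Schur's test for the L^2
    contraction. *)
Lemma integral_kop_sqr k f : subker k -> measurable_fun setT f ->
  (\int[mu]_x \int[mu]_y (k x y * f y ^+ 2)%:E <= \int[mu]_y (f y ^+ 2)%:E)%E.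
Proof.
move=> hk mf.
rewrite (fubini_tonelli (fun z : X * X => (k z.1 z.2 * f z.2 ^+ 2)%:E))/=; last 2 first.
- exact: measurable_kop_sqr.
- by move=> z; exact: kop_sqr_ge0.
apply: ge0_le_integral => //.
- by move=> y _; apply: integral_ge0 => x _; exact: kop_sqr_ge0.
- apply: (measurable_fun_fubini_tonelli_G (fun z : X * X => (k z.1 z.2 * f z.2 ^+ 2)%:E)).
    exact: measurable_kop_sqr.
  by move=> z; exact: kop_sqr_ge0.
- exact: measurable_sqr.
move=> y _; under eq_integral do rewrite mulrC EFinM (subker_sym hk).
rewrite ge0_integralZl_EFin ?sqr_ge0//.
- by rewrite -[leRHS]mule1 lee_wpmul2l ?lee_fin ?sqr_ge0 ?subker_le1.
- by move=> x _; rewrite lee_fin subker_ge0.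
- by apply/measurable_EFinP; exact: subker_slice.
Qed.

Lemma kop_contraction k f : subker k -> measurable_fun setT f ->
  (\int[mu]_x (kop k f x ^+ 2)%:E <= \int[mu]_x (f x ^+ 2)%:E)%E.
Proof.
move=> hk mf; apply: le_trans (integral_kop_sqr hk mf).
apply: ge0_le_integral => //.
- by move=> x _; rewrite lee_fin sqr_ge0.
- by apply: measurable_sqr; exact: measurable_kop.
- apply: (measurable_fun_fubini_tonelli_F (fun z : X * X => (k z.1 z.2 * f z.2 ^+ 2)%:E)).
    exact: measurable_kop_sqr.
  by move=> z; exact: kop_sqr_ge0.
- by move=> x _; exact: sqr_kop_le.
Qed.

Lemma rL2_kop k f : subker k -> rL2 mu f -> rL2 mu (kop k f).
Proof.
move=> hk [mf f2]; split; first exact: measurable_kop.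
exact: le_lt_trans (kop_contraction hk mf) f2.
Qed.

Lemma ip_kop_le k f : subker k -> rL2 mu f -> ip mu (kop k f) (kop k f) <= ip mu f f.
Proof.
move=> hk f2; rewrite -lee_fin -!integral_sqrE//; last exact: rL2_kop.
by apply: kop_contraction => //; case: f2.
Qed.

Lemma nrm_kop k f : subker k -> rL2 mu f -> nrm mu (kop k f) <= nrm mu f.
Proof. by move=> hk f2; rewrite ler_wsqrtr// ip_kop_le. Qed.

Lemma measurable_kform k f h : subker k -> measurable_fun setT f ->
  measurable_fun setT h ->
  measurable_fun setT (fun z : X * X => k z.1 z.2 * f z.2 * h z.1).
Proof.
move=> hk mf mh; apply: measurable_funM; first exact: measurable_kopF.
exact: measurableT_comp mh measurable_fst.
Qed.

(** [|k f h|] is at most [k f^2 + k h^2]. One term is integrated in each order of the two variables,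
    so that both reduce to [integral_kop_sqr]. *)
Lemma integrable_kform k f h : subker k -> rL2 mu f -> rL2 mu h ->
  (sqm mu).-integrable setT
    (EFin \o (fun z : X * X => k z.1 z.2 * f z.2 * h z.1)).
Proof.
rewrite /sqm => hk f2 h2; have [mf fy] := f2; have [mh hy] := h2.
have int1 g : rL2 mu g -> (mu \x mu)%E.-integrable setT
    (EFin \o (fun z : X * X => k z.1 z.2 * g z.2 ^+ 2)).
  move=> [mg gy]; apply/integrable12ltyP; first exact: measurable_kop_sqr.
  apply: le_lt_trans gy => /=; apply: le_trans (integral_kop_sqr hk mg).
  rewrite le_eqVlt; apply/orP; left; apply/eqP.
  apply: eq_integral => x _; apply: eq_integral => y _.
  by rewrite ger0_norm// mulr_ge0 ?sqr_ge0 ?subker_ge0.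
have int2 g : rL2 mu g -> (mu \x mu)%E.-integrable setT
    (EFin \o (fun z : X * X => k z.1 z.2 * g z.1 ^+ 2)).
  move=> [mg gy].
  have mk : measurable_fun setT (EFin \o (fun z : X * X => k z.1 z.2 * g z.1 ^+ 2)).
    apply/measurable_EFinP; apply: measurable_funM; first exact: subker_measurable.
    apply: (measurableT_comp (f := fun x => g x ^+ 2)) measurable_fst.
    exact: measurable_funX.
  apply/integrable21ltyP => //.
  apply: le_lt_trans gy => /=; apply: le_trans (integral_kop_sqr hk mg).
  rewrite le_eqVlt; apply/orP; left; apply/eqP.
  apply: eq_integral => x _; apply: eq_integral => y _.
  by rewrite ger0_norm ?(subker_sym hk y x)// mulr_ge0 ?sqr_ge0 ?subker_ge0.
apply: le_Rintegrable (RintegrableD measurableT (int1 _ f2) (int2 _ h2)) => //.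
  exact: measurable_kform.
move=> z _; rewrite -mulrA normrM -mulrDr ger0_norm ?subker_ge0//.
apply: ler_wpM2l; first exact: subker_ge0.
have := sqr_ge0 (f z.2 - h z.1); have := sqr_ge0 (f z.2 + h z.1).
by rewrite ler_norml => ? ?; apply/andP; split; nra.
Qed.

Lemma ip_kopE k f h : subker k -> rL2 mu f -> rL2 mu h ->
  ip mu (kop k f) h = \int[sqm mu]_z (k z.1 z.2 * f z.2 * h z.1).
Proof.
move=> hk f2 h2; have := integrable_kform hk f2 h2 => ikf.
rewrite /Rintegral -(integral12_prod_meas1 ikf)//; congr fine.
apply: ae_eq_integral => //.
- apply/measurable_EFinP; apply: measurable_funM; last by case: h2.
  by apply: measurable_kop => //; case: f2.
- exact: (measurable_fubini_F ikf).
have := ae_integrable1 ikf; apply: filterS => x /= ix _; rewrite /fubini_F/=.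
(* Integrability of the slice says nothing about [k x y * f y] when [h x = 0], but then both sides
   vanish; otherwise one divides by [h x]. *)
have [hx0|hx0] := eqVneq (h x) 0.
  by under eq_integral do rewrite hx0 mulr0; rewrite integral0 hx0 mulr0.
have ix' : mu.-integrable setT (EFin \o (fun y => k x y * f y)).
  have := RintegrableZl measurableT (h x)^-1 ix.
  by apply: eq_integrable => // y _ /=; congr (_%:E); field.
rewrite /kop mulrC -RintegralZl// EFin_Rintegral//.
  by apply: eq_integral => y _; rewrite mulrC.
exact: RintegrableZl.
Qed.

Lemma EFin_ip_kop k f h c : subker k -> rL2 mu f -> rL2 mu h ->
  (c * ip mu (kop k f) h)%:E =
  (\int[sqm mu]_z (c * (k z.1 z.2 * f z.2 * h z.1))%:E)%E.
Proof.
move=> hk f2 h2; have ikf := integrable_kform hk f2 h2.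
have ickf := RintegrableZl measurableT c ikf.
rewrite -(EFin_Rintegral measurableT ickf) ip_kopE//.
by rewrite (RintegralZl c measurableT ikf).
Qed.

(** Both sides are one double integral, computed in its two orders by Fubini. *)
Lemma ip_kop_sym k f h : subker k -> rL2 mu f -> rL2 mu h ->
  ip mu (kop k f) h = ip mu f (kop k h).
Proof.
move=> hk f2 h2; have := integrable_kform hk f2 h2 => ikf.
rewrite ip_kopE// ipC ip_kopE//.
have ikh := integrable_kform hk h2 f2.
rewrite /Rintegral -(integral12_prod_meas1 ikf) -(integral21_prod_meas1 ikh); congr fine.
apply: eq_integral => x _; apply: eq_integral => y _ /=.
by rewrite (subker_sym hk y x) mulrAC.
Qed.

End kernels.

(** * Averages of kernels over a parameter *)

Section mixture.
Context {d : measure_display} {X : measurableType d} {R : realType}.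
Variable mu : {sigma_finite_measure set X -> \bar R}.
Context {dT : measure_display} {T : measurableType dT}.
Variable m : {sigma_finite_measure set T -> \bar R}.
Variables (w : T -> R) (q : T -> X -> X -> R).
Hypothesis mw : measurable_fun setT w.
Hypothesis w0 : forall t, 0 <= w t.
Hypothesis w1 : (\int[m]_t (w t)%:E <= 1)%E.
Hypothesis mq : measurable_fun setT (fun z : T * X * X => q z.1.1 z.1.2 z.2).
Hypothesis hq : forall t, subker mu (q t).
Implicit Types f h : X -> R.

Definition mixk (x y : X) : R := \int[m]_t (w t * q t x y).

Let measurable_wq : measurable_fun setT (fun z : T * (X * X) => w z.1 * q z.1 z.2.1 z.2.2).
Proof.
apply: measurable_funM; first exact: measurableT_comp mw measurable_fst.
apply: (measurableT_comp mq (g := fun z : T * (X * X) => (z.1, z.2.1, z.2.2))).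
apply: measurable_fun_pair; last exact: measurableT_comp measurable_snd measurable_snd.
by apply: measurable_fun_pair; last exact: measurableT_comp measurable_fst measurable_snd.
Qed.

Let wq_ge0 t x y : 0 <= w t * q t x y.
Proof. by rewrite mulr_ge0// (subker_ge0 (hq t)). Qed.

(** Only an inequality: where the integral over [t] diverges, as may happen for the Green kernel on
    the diagonal, [mixk] takes the default value 0. *)
Let mixk_le x y : ((mixk x y)%:E <= \int[m]_t (w t * q t x y)%:E)%E.
Proof.
rewrite /mixk /Rintegral.
have : (0 <= \int[m]_t (w t * q t x y)%:E)%E.
  by apply: integral_ge0 => t _; rewrite lee_fin.
by case: (\int[m]_t (w t * q t x y)%:E)%E => //= _; rewrite leey.
Qed.

Lemma subker_mixk : subker mu mixk.
Proof.
split.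
- apply: (@measurable_Rintegral _ _ _ _ _ m (fun u : X * X * T => w u.2 * q u.2 u.1.1 u.1.2)).
  by apply: (measurableT_comp measurable_wq (g := fun u : X * X * T => (u.2, u.1))); exact: measurable_fun_pair.
- by move=> x y; apply: Rintegral_ge0.
- by move=> x y; apply: eq_Rintegral => t _; rewrite (subker_sym (hq t)).
- move=> x.
  have mx : measurable_fun setT (fun u : X * T => (w u.2 * q u.2 x u.1)%:E).
    apply/measurable_EFinP.
    apply: (measurableT_comp measurable_wq (g := fun u : X * T => (u.2, (x, u.1)))).
    by apply: measurable_fun_pair => //; exact: measurable_fun_pair.
  apply: (@le_trans _ _ (\int[mu]_y \int[m]_t (w t * q t x y)%:E)%E).
    apply: ge0_le_integral => //.
    + by move=> y _; rewrite lee_fin; exact: Rintegral_ge0.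
    + apply/measurable_EFinP.
      apply: (@measurable_Rintegral _ _ _ _ _ m (fun u : X * T => w u.2 * q u.2 x u.1)).
      exact/measurable_EFinP.
    + apply: (measurable_fun_fubini_tonelli_F (fun u : X * T => (w u.2 * q u.2 x u.1)%:E)) => //.
      by move=> u; rewrite lee_fin.
  rewrite (fubini_tonelli (fun u : X * T => (w u.2 * q u.2 x u.1)%:E))//=; last first.
    by move=> u; rewrite lee_fin.
  apply: le_trans w1; apply: ge0_le_integral => //.
  + by move=> t _; apply: integral_ge0 => y _; rewrite lee_fin.
  + apply: (measurable_fun_fubini_tonelli_G (fun u : X * T => (w u.2 * q u.2 x u.1)%:E)) => //.
    by move=> u; rewrite lee_fin.
  + exact/measurable_EFinP.
  + move=> t _; under eq_integral do rewrite EFinM.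
    rewrite ge0_integralZl_EFin//.
    * by rewrite -[leRHS]mule1 lee_wpmul2l ?lee_fin ?(subker_le1 (hq t)).
    * by move=> y _; rewrite lee_fin (subker_ge0 (hq t)).
    * by apply/measurable_EFinP; exact: subker_slice (hq t).
Qed.

(* Weighted Jensen inequality: [w b / C] has mass at most 1, and
   [w = (w b / C) * (C / b)]. *)
Lemma sqr_kop_mixk_le (b : T -> R) (C : R) f x : measurable_fun setT b ->
  (forall t, 0 < b t) -> 0 < C -> (\int[m]_t (w t * b t)%:E <= C%:E)%E ->
  measurable_fun setT f ->
  (forall t, mu.-integrable setT (EFin \o (fun y => q t x y * f y))) ->
  ((kop mu mixk f x ^+ 2)%:E <=
    C%:E * \int[m]_t (w t / b t * kop mu (q t) (fun y => `|f y|) x ^+ 2)%:E)%E.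
Proof.
move=> mb b0 C0 wbC mf iqf.
set A := fun t => kop mu (q t) (fun y => `|f y|) x.
have A0 t : 0 <= A t.
  by apply: Rintegral_ge0 => y _; rewrite mulr_ge0// (subker_ge0 (hq t)).
have mqf : measurable_fun setT (fun z : T * X => q z.1 x z.2 * `|f z.2|).
  apply: measurable_funM.
    apply: (measurableT_comp mq (g := fun z : T * X => (z.1, x, z.2))).
    by apply: measurable_fun_pair => //; exact: measurable_fun_pair.
  by apply: measurableT_comp => //; exact: measurableT_comp mf measurable_snd.
have mA : measurable_fun setT A by apply: (measurable_Rintegral mu mqf).
have mV : measurable_fun setT (fun t => (b t)^-1).
  rewrite (_ : (fun t => (b t)^-1) = (fun t => b t `^ (-1))).
    exact: (measurableT_comp (measurable_powR (-1)) mb).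
  by apply/funext => t; rewrite powR_inv1// ltW.
pose W t := w t * b t / C; pose phi t := C / b t * A t.
have mW : measurable_fun setT W by do 2 apply: measurable_funM => //.
have mphi : measurable_fun setT phi by do 2 apply: measurable_funM => //.
have W0 t : 0 <= W t by rewrite mulr_ge0 ?invr_ge0 ?mulr_ge0// ltW.
have WE t : W t * phi t = w t * A t.
  by rewrite /W /phi; field; rewrite !gt_eqF.
have W2E t : W t * phi t ^+ 2 = C * (w t / b t * A t ^+ 2).
  by rewrite /W /phi; field; rewrite !gt_eqF.
have W1 : (\int[m]_t (W t)%:E <= 1)%E.
  under eq_integral do rewrite /W mulrC EFinM.
  rewrite ge0_integralZl_EFin// ?invr_ge0 ?(ltW C0)//.
  - rewrite -[leRHS](_ : C^-1%:E * C%:E = 1)%E ?lee_wpmul2l ?lee_fin ?invr_ge0 ?(ltW C0)//.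
    by rewrite -EFinM mulVf ?gt_eqF.
  - by move=> t _; rewrite lee_fin mulr_ge0// ltW.
  - by apply/measurable_EFinP; exact: measurable_funM.
have -> : (C%:E * \int[m]_t (w t / b t * A t ^+ 2)%:E = \int[m]_t (W t * phi t ^+ 2)%:E)%E.
  rewrite -ge0_integralZl_EFin ?(ltW C0)//.
  - by apply: eq_integral => t _; rewrite W2E EFinM.
  - by move=> t _; rewrite lee_fin mulr_ge0 ?sqr_ge0// divr_ge0// ltW.
  - apply/measurable_EFinP; apply: measurable_funM; first exact: measurable_funM.
    exact: measurable_funX.
have [->|] := eqVneq (\int[m]_t (W t * phi t ^+ 2)%:E)%E +oo%E; first exact: leey.
rewrite -ltey => fin; apply: le_trans (sqr_Rintegral_le mW mphi W0 W1).
(* Since [W * phi = w * A], finiteness of the right-hand side and of the mass of [W] gives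
   integrability of [w * A]; its [Rintegral] is then the true integral. *)
have iwA : m.-integrable setT (EFin \o (fun t => w t * A t)).
  have := integrable_weighted mW mphi W0 (le_lt_trans W1 (ltry _)) fin.
  apply: eq_integrable => // t _ /=; rewrite ger0_norm ?WE//.
  by rewrite mulr_ge0// divr_ge0// ltW.
have mmix := subker_slice x subker_mixk.
have mwqf : measurable_fun setT (fun z : T * X => (w z.1 * (q z.1 x z.2 * `|f z.2|))%:E).
  apply/measurable_EFinP; apply: measurable_funM => //.
  exact: measurableT_comp mw measurable_fst.
have wqf0 z : (0 <= (w z.1 * (q z.1 x z.2 * `|f z.2|))%:E)%E.
  by rewrite lee_fin mulrA mulr_ge0.
have le1 : (\int[mu]_y (mixk x y * `|f y|)%:E <= (\int[m]_t (w t * A t))%:E)%E.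
  rewrite EFin_Rintegral//.
  apply: (@le_trans _ _ (\int[mu]_y \int[m]_t (w t * (q t x y * `|f y|))%:E)%E).
    apply: ge0_le_integral => //.
    - by move=> y _; rewrite lee_fin mulr_ge0// (subker_ge0 subker_mixk).
    - by apply/measurable_EFinP; apply: measurable_funM => //; exact: measurableT_comp.
    - exact: (measurable_fun_fubini_tonelli_G _ mwqf wqf0).
    move=> y _; under eq_integral do rewrite mulrA EFinM.
    rewrite ge0_integralZr//.
    - by rewrite EFinM lee_wpmul2r ?lee_fin.
    - apply/measurable_EFinP.
      apply: (measurableT_comp measurable_wq (g := fun t => (t, (x, y)))).
      exact: measurable_fun_pair.
    - by move=> t _; rewrite lee_fin.
  rewrite -(fubini_tonelli _ mwqf wqf0)/=.
  rewrite le_eqVlt; apply/orP; left; apply/eqP; apply: eq_integral => t _.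
  (* This is where [iqf] enters: it makes [A t] a true integral and not the default 0. *)
  have iqa : mu.-integrable setT (EFin \o (fun y => q t x y * `|f y|)).
    apply: le_Rintegrable (integrable_norm (iqf t)) => //=.
      exact: (measurableT_comp mqf (pair1_measurable t)).
    by move=> y _; rewrite !normrM normr_id.
  rewrite /A /kop -RintegralZl// EFin_Rintegral//; exact: RintegrableZl.
have imf : mu.-integrable setT (EFin \o (fun y => mixk x y * `|f y|)).
  apply: ge0_Rintegrable => //.
  - by apply: measurable_funM => //; exact: measurableT_comp.
  - by move=> y _; rewrite mulr_ge0// (subker_ge0 subker_mixk).
  - by apply: le_lt_trans le1 (ltry _).
have imf' : mu.-integrable setT (EFin \o (fun y => mixk x y * f y)).
  apply: le_Rintegrable imf => //; first exact: measurable_funM.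
  by move=> y _; rewrite normrM (ger0_norm (subker_ge0 subker_mixk _ _)).
rewrite lee_fin -[leLHS]real_normK ?num_real// -[leRHS]real_normK ?num_real//.
rewrite lerXn2r ?nnegrE//.
apply: le_trans (le_normr_Rintegral _ imf') _ => //.
apply: (@le_trans _ _ (\int[mu]_y (mixk x y * `|f y|))).
  apply: le_Rintegral => //; first exact: integrable_norm.
  by move=> y _; rewrite normrM (ger0_norm (subker_ge0 subker_mixk _ _)).
have -> : \int[m]_t (W t * phi t) = \int[m]_t (w t * A t).
  by apply: eq_Rintegral => t _; rewrite WE.
by apply: le_trans _ (ler_norm _); rewrite -lee_fin EFin_Rintegral.
Qed.

Lemma norm_ip_kop_le k f h : subker mu k -> rL2 mu f -> rL2 mu h ->
  `|ip mu (kop mu k f) h| <= nrm mu f * nrm mu h.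
Proof.
move=> hk f2 h2; apply: le_trans (cauchy_schwarz (rL2_kop hk f2) h2) _.
by rewrite ler_wpM2r ?nrm_ge0// nrm_kop.
Qed.

Let Phi f h (u : T * (X * X)) : R := w u.1 * q u.1 u.2.1 u.2.2 * f u.2.2 * h u.2.1.

Let measurable_Phi f h : measurable_fun setT f -> measurable_fun setT h ->
  measurable_fun setT (Phi f h).
Proof.
move=> mf mh; apply: measurable_funM; first apply: measurable_funM => //.
  by apply: (measurableT_comp mf); exact: measurableT_comp measurable_snd measurable_snd.
by apply: (measurableT_comp mh); exact: measurableT_comp measurable_fst measurable_snd.
Qed.

(** Integrating absolute values over the two space variables first gives
    [w t * ip (kop (q t) |f|) |h|], which the contraction bounds by [w t] times the product of the
    norms. *)
Let integrable_Phi f h : rL2 mu f -> rL2 mu h ->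
  (m \x sqm mu)%E.-integrable setT (EFin \o Phi f h).
Proof.
move=> f2 h2; have [mf _] := f2; have [mh _] := h2.
have mP : measurable_fun setT (EFin \o Phi f h) by apply/measurable_EFinP; exact: measurable_Phi.
apply (@integrable12ltyP _ _ _ _ _ m (sqm mu) _ mP).2.
pose c := nrm mu f * nrm mu h.
apply: (@le_lt_trans _ _ (\int[m]_t (c%:E * (w t)%:E))%E).
  apply: ge0_le_integral => //.
  - by move=> t _; exact: integral_ge0.
  - apply: (measurable_fun_fubini_tonelli_F (fun u => `|(EFin \o Phi f h) u|)%E) => //.
    exact: measurableT_comp.
  - by apply: measurable_funeM; exact/measurable_EFinP.
  move=> t _ /=; have nf2 := rL2_norm f2; have nh2 := rL2_norm h2.
  have -> : (\int[sqm mu]_y `|Phi f h (t, y)|%:E)%E =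
      (w t * ip mu (kop mu (q t) (fun x => `|f x|)) (fun x => `|h x|))%:E.
    rewrite EFin_ip_kop//.
    apply: eq_integral => z _; rewrite /Phi/= !normrM !(ger0_norm (w0 _)).
    by rewrite (ger0_norm (subker_ge0 (hq t) _ _)) !mulrA.
  rewrite -EFinM lee_fin mulrC ler_wpM2r// /c -(nrm_norm mu f) -(nrm_norm mu h).
  by apply: le_trans (ler_norm _) _; exact: norm_ip_kop_le.
rewrite ge0_integralZl_EFin//.
- by rewrite lte_mul_pinfty// ?(le_lt_trans w1 (ltry _))// lee_fin mulr_ge0 ?nrm_ge0.
- by move=> t _; rewrite lee_fin.
- exact/measurable_EFinP.
- by rewrite mulr_ge0 ?nrm_ge0.
Qed.

Let PhiE f h t : rL2 mu f -> rL2 mu h ->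
  (\int[sqm mu]_z (Phi f h (t, z))%:E)%E = (w t * ip mu (kop mu (q t) f) h)%:E.
Proof.
move=> f2 h2; rewrite EFin_ip_kop//.
by apply: eq_integral => z _; rewrite /Phi/= !mulrA.
Qed.

Lemma integrable_mix f h : rL2 mu f -> rL2 mu h ->
  m.-integrable setT (EFin \o (fun t => w t * ip mu (kop mu (q t) f) h)).
Proof.
move=> f2 h2; have := integrable_fubini_F (integrable_Phi f2 h2).
by apply: eq_integrable => // t _; rewrite /fubini_F/= PhiE.
Qed.

Lemma ip_mixk f h : rL2 mu f -> rL2 mu h ->
  ip mu (kop mu mixk f) h = \int[m]_t (w t * ip mu (kop mu (q t) f) h).
Proof.
move=> f2 h2; have iP := integrable_Phi f2 h2.
rewrite ip_kopE//; last exact: subker_mixk.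
have := Fubini iP; rewrite /Rintegral => FE; congr fine.
transitivity (\int[m]_t \int[sqm mu]_z (EFin \o Phi f h) (t, z))%E; last first.
  by apply: eq_integral => t _; rewrite -PhiE.
rewrite FE; apply: ae_eq_integral => //.
- apply/measurable_EFinP; apply: measurable_kform; [exact: subker_mixk| by case: f2|by case: h2].
- exact: (measurable_fubini_G iP).
have := ae_integrable2 iP; apply: filterS => -[x y] /= ix _.
(* As in [ip_kopE]: if the factor vanishes both sides are 0, otherwise dividing by it shows that
   [mixk x y] is a convergent integral. *)
have [fh0|fh0] := eqVneq (f y * h x) 0.
  rewrite -mulrA fh0 mulr0 integral0_eq// => t _.
  by rewrite /Phi/= -mulrA fh0 mulr0.
have ix' : m.-integrable setT (EFin \o (fun t => w t * q t x y)).
  have := RintegrableZl measurableT (f y * h x)^-1 ix.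
  by apply: eq_integrable => // t _ /=; rewrite /Phi/= -[_ * _ * f y * h x]mulrA mulrC mulfK.
rewrite -mulrA mulrC /mixk -RintegralZl// EFin_Rintegral//.
  by apply: eq_integral => t _; congr (_%:E); rewrite /Phi/=; ring.
exact: RintegrableZl.
Qed.

End mixture.

(** * The heat semigroup and the Green kernel *)

Section heat.
Context {d : measure_display} {X : measurableType d} {R : realType}.
Variable mu : {sigma_finite_measure set X -> \bar R}.
Variables (p : R -> X -> X -> R) (hp : heat_kernel mu p).
Implicit Types (f g h : X -> R) (t s : R).

(** Extending by 0 to [t <= 0] gives a measurable family of sub-Markov kernels over the whole line.
    Note that [hk 0] is the zero kernel, whereas [heat_op] at time 0 is the identity. *)
Definition hk t (x y : X) : R := if 0 < t then p t x y else 0.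

Definition exp_weight t : R := if 0 < t then expR (- t) else 0.

Lemma hkE t : 0 < t -> hk t = p t.
Proof. by move=> t0; apply/funext => x; apply/funext => y; rewrite /hk t0. Qed.

Lemma measurable_hk : measurable_fun setT (fun z : R * X * X => hk z.1.1 z.1.2 z.2).
Proof.
have mD : measurable [set z : R * X * X | 0 < z.1.1].
  have -> : [set z : R * X * X | 0 < z.1.1] = (fun z => z.1.1) @^-1` `]0, +oo[%classic.
    by apply/seteqP; split=> z /=; rewrite in_itv/= andbT.
  rewrite -[X in measurable X]setTI.
  by apply: (measurableT_comp measurable_fst measurable_fst) => //.
have := heat_kernel_measurable hp => /(measurable_restrictT _ mD).
congr measurable_fun; apply/funext => z; rewrite patchE /hk.
by rewrite mem_setE.
Qed.

Lemma subker_hk t : subker mu (hk t).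
Proof.
have mt : measurable_fun setT (fun z : X * X => hk t z.1 z.2).
  apply: (measurableT_comp measurable_hk (g := fun z : X * X => (t, z.1, z.2))).
  by apply: measurable_fun_pair => //; exact: measurable_fun_pair.
have [t0|t0] := ltP 0 t; split => //.
- by move=> x y; rewrite hkE// (heat_kernel_ge0 hp).
- by move=> x y; rewrite hkE// (heat_kernel_sym hp).
- by move=> x; rewrite hkE//; exact: (heat_kernel_le1 hp).
- by move=> x y; rewrite /hk ltNge t0.
- by move=> x y; rewrite /hk ltNge t0.
- by move=> x; rewrite /hk ltNge t0/= integral0.
Qed.

Lemma hk_semigroup t s x y : 0 < t -> 0 < s ->
  kop mu (hk s) (hk t x) y = hk (t + s) x y.
Proof.
move=> t0 s0; have := heat_kernel_semigroup hp x y t0 s0.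
rewrite /kop !hkE ?addr_gt0// => pE.
rewrite -[RHS]/(fine (p (t + s) x y)%:E) pE; congr fine.
by apply: eq_integral => z _; rewrite mulrC (heat_kernel_sym hp y).
Qed.

Lemma rL2_hk t x : 0 < t -> rL2 mu (hk t x).
Proof.
move=> t0; split; first exact: subker_slice (subker_hk t).
have := heat_kernel_semigroup hp x x t0 t0; rewrite hkE// => pE.
rewrite (eq_integral (fun z => (p t x z * p t z x)%:E)) -?pE ?ltry// => y _.
by rewrite expr2 (heat_kernel_sym hp y).
Qed.

Lemma kop_hkE t f x : kop mu (hk t) f x = ip mu (hk t x) f.
Proof. by []. Qed.

Lemma ip_hk t x : 0 < t -> ip mu (hk t x) (hk t x) = hk (t + t) x x.
Proof. by move=> t0; rewrite -hk_semigroup. Qed.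

(** The left side is the squared norm of [hk t x], the right side that of [hk (t / 2) x], and the
    heat operator at time [t / 2] maps the second slice to the first. It brings the Cauchy-Schwarz
    bound, which naturally involves time [2 t], back to time [t], where the hypothesis on [F2] is
    stated. *)
Lemma hk_diag_le t x : 0 < t -> hk (t + t) x x <= hk t x x.
Proof.
move=> t0; have t20 : 0 < t / 2 by rewrite divr_gt0.
rewrite -ip_hk// [t in X in _ <= X]splitr -ip_hk//.
have -> : hk t x = kop mu (hk (t / 2)) (hk (t / 2) x).
  by apply/funext => y; rewrite hk_semigroup// -splitr.
by apply: ip_kop_le; [exact: subker_hk|exact: rL2_hk].
Qed.

Lemma sqr_kop_hk_le t f x : 0 < t -> rL2 mu f ->
  kop mu (hk t) f x ^+ 2 <= hk t x x * ip mu f f.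
Proof.
move=> t0 f2; apply: (@le_trans _ _ (hk (t + t) x x * ip mu f f)); last first.
  by rewrite ler_wpM2r ?ip_ge0// hk_diag_le.
rewrite kop_hkE -ip_hk// -!nrm_sqr -exprMn -real_normK ?num_real//.
by rewrite lerXn2r ?nnegrE ?mulr_ge0 ?nrm_ge0// cauchy_schwarz//; exact: rL2_hk.
Qed.

Lemma kop_hk_semigroup t s f : 0 < t -> 0 < s -> rL2 mu f ->
  kop mu (hk t) (kop mu (hk s) f) = kop mu (hk (t + s)) f.
Proof.
move=> t0 s0 f2; apply/funext => x.
rewrite !kop_hkE -ip_kop_sym//; [|exact: subker_hk|exact: rL2_hk].
by congr ip; apply/funext => y; rewrite hk_semigroup.
Qed.

Lemma exp_weight_ge0 t : 0 <= exp_weight t.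
Proof. by rewrite /exp_weight; case: ifP => // _; exact: expR_ge0. Qed.

Lemma measurable_exp_weight : measurable_fun setT exp_weight.
Proof.
apply: measurable_fun_if => //.
  exact: measurable_fun_ltr.
by apply: measurable_funTS; apply: measurableT_comp.
Qed.

Lemma exp_weight_le1 : (\int[lebesgue_measure]_t (exp_weight t)%:E <= 1)%E.
Proof.
rewrite -(@integral_exponential_pdf R 1 ltr01); apply: ge0_le_integral => //.
- by move=> t _; rewrite lee_fin exp_weight_ge0.
- by apply/measurable_EFinP; exact: measurable_exp_weight.
- by apply/measurable_EFinP; exact: measurable_exponential_pdf.
move=> t _; rewrite lee_fin /exp_weight; case: ifPn => t0.
  by rewrite exponential_pdfE ?(ltW t0)// mul1r mulN1r.
exact: exponential_pdf_ge0.
Qed.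

(* The kernel of [(H + 1)^-1], as the Laplace transform of the heat kernel. *)
Definition green : X -> X -> R := mixk lebesgue_measure exp_weight hk.

Lemma subker_green : subker mu green.
Proof.
apply: subker_mixk.
- exact: measurable_exp_weight.
- exact: exp_weight_ge0.
- exact: exp_weight_le1.
- exact: measurable_hk.
- exact: subker_hk.
Qed.

Lemma ip_green f h : rL2 mu f -> rL2 mu h ->
  ip mu (kop mu green f) h =
  \int[lebesgue_measure]_t (exp_weight t * ip mu (kop mu (hk t) f) h).
Proof.
apply: ip_mixk.
- exact: measurable_exp_weight.
- exact: exp_weight_ge0.
- exact: exp_weight_le1.
- exact: measurable_hk.
- exact: subker_hk.
Qed.

Lemma integrable_exp_ip f h : rL2 mu f -> rL2 mu h ->
  lebesgue_measure.-integrable setT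
    (EFin \o (fun t => exp_weight t * ip mu (kop mu (hk t) f) h)).
Proof.
apply: integrable_mix.
- exact: measurable_exp_weight.
- exact: exp_weight_ge0.
- exact: exp_weight_le1.
- exact: measurable_hk.
- exact: subker_hk.
Qed.

End heat.

(** * Complex L^2 functions *)

Section complex_L2.
Context {d : measure_display} {X : measurableType d} {R : realType}.
Variable mu : {measure set X -> \bar R}.
Local Notation C := R[i].
Implicit Types f g h : X -> C.

Definition re f : X -> R := fun x => complex.Re (f x).
Definition im f : X -> R := fun x => complex.Im (f x).

(** The real part of the complex inner product. The imaginary part is recovered by multiplying an
    argument by i, see [Im_L2inner]. *)
Definition rip f g : R := ip mu (re f) (re g) + ip mu (im f) (im g).

Lemma normc_sqr (z : C) : normc z ^+ 2 = complex.Re z ^+ 2 + complex.Im z ^+ 2.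
Proof. by case: z => a b /=; rewrite sqr_sqrtr// addr_ge0 ?sqr_ge0. Qed.

Lemma normc_ge0 (z : C) : 0 <= normc z.
Proof. by case: z => a b; exact: sqrtr_ge0. Qed.

Lemma cLnorm2 f : cLnorm mu 2%:E f = ((\int[mu]_x (normc (f x) ^+ 2)%:E) `^ 2^-1)%E.
Proof.
rewrite /cLnorm unlock; congr (_ `^ _)%E; apply: eq_integral => x _ /=.
by rewrite powR_mulrn ?normr_ge0// ger0_norm ?normc_ge0.
Qed.

Lemma L2P f : L2 mu f <-> rL2 mu (re f) /\ rL2 mu (im f).
Proof.
have key : cmeasurable f ->
    (\int[mu]_x (normc (f x) ^+ 2)%:E = \int[mu]_x (re f x ^+ 2)%:E + \int[mu]_x (im f x ^+ 2)%:E)%E.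
  move=> [mre mim]; under eq_integral do rewrite normc_sqr EFinD.
  rewrite ge0_integralD//.
  - by move=> x _; rewrite lee_fin sqr_ge0.
  - exact: measurable_sqr.
  - by move=> x _; rewrite lee_fin sqr_ge0.
  - exact: measurable_sqr.
have sq0 (g : X -> R) : (0 <= \int[mu]_x (g x ^+ 2)%:E)%E.
  by apply: integral_ge0 => x _; rewrite lee_fin sqr_ge0.
split.
  move=> [mf]; rewrite cLnorm2 => fy; have [mre mim] := mf.
  have : (\int[mu]_x (normc (f x) ^+ 2)%:E < +oo)%E.
    move: fy; case: (\int[mu]_x (normc (f x) ^+ 2)%:E)%E => [r _| |//]; first exact: ltry.
    by rewrite poweRyr ?invr_eq0.
  rewrite key// => hfin; split; split=> //; apply: le_lt_trans hfin.
    by rewrite leeDl.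
  by rewrite leeDr.
move=> [[mre hre] [mim him]]; have mf : cmeasurable f by split.
split=> //; rewrite cLnorm2 key// poweR_lty// lte_add_pinfty//.
Qed.

Lemma L2normE f : L2 mu f -> L2norm mu f = (Num.sqrt (rip f f))%:E.
Proof.
move=> /L2P[f1 f2]; rewrite /L2norm cLnorm2.
have -> : (\int[mu]_x (normc (f x) ^+ 2)%:E = (rip f f)%:E)%E.
  under eq_integral do rewrite normc_sqr EFinD.
  rewrite ge0_integralD//; first by rewrite !integral_sqrE.
  - by move=> x _; rewrite lee_fin sqr_ge0.
  - by case: f1 => ? _; exact: measurable_sqr.
  - by move=> x _; rewrite lee_fin sqr_ge0.
  - by case: f2 => ? _; exact: measurable_sqr.
by rewrite poweR_EFin powR12_sqrt// addr_ge0// ip_ge0.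
Qed.

Lemma Re_L2inner f g : L2 mu f -> L2 mu g -> complex.Re (L2inner mu f g) = rip f g.
Proof.
move=> /L2P[f1 f2] /L2P[g1 g2]; rewrite /L2inner /cintegral /rip /ip /=.
rewrite -RintegralD//; try exact: integrable_mul.
apply: eq_Rintegral => x _; rewrite /re /im.
by case: (f x) => a b; case: (g x) => c e /=; ring.
Qed.

End complex_L2.

(** * Increments of the resolvent along the heat semigroup *)

Section lebesgue_shift.
Context {R : realType}.
Local Notation leb := (@lebesgue_measure R).

Lemma lebesgue_measure_shift (a : R) (A : set R) : measurable A ->
  pushforward leb (fun x : R => x + a : measurableTypeR R) A = leb A.
Proof.
move=> mA; have ms : measurable_fun setT (fun x : R => x + a : measurableTypeR R).
  exact: measurable_funD.
apply/esym; apply: lebesgue_measure_unique => //= _ [[b c]] _ <-.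
rewrite /pushforward.
have -> : (fun x : R => x + a) @^-1` `]b, c]%classic = `]b - a, c - a]%classic.
  by apply/seteqP; split=> x /=; rewrite !in_itv/= ltrBlDr lerBrDr.
rewrite !lebesgue_measure_itv/= !lte_fin ltrD2r.
by case: ifP => // _; rewrite -EFinB -EFinB; congr (_%:E); ring.
Qed.

Lemma integrable_shift (a : R) (g : R -> R) : leb.-integrable setT (EFin \o g) ->
  leb.-integrable setT (EFin \o (fun x => g (x + a))).
Proof.
move=> ig; have mg := measurable_int _ ig.
have ms : measurable_fun setT (fun x : R => x + a : measurableTypeR R).
  exact: measurable_funD.
have shE A : measurable A -> A `<=` setT ->
    pushforward leb (fun x : R => x + a : measurableTypeR R) A = leb A.
  by move=> mA _; exact: lebesgue_measure_shift.
apply/integrableP; split; first exact: (measurableT_comp mg ms).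
have /integrableP[_] := ig; rewrite -(eq_measure_integral _ shE).
by rewrite ge0_integral_pushforward//; exact: measurableT_comp.
Qed.

Lemma Rintegral_shift (a : R) (g : R -> R) : leb.-integrable setT (EFin \o g) ->
  \int[leb]_x g (x + a) = \int[leb]_x g x.
Proof.
move=> ig; congr fine; have mg := measurable_int _ ig.
have ms : measurable_fun setT (fun x : R => x + a : measurableTypeR R).
  exact: measurable_funD.
have shE A : measurable A -> A `<=` setT ->
    pushforward leb (fun x : R => x + a : measurableTypeR R) A = leb A.
  by move=> mA _; exact: lebesgue_measure_shift.
rewrite -[RHS](eq_measure_integral _ shE).
by rewrite integral_pushforward//; exact: integrable_shift.
Qed.

End lebesgue_shift.

Section resolvent.
Context {d : measure_display} {X : measurableType d} {R : realType}.
Variable mu : {sigma_finite_measure set X -> \bar R}.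
Variables (p : R -> X -> X -> R) (hp : heat_kernel mu p).
Implicit Types (f g h : X -> R) (t s : R).
Local Notation leb := (@lebesgue_measure R).
Local Notation P t := (kop mu (hk p t)).
Local Notation G := (kop mu (green p)).

Lemma Re_cscale (a : R) (z : R[i]) : complex.Re ((a)%:C%C * z) = a * complex.Re z.
Proof. by case: z => b c /=; rewrite mul0r subr0. Qed.

Lemma Im_cscale (a : R) (z : R[i]) : complex.Im ((a)%:C%C * z) = a * complex.Im z.
Proof. by case: z => b c /=; rewrite mul0r addr0. Qed.

Lemma re_heat_op t (F : X -> R[i]) : 0 < t -> re (heat_op mu p t F) = P t (re F).
Proof.
move=> t0; rewrite hkE// /heat_op gt_eqF//; apply/funext => x.
by apply: eq_Rintegral => y _; rewrite Re_cscale.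
Qed.

Lemma im_heat_op t (F : X -> R[i]) : 0 < t -> im (heat_op mu p t F) = P t (im F).
Proof.
move=> t0; rewrite hkE// /heat_op gt_eqF//; apply/funext => x.
by apply: eq_Rintegral => y _; rewrite Im_cscale.
Qed.

Lemma rL2_hkop t f : rL2 mu f -> rL2 mu (P t f).
Proof. by move=> f2; apply: rL2_kop => //; exact: subker_hk. Qed.

Lemma rL2_green f : rL2 mu f -> rL2 mu (G f).
Proof. by move=> f2; apply: rL2_kop => //; exact: subker_green. Qed.

Lemma hk_cvg f : rL2 mu f -> nrm mu (fun x => P t f x - f x) @[t --> 0^'+] --> 0.
Proof.
move=> f2; pose F x := (f x)%:C%C.
have F2 : L2 mu F by apply/L2P; split => //; exact: rL20.
have := heat_kernel_continuous hp F2.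
move=> /fine_cvgP[_ /cvgrPdist_lt/= hc]; apply/cvgrPdist_lt => /= e e0.
have := hc e e0; apply: filterS2 (nbhs_right_gt 0) => t t0.
have PF2 : L2 mu (fun x => heat_op mu p t F x - F x).
  apply/L2P; split.
    rewrite (_ : re _ = fun x => P t f x - f x); first by apply: rL2B => //; exact: rL2_hkop.
    by rewrite -[P t f](re_heat_op F t0); apply/funext => x; rewrite /re raddfB.
  rewrite (_ : im _ = fun x => P t (im F) x - im F x).
    by apply: rL2B; [apply: rL2_hkop|]; exact: rL20.
  by rewrite -(im_heat_op F t0); apply/funext => x; rewrite /im raddfB.
rewrite L2normE// !sub0r !normrN; apply: le_lt_trans.
rewrite !ger0_norm ?sqrtr_ge0// ler_wsqrtr//.
rewrite /rip (_ : re _ = fun x => P t f x - f x) ?lerDl ?ip_ge0//.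
by rewrite -[P t f](re_heat_op F t0); apply/funext => x; rewrite /re raddfB.
Qed.

Lemma ip_hk_cvg f h : rL2 mu f -> rL2 mu h ->
  ip mu (P t f) h @[t --> 0^'+] --> ip mu f h.
Proof.
move=> f2 h2; apply/cvgrPdist_le => /= e e0.
have /cvgrPdist_le/= := hk_cvg f2.
pose e' := e / (nrm mu h + 1).
have e'0 : 0 < e' by rewrite divr_gt0// ltr_wpDl ?nrm_ge0.
move=> /(_ e' e'0); apply: filterS => t; rewrite sub0r normrN ger0_norm ?nrm_ge0// => ht.
have Pf2 := rL2_hkop t f2.
rewrite distrC -ipBl//; apply: le_trans (cauchy_schwarz (rL2B Pf2 f2) h2) _.
apply: (@le_trans _ _ (e' * (nrm mu h + 1))); last by rewrite divfK ?gt_eqF// ltr_wpDl ?nrm_ge0.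
by rewrite ler_pM ?nrm_ge0// lerDl.
Qed.

(** The integrand of the Laplace transform: its integral over the line is [ip (G f) h]. *)
Definition orb f h t : R := exp_weight t * ip mu (P t f) h.

Lemma integrable_orb f h : rL2 mu f -> rL2 mu h -> leb.-integrable setT (EFin \o orb f h).
Proof. exact: integrable_exp_ip. Qed.

Lemma orb_le f h t : rL2 mu f -> rL2 mu h ->
  `|orb f h t| <= exp_weight t * (nrm mu f * nrm mu h).
Proof.
move=> f2 h2; rewrite normrM (ger0_norm (exp_weight_ge0 _)).
by rewrite ler_wpM2l ?exp_weight_ge0// norm_ip_kop_le//; exact: subker_hk.
Qed.

Lemma orb_le1 f h t : rL2 mu f -> rL2 mu h -> `|orb f h t| <= nrm mu f * nrm mu h.
Proof.
move=> f2 h2; apply: le_trans (orb_le t f2 h2) _.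
rewrite ler_piMl ?mulr_ge0 ?nrm_ge0// /exp_weight; case: ifP => // t0.
by rewrite -[leRHS]expR0 ler_expR oppr_le0 ltW.
Qed.

Lemma integrable_orbS f h (D : set R) : measurable D -> rL2 mu f -> rL2 mu h ->
  leb.-integrable D (EFin \o orb f h).
Proof. by move=> mD f2 h2; apply: integrableS (integrable_orb f2 h2). Qed.

Lemma green_orb f h : rL2 mu f -> rL2 mu h -> forall t,
  ip mu (G f) h = \int[leb]_(s in `]-oo, t]) orb f h s + \int[leb]_(s in `]t, +oo[) orb f h s.
Proof.
move=> f2 h2 t; rewrite ip_green// -Rintegral_setU//.
- by rewrite -itv_bndbnd_setU//= set_itvE.
- by rewrite -itv_bndbnd_setU//= set_itvE; exact: integrable_orb.
- rewrite disj_set2E; apply/eqP/seteqP; split=> x//=.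
  by rewrite !in_itv/= andbT => -[]; rewrite leNgt => /negP.
Qed.

(** As [exp (- s) = exp t * exp (- (s + t))], applying the semigroup at time [t] shifts the Laplace
    integral: only the part beyond [t] remains, multiplied by [exp t]. *)
Lemma hk_green_orb f h t : rL2 mu f -> rL2 mu h -> 0 < t ->
  ip mu (P t (G f)) h = expR t * \int[leb]_(s in `]t, +oo[) orb f h s.
Proof.
move=> f2 h2 t0; have Ph2 := rL2_hkop t h2.
pose g := orb f h \_ `]t, +oo[%classic.
have ig : leb.-integrable setT (EFin \o g).
  by rewrite -restrict_EFin; apply: (integrable_mkcond _ _).1 => //; exact: integrable_orbS.
(* For [s <= 0] both sides are 0: on the left by [exp_weight], on the right because [s + t] is
   outside the support of [g]. *)
have gE s : exp_weight s * ip mu (P s f) (P t h) = expR t * g (s + t).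
  rewrite /g patchE mem_setE/= in_itv/= andbT ltrDr /orb /exp_weight.
  have [s0|s0] := ltP 0 s; last by rewrite mul0r mulr0.
  rewrite addr_gt0// mulrA -expRD opprD addrCA subrr addr0; congr (_ * _).
  rewrite -(ip_kop_sym (subker_hk hp t) (rL2_hkop s f2) h2).
  by rewrite (kop_hk_semigroup hp t0 s0 f2) addrC.
rewrite (ip_kop_sym (subker_hk hp t) (rL2_green f2) h2) (ip_green hp f2 Ph2).
transitivity (\int[leb]_s (expR t * g (s + t))).
  by apply: eq_Rintegral => s _; exact: gE.
rewrite (RintegralZl (expR t) measurableT (integrable_shift t ig)); congr (_ * _).
by rewrite (Rintegral_shift t ig); apply: esym; exact: Rintegral_mkcond.
Qed.

End resolvent.

Section resolvent_increments.
Context {d : measure_display} {X : measurableType d} {R : realType}.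
Variable mu : {sigma_finite_measure set X -> \bar R}.
Variables (p : R -> X -> X -> R) (hp : heat_kernel mu p).
Implicit Types (f g h : X -> R) (t s : R).
Local Notation leb := (@lebesgue_measure R).
Local Notation P t := (kop mu (hk p t)).
Local Notation G := (kop mu (green p)).

(** From [1 - t <= exp (- t)] one gets [exp t * (1 - t) <= 1], hence [exp t - 1 <= t * exp t]; and
    [exp t <= 1 + 2 t] because [(1 + 2 t) (1 - t) >= 1] up to [t = 1/2]. *)
Lemma expR_sub1_bounds t : 0 < t <= 2^-1 -> t <= expR t - 1 <= t + 2 * t ^+ 2.
Proof.
move=> /andP[t0 t2]; apply/andP; split; first by rewrite lerBrDl expR_ge1Dx.
have h1 : 1 - t <= expR (- t) by exact: expR_ge1Dx.
have h2 : expR t * (1 - t) <= 1.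
  by rewrite -[leRHS](@mulfV _ (expR t)) ?gt_eqF ?expR_gt0// -expRN ler_wpM2l ?expR_ge0.
have t1 : 0 < 1 - t by lra.
have t2' : 0 <= 1 - 2 * t by lra.
have h3 : expR t <= 1 + 2 * t.
  rewrite -(ler_pM2r t1); apply: le_trans h2 _.
  by have := mulr_ge0 (ltW t0) t2'; lra.
have := ler_wpM2l (ltW t0) h3; lra.
Qed.

(** Used with [B = 0] for the size of the integral near 0, and with [B = ip f h] for its derivative.
    The orbit vanishes at nonpositive times, so the interval that counts has length [t]. *)
Lemma orb_head f h t (e B : R) : rL2 mu f -> rL2 mu h -> 0 < t ->
  (forall s, 0 < s <= t -> `|orb mu p f h s - B| <= e) ->
  `|\int[leb]_(s in `]-oo, t]) orb mu p f h s - t * B| <= t * e.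
Proof.
move=> f2 h2 t0 he.
have mI : measurable (`]0, t]%classic : set (measurableTypeR R)) by exact: measurable_itv.
have lebI : leb `]0, t]%classic = t%:E.
  by rewrite lebesgue_measure_itv/= lte_fin t0 oppr0 adde0.
have io := integrable_orbS hp (measurable_itv `]0, t]) f2 h2.
have ic (c : R) : leb.-integrable `]0, t]%classic (EFin \o (fun=> c)).
  apply: measurable_bounded_integrable => //; first exact: (eq_ind_r (fun z => (z < +oo)%E) (ltry t) lebI).
  by exists `|c|; split => // M cM x _ /=; exact: ltW.
have intc (c : R) : \int[leb]_(s in `]0, t]) c = t * c.
  by rewrite Rintegral_cst// mulrC; congr (_ * _); rewrite -[RHS]/(fine t%:E) -lebI.
have -> : \int[leb]_(s in `]-oo, t]) orb mu p f h s = \int[leb]_(s in `]0, t]) orb mu p f h s.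
  rewrite Rintegral_mkcond [in RHS]Rintegral_mkcond; apply: eq_Rintegral => s _.
  rewrite !patchE !mem_setE /= !in_itv/=; case: (ltP 0 s) => //= s0.
  by case: ifP => // _; rewrite /orb /exp_weight ltNge s0 mul0r.
rewrite -[t * B]intc -(RintegralB mI io (ic B)).
have iB := RintegrableB mI io (ic B).
apply: le_trans (le_normr_Rintegral mI iB) _.
rewrite -intc; apply: le_Rintegral => //; first exact: integrable_norm.
Qed.

Lemma orb_tail_le f h t : rL2 mu f -> rL2 mu h ->
  `|\int[leb]_(s in `]t, +oo[) orb mu p f h s| <= nrm mu f * nrm mu h.
Proof.
move=> f2 h2; have io := integrable_orbS hp (measurable_itv `]t, +oo[) f2 h2.
apply: le_trans (le_normr_Rintegral _ io) _ => //.
set c := _ * _.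
rewrite -lee_fin EFin_Rintegral//; last exact: integrable_norm.
have mo : measurable_fun setT (fun s => `|orb mu p f h s|%:E).
  exact: (measurable_int _ (integrable_norm (integrable_orb hp f2 h2))).
apply: (@le_trans _ _ (\int[leb]_s (exp_weight s * c)%:E)%E).
  apply: (@le_trans _ _ (\int[leb]_s `|orb mu p f h s|%:E)%E).
    apply: ge0_subset_integral => //.
  apply: ge0_le_integral => //.
  - apply/measurable_EFinP; apply: measurable_funM => //; exact: measurable_exp_weight.
  - by move=> s _; rewrite lee_fin (orb_le hp).
under eq_integral do rewrite EFinM.
have c0 : 0 <= c by rewrite mulr_ge0 ?nrm_ge0.
rewrite ge0_integralZr//.
- by rewrite -[leRHS]mul1e lee_wpmul2r ?lee_fin// exp_weight_le1.
- by apply/measurable_EFinP; exact: measurable_exp_weight.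
- by move=> s _; rewrite lee_fin exp_weight_ge0.
Qed.

Lemma ip_green_increment f h t : rL2 mu f -> rL2 mu h -> 0 < t ->
  ip mu (fun x => G f x - P t (G f) x) h =
  \int[leb]_(s in `]-oo, t]) orb mu p f h s -
    (expR t - 1) * \int[leb]_(s in `]t, +oo[) orb mu p f h s.
Proof.
move=> f2 h2 t0; have Gf2 := rL2_green hp f2.
rewrite (ipBl Gf2 (rL2_hkop hp t Gf2) h2).
by rewrite (green_orb hp f2 h2 t) (hk_green_orb hp)//; ring.
Qed.

(** Testing the increment against itself. The constant 3 is 1 for the integral up to [t] plus 2 for
    the tail, whose factor is [exp t - 1 <= 2 t]. *)
Lemma nrm_green_increment f t : rL2 mu f -> 0 < t <= 2^-1 ->
  nrm mu (fun x => G f x - P t (G f) x) <= 3 * t * nrm mu f.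
Proof.
move=> f2 t12; have /andP[t0 t2] := t12.
have Gf2 := rL2_green hp f2; have PGf2 := rL2_hkop hp t Gf2.
set h := fun x => _; have h2 : rL2 mu h by exact: rL2B.
have hh : ip mu h h <= 3 * t * nrm mu f * nrm mu h.
  rewrite {1}/h ip_green_increment//.
  have H1 := @orb_head f h t (nrm mu f * nrm mu h) 0 f2 h2 t0.
  rewrite mulr0 subr0 in H1.
  have H : `|\int[leb]_(s in `]-oo, t]) orb mu p f h s| <= t * (nrm mu f * nrm mu h).
    by apply: H1 => s _; rewrite subr0 (orb_le1 hp).
  have H2 := orb_tail_le t f2 h2.
  have /andP[e1 e2] := expR_sub1_bounds t12.
  have e3 : expR t - 1 <= 2 * t.
    have t2' : 0 <= 1 - 2 * t by lra.
    by have := mulr_ge0 (ltW t0) t2'; lra.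
  apply: le_trans (ler_norm _) _; apply: le_trans (ler_normB _ _) _.
  rewrite normrM (ger0_norm (le_trans (ltW t0) e1)).
  have := ler_pM (le_trans (ltW t0) e1) (normr_ge0 _) e3 H2.
  by rewrite -(mulrA (3 * t)); move: H; set c := nrm mu f * nrm mu h; lra.
have [h0|h0] := eqVneq (nrm mu h) 0; first by rewrite h0 !mulr_ge0 ?nrm_ge0// ltW.
have hgt : 0 < nrm mu h by rewrite lt_neqAle eq_sym h0 nrm_ge0.
by rewrite -(ler_pM2r hgt) -expr2 nrm_sqr.
Qed.

(** In [ip_green_increment] divided by [t], the integral up to [t] tends to [ip f h] by continuity
    of the orbit at 0, while [(exp t - 1) / t] tends to 1 and the tail to [ip (G f) h]. *)
Lemma cvg_green_increment f h : rL2 mu f -> rL2 mu h ->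
  t^-1 * ip mu (fun x => G f x - P t (G f) x) h @[t --> 0^'+] -->
  ip mu (fun x => f x - G f x) h.
Proof.
move=> f2 h2; have Gf2 := rL2_green hp f2.
have orb_cvg : orb mu p f h t @[t --> 0^'+] --> ip mu f h.
  rewrite -[ip mu f h]mul1r; apply: cvgM; last exact: ip_hk_cvg.
  have : expR (- t) @[t --> 0^'+] --> (1 : R).
    rewrite -expR0 -{2}oppr0; apply: cvg_at_right_filter.
    by apply: (@continuous_comp _ _ _ (fun t : R => - t) expR); [exact: opp_continuous|exact: continuous_expR].
  apply: cvg_trans; apply: near_eq_cvg; near=> t.
  by rewrite /exp_weight ifT//; near: t; exact: nbhs_right_gt.
apply/cvgrPdist_le => /= e e0.
have e30 : 0 < e / 3 by rewrite divr_gt0.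
set M := nrm mu f * nrm mu h; have M0 : 0 <= M by rewrite mulr_ge0 ?nrm_ge0.
set W := ip mu (G f) h.
have [dl dl0 hdl] : exists2 dl : R, 0 < dl &
    forall s, 0 < s < dl -> `|orb mu p f h s - ip mu f h| <= e / 3.
  move/cvgrPdist_le: orb_cvg => /(_ _ e30) [dl /= dl0 hd]; exists dl => // s /andP[s0 sd].
  by rewrite distrC; apply: hd => //=; rewrite sub0r normrN gtr0_norm.
have Mp : 0 < 4 * (`|W| + M + 1) by rewrite mulr_gt0// ltr_wpDl// addr_ge0.
near=> t.
have t0 : 0 < t by near: t; exact: nbhs_right_gt.
have t12 : 0 < t <= 2^-1 by rewrite t0/=; near: t; apply: nbhs_right_le; rewrite invr_gt0.
have tdl : t < dl by near: t; apply: nbhs_right_lt.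
(* The two errors of second order, divided by [t]. With the [e / 3] allowed for the head the total
   stays below [e]. *)
have tM : 2 * t * `|W| + 2 * M * t <= e / 2.
  have : t <= e / (4 * (`|W| + M + 1)).
    by near: t; apply: nbhs_right_le; exact: divr_gt0.
  rewrite ler_pdivlMr//; have := normr_ge0 W; nra.
have H1 : `|\int[leb]_(s in `]-oo, t]) orb mu p f h s - t * ip mu f h| <= t * (e / 3).
  apply: orb_head => // s /andP[s0 st]; apply: hdl; rewrite s0/= (le_lt_trans st)//.
have H2 : `|\int[leb]_(s in `]-oo, t]) orb mu p f h s - t * 0| <= t * M.
  by apply: orb_head => // s _; rewrite subr0 (orb_le1 hp).
rewrite ip_green_increment// ipBl// -/W.
have := green_orb hp f2 h2 t; rewrite -/W; move: H1 H2.
set I1 := Rintegral _ _ _; set I2 := Rintegral _ _ _ => H1 H2 WE.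
have {WE} -> : I2 = W - I1 by rewrite WE; ring.
have /andP[e1 e2] := expR_sub1_bounds t12.
set c := expR t - 1 in e1 e2 *.
(* Three errors: the head against [t * ip f h], the factor [exp t - 1] against [t], and the part of
   [W] missing from the tail. *)
have -> : ip mu f h - W - t^-1 * (I1 - c * (W - I1)) =
    t^-1 * (- (I1 - t * ip mu f h) + (c - t) * W - c * (I1 - t * 0)).
  by field; rewrite gt_eqF.
rewrite normrM ger0_norm ?invr_ge0 ?(ltW t0)// ler_pdivrMl//.
apply: le_trans (ler_normB _ _) _; rewrite normrM.
apply: le_trans (lerD (ler_normD _ _) (lexx _)) _; rewrite normrM normrN.
have ct0 : 0 <= c - t by rewrite subr_ge0.
have c0 : 0 <= c by apply: le_trans e1; exact: ltW.
rewrite (ger0_norm ct0) (ger0_norm c0).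
have c2 : c <= 2 * t.
  have /andP[_ th] := t12; have t2' : 0 <= 1 - 2 * t by lra.
  by have := mulr_ge0 (ltW t0) t2'; lra.
have A1 := ler_pM ct0 (normr_ge0 W) (_ : c - t <= 2 * t ^+ 2) (lexx _).
have {}A1 : (c - t) * `|W| <= 2 * t ^+ 2 * `|W| by apply: A1; lra.
have A2 := ler_pM c0 (normr_ge0 _) c2 H2.
have A3 : t * (2 * t * `|W| + 2 * M * t) <= t * (e / 2) by rewrite ler_wpM2l// ltW.
have A4 : t * (e / 3) + t * (e / 2) <= t * e by nra.
lra.
Unshelve. all: end_near.
Qed.

End resolvent_increments.

Section complex_functions.
Context {d : measure_display} {X : measurableType d} {R : realType}.
Variable mu : {measure set X -> \bar R}.
Local Notation C := R[i].
Implicit Types f g h : X -> C.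

Lemma reD f g : re (fun x => f x + g x) = (fun x => re f x + re g x).
Proof. by apply/funext => x; rewrite /re raddfD. Qed.

Lemma imD f g : im (fun x => f x + g x) = (fun x => im f x + im g x).
Proof. by apply/funext => x; rewrite /im raddfD. Qed.

Lemma reB f g : re (fun x => f x - g x) = (fun x => re f x - re g x).
Proof. by apply/funext => x; rewrite /re raddfB. Qed.

Lemma imB f g : im (fun x => f x - g x) = (fun x => im f x - im g x).
Proof. by apply/funext => x; rewrite /im raddfB. Qed.

Lemma reiZ f : re (fun x => 'i%C * f x) = (fun x => - im f x).
Proof. by apply/funext => x; rewrite /re /im; case: (f x) => a b /=; ring. Qed.

Lemma imiZ f : im (fun x => 'i%C * f x) = re f.
Proof. by apply/funext => x; rewrite /re /im; case: (f x) => a b /=; ring. Qed.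

Lemma L2D f g : L2 mu f -> L2 mu g -> L2 mu (fun x => f x + g x).
Proof.
by move=> /L2P[f1 f2] /L2P[g1 g2]; apply/L2P; rewrite reD imD; split; exact: rL2D.
Qed.

Lemma L2B f g : L2 mu f -> L2 mu g -> L2 mu (fun x => f x - g x).
Proof.
by move=> /L2P[f1 f2] /L2P[g1 g2]; apply/L2P; rewrite reB imB; split; exact: rL2B.
Qed.

Lemma ripDl f g h : L2 mu f -> L2 mu g -> L2 mu h ->
  rip mu (fun x => f x + g x) h = rip mu f h + rip mu g h.
Proof.
move=> /L2P[f1 f2] /L2P[g1 g2] /L2P[h1 h2].
by rewrite /rip reD imD !ipDl// addrACA.
Qed.

Lemma ripBl f g h : L2 mu f -> L2 mu g -> L2 mu h ->
  rip mu (fun x => f x - g x) h = rip mu f h - rip mu g h.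
Proof.
move=> /L2P[f1 f2] /L2P[g1 g2] /L2P[h1 h2].
by rewrite /rip reB imB !ipBl// opprD addrACA.
Qed.

Lemma ripC f g : rip mu f g = rip mu g f.
Proof. by rewrite /rip ipC [ip _ (im f) _]ipC. Qed.

Lemma ripDr f g h : L2 mu f -> L2 mu g -> L2 mu h ->
  rip mu h (fun x => f x + g x) = rip mu h f + rip mu h g.
Proof. by move=> f2 g2 h2; rewrite ripC ripDl// ![rip mu _ h]ripC. Qed.

Lemma ripBr f g h : L2 mu f -> L2 mu g -> L2 mu h ->
  rip mu h (fun x => f x - g x) = rip mu h f - rip mu h g.
Proof. by move=> f2 g2 h2; rewrite ripC ripBl// ![rip mu _ h]ripC. Qed.

Lemma rip_ge0 f : 0 <= rip mu f f.
Proof. by rewrite addr_ge0// ip_ge0. Qed.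

Lemma eq_ae_rip f f' g : L2 mu f -> L2 mu f' -> L2 mu g ->
  f = f' %[ae mu] -> rip mu f g = rip mu f' g.
Proof.
move=> /L2P[[f1 _] [f2 _]] /L2P[[f1' _] [f2' _]] /L2P[[g1 _] [g2 _]] ff'.
rewrite /rip; congr (_ + _); apply: eq_ae_ip => //; try exact: aeW.
  by apply: filterS ff' => x /= ff' xT; rewrite /re ff'.
by apply: filterS ff' => x /= ff' xT; rewrite /im ff'.
Qed.

Lemma rip_eq0 f : L2 mu f -> rip mu f f = 0 -> f = (fun=> 0) %[ae mu].
Proof.
move=> /L2P[f1 f2] /eqP; rewrite paddr_eq0 ?ip_ge0// => /andP[/eqP h1 /eqP h2].
apply: filterS2 (ip_eq0 f1 h1) (ip_eq0 f2 h2) => x /= e1 e2 xT.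
move: (e1 xT) (e2 xT); rewrite /re /im; case: (f x) => a b /= -> ->.
by apply/eqP; rewrite eq_complex/= !eqxx.
Qed.

(** The real part of i z is minus the imaginary part of z. An identity of complex inner products
    thus follows from its real part, if the latter is known for a family stable under multiplication
    by i. *)
Lemma Im_L2inner f g : L2 mu f -> L2 mu g ->
  complex.Im (L2inner mu f g) = - rip mu (fun x => 'i%C * f x) g.
Proof.
move=> /L2P[f1 f2] /L2P[g1 g2]; rewrite /L2inner /cintegral /rip reiZ imiZ /=.
rewrite ipNl// opprD opprK /ip -RintegralB//; try exact: integrable_mul.
apply: eq_Rintegral => x _; rewrite /re /im.
by case: (f x) => a b; case: (g x) => c e /=; ring.
Qed.

End complex_functions.

(** * Spectral calculus and the resolvent *)

Section polar.
Context {d : measure_display} {X : measurableType d} {R : realType}.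
Local Notation C := R[i].
Variable nu : (X -> C) -> {measure set R -> \bar R}.

(** The terms with odd powers of i are purely imaginary, so that only the measures of [f + h] and
    [f - h] remain. *)
Lemma Re_polar_integral (phi : R -> R) (f h : X -> C) :
  complex.Re (polar_integral nu phi f h) =
  4^-1 * (\int[nu (fun x => f x + h x)]_l phi l - \int[nu (fun x => f x - h x)]_l phi l).
Proof.
rewrite /polar_integral !big_ord_recl big_ord0/=.
have e0 : (fun x => f x + 'i%C ^+ 0 * h x) = (fun x => f x + h x).
  by apply/funext => x; rewrite expr0 mul1r.
have e2 : (fun x => f x + 'i%C ^+ bump 0 (bump 0 0) * h x) = (fun x => f x - h x).
  by apply/funext => x; rewrite /bump/= sqr_i mulN1r.
rewrite e0 e2 /bump/= ?expr0 ?expr1 ?sqr_i; by field.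
Qed.

End polar.

Section spectral.
Context {d : measure_display} {X : measurableType d} {R : realType}.
Variable mu : {sigma_finite_measure set X -> \bar R}.
Local Notation C := R[i].
Variables (E : set R -> (X -> C) -> X -> C) (nu : (X -> C) -> {measure set R -> \bar R}).
Hypothesis hE : spectral_measure mu E nu.
Implicit Types (f g h u v w : X -> C) (phi : R -> R).

Lemma nuE A f : measurable A -> L2 mu f -> nu f A = (rip mu (E A f) f)%:E.
Proof.
by move=> mA f2; rewrite (spectral_scalar hE)// Re_L2inner//; exact: (spectral_L2 hE).
Qed.

Lemma spectralD A f g : measurable A -> L2 mu f -> L2 mu g ->
  E A (fun x => f x + g x) = (fun x => E A f x + E A g x) %[ae mu].
Proof.
move=> mA f2 g2; have := spectral_linear hE 1 mA f2 g2.
rewrite (_ : (fun x => 1 * f x + g x) = (fun x => f x + g x)); last first.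
  by apply/funext => x; rewrite mul1r.
by apply: filterS => x /= h xT; rewrite h// mul1r.
Qed.

Lemma spectralB A f g : measurable A -> L2 mu f -> L2 mu g ->
  E A (fun x => f x - g x) = (fun x => E A f x - E A g x) %[ae mu].
Proof.
move=> mA f2 g2; have := spectral_linear hE (-1) mA g2 f2.
rewrite (_ : (fun x => -1 * g x + f x) = (fun x => f x - g x)); last first.
  by apply/funext => x; rewrite mulN1r addrC.
by apply: filterS => x /= h xT; rewrite h// mulN1r addrC.
Qed.

Lemma nu_fin_num A f : measurable A -> L2 mu f -> nu f A \is a fin_num.
Proof. by move=> mA f2; rewrite nuE. Qed.

Lemma nuD A f g : measurable A -> L2 mu f -> L2 mu g ->
  nu (fun x => f x + g x) A =
  (rip mu (E A f) f + rip mu (E A f) g + rip mu (E A g) f + rip mu (E A g) g)%:E.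
Proof.
move=> mA f2 g2; have fg2 := L2D f2 g2; rewrite nuE//; congr (_%:E).
have Ef2 := spectral_L2 hE mA f2; have Eg2 := spectral_L2 hE mA g2.
have EDfg2 := spectral_L2 hE mA fg2.
rewrite (eq_ae_rip EDfg2 (L2D Ef2 Eg2) fg2 (spectralD mA f2 g2)).
by rewrite ripDl// !ripDr//; ring.
Qed.

Lemma nuB A f g : measurable A -> L2 mu f -> L2 mu g ->
  nu (fun x => f x - g x) A =
  (rip mu (E A f) f - rip mu (E A f) g - rip mu (E A g) f + rip mu (E A g) g)%:E.
Proof.
move=> mA f2 g2; have fg2 := L2B f2 g2; rewrite nuE//; congr (_%:E).
have Ef2 := spectral_L2 hE mA f2; have Eg2 := spectral_L2 hE mA g2.
have EDfg2 := spectral_L2 hE mA fg2.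
rewrite (eq_ae_rip EDfg2 (L2B Ef2 Eg2) fg2 (spectralB mA f2 g2)).
by rewrite ripBl// !ripBr//; ring.
Qed.

(** The parallelogram law holds for the measures themselves, set by set, and is then integrated. It
    makes the spectral domain stable under sums and differences. *)
Lemma integral_nu_parallelogram phi f g : measurable_fun setT phi ->
  (forall l, 0 <= phi l) -> L2 mu f -> L2 mu g ->
  (\int[nu (fun x => (f x + g x)%R)]_l (phi l)%:E + \int[nu (fun x => (f x - g x)%R)]_l (phi l)%:E =
   2%:E * \int[nu f]_l (phi l)%:E + 2%:E * \int[nu g]_l (phi l)%:E)%E.
Proof.
move=> mphi phi0 f2 g2.
have mphi' : measurable_fun setT (EFin \o phi) by exact/measurable_EFinP.
have phi0' : forall x, setT x -> (0 <= (EFin \o phi) x)%E by move=> x _; rewrite lee_fin.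
pose two : {nonneg R} := NngNum (ler0n R 2).
have sc (m : {measure set R -> \bar R}) :
    (2%:E * \int[m]_l (phi l)%:E = \int[mscale two m]_l (phi l)%:E)%E.
  by rewrite ge0_integral_mscale.
rewrite !sc -!ge0_integral_measure_add//.
apply: eq_measure_integral => A mA _.
transitivity (nu (fun x => (f x + g x)%R) A + nu (fun x => (f x - g x)%R) A)%E.
  exact: measure_addE.
transitivity (mscale two (nu f) A + mscale two (nu g) A)%E; last first.
  by apply/esym; exact: measure_addE.
rewrite /mscale/= nuD// nuB// !nuE//.
by rewrite -!EFinM -!EFinD; congr (_%:E); ring.
Qed.

Lemma integral_nu_double phi f : measurable_fun setT phi ->
  (forall l, 0 <= phi l) -> L2 mu f ->
  (\int[nu (fun x => (f x + f x)%R)]_l (phi l)%:E = 4%:E * \int[nu f]_l (phi l)%:E)%E.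
Proof.
move=> mphi phi0 f2; rewrite -(ge0_integral_mscale _ measurableT (NngNum (ler0n R 4)))//.
- apply: eq_measure_integral => A mA _.
  by rewrite nuD//= /mscale/= nuE// -EFinM; congr (_%:E); ring.
- exact/measurable_EFinP.
- by move=> x _; rewrite lee_fin.
Qed.

Lemma integral_nu_zero phi f : L2 mu f ->
  (\int[nu (fun x => (f x - f x)%R)]_l (phi l)%:E = 0)%E.
Proof.
move=> f2; rewrite -(integral_measure_zero setT (EFin \o phi)).
apply: eq_measure_integral => A mA _.
by rewrite nuB// /mzero; congr (_%:E); ring.
Qed.

Lemma nu_integrable_cst f (c : R) : L2 mu f -> (nu f).-integrable setT (EFin \o (fun=> c)).
Proof.
move=> f2; apply: measurable_bounded_integrable => //.
  by rewrite ltey_eq nu_fin_num.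
by exists `|c|; split => // M cM x _ /=; exact: ltW.
Qed.

End spectral.

Section heat_spectral.
Context {d : measure_display} {X : measurableType d} {R : realType}.
Variable mu : {sigma_finite_measure set X -> \bar R}.
Variables (p : R -> X -> X -> R) (hp : heat_kernel mu p).
Local Notation C := R[i].
Variables (E : set R -> (X -> C) -> X -> C) (nu : (X -> C) -> {measure set R -> \bar R}).
Hypothesis hE : spectral_measure mu E nu.
Local Notation T t := (heat_op mu p t).
Hypothesis hP : forall (t : R) f, 0 <= t -> L2 mu f ->
  spectral_integral mu nu (fun l => expR (- (t * l))) f (T t f).
Implicit Types (f g h u v w : X -> C) (t : R).

Lemma L2_heat t f : 0 < t -> L2 mu f -> L2 mu (T t f).
Proof.
move=> t0 /L2P[f1 f2]; apply/L2P; rewrite re_heat_op// im_heat_op//.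
by split; exact: rL2_hkop.
Qed.

Lemma heat_op0 f : T 0 f = f. Proof. by rewrite /heat_op eqxx. Qed.

Lemma rip_heat_sym t f h : 0 < t -> L2 mu f -> L2 mu h ->
  rip mu (T t f) h = rip mu f (T t h).
Proof.
move=> t0 /L2P[f1 f2] /L2P[h1 h2]; rewrite /rip !re_heat_op// !im_heat_op//.
by rewrite !ip_kop_sym//; exact: subker_hk.
Qed.

Lemma heat_op_semigroup t f : 0 < t -> L2 mu f -> T t (T t f) = T (t + t) f.
Proof.
move=> t0 /L2P[f1 f2]; have tt0 : 0 < t + t by rewrite addr_gt0.
apply/funext => x; apply/eqP; rewrite eq_complex; apply/andP; split; apply/eqP.
  rewrite -[LHS]/(re _ x) -[RHS]/(re _ x) !re_heat_op//.
  by rewrite kop_hk_semigroup.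
rewrite -[LHS]/(im _ x) -[RHS]/(im _ x) !im_heat_op//.
by rewrite kop_hk_semigroup.
Qed.

(** The exponential is unbounded for negative [l]. The domain condition at time [t / 2] is exactly
    this integrability, as [exp (- t l)] is the square of [exp (- (t / 2) l)]. *)
Lemma integrable_nu_exp t f : 0 <= t -> L2 mu f ->
  (nu f).-integrable setT (EFin \o (fun l => expR (- (t * l)))).
Proof.
move=> t0 f2; have t20 : 0 <= t / 2 by rewrite divr_ge0.
have [_ _ + _] := hP t20 f2 => hfin.
apply: ge0_Rintegrable => //.
  by apply: measurableT_comp => //; apply: measurableT_comp => //; exact: measurable_funM.
apply: le_lt_trans hfin; rewrite le_eqVlt; apply/orP; left; apply/eqP.
apply: eq_integral => l _; rewrite -expRM_natl; congr (expR _)%:E.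
by field.
Qed.

Lemma rip_heatE t f h : 0 <= t -> L2 mu f -> L2 mu h ->
  rip mu (T t f) h = 4^-1 *
    (\int[nu (fun x => f x + h x)]_l expR (- (t * l)) -
     \int[nu (fun x => f x - h x)]_l expR (- (t * l))).
Proof.
move=> t0 f2 h2; have [_ Tf2 _ /(_ h h2) hf] := hP t0 f2.
have [_ _ hfin _] := hP t0 h2.
by rewrite -Re_L2inner// hf// Re_polar_integral.
Qed.

(** For equal arguments polarization collapses: [w - w] has the zero measure and [w + w] four times
    the measure of [w]. *)
Lemma rip_heat_self t w : 0 <= t -> L2 mu w ->
  rip mu (T t w) w = \int[nu w]_l expR (- (t * l)).
Proof.
move=> t0 w2; rewrite rip_heatE//.
have me : measurable_fun setT (fun l : R => expR (- (t * l))).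
  by apply: measurableT_comp => //; apply: measurableT_comp => //; exact: measurable_funM.
have -> : \int[nu (fun x => w x - w x)]_l expR (- (t * l)) = 0.
  by rewrite /Rintegral (integral_nu_zero hE).
have -> : \int[nu (fun x => w x + w x)]_l expR (- (t * l)) =
    4 * \int[nu w]_l expR (- (t * l)).
  rewrite /Rintegral (integral_nu_double hE)//.
  have fin := integrable_fin_num measurableT (integrable_nu_exp t0 w2).
  by rewrite fineM.
by rewrite subr0 mulrA mulVf ?mul1r// pnatr_eq0.
Qed.

(** Both squares are expanded. The last term is the squared norm of the evolved vector, equal to
    [rip (T (t + t) w) w]: the semigroup law plays the part of multiplicativity of the spectral
    calculus. *)
Lemma integral_nu_increment t w : 0 < t -> L2 mu w ->
  (\int[nu w]_l ((1 - expR (- (t * l))) ^+ 2)%:E)%E =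
  (rip mu (fun x => w x - T t w x) (fun x => w x - T t w x))%:E.
Proof.
move=> t0 w2; have Tw2 := L2_heat t0 w2.
have tt0 : 0 <= t + t by rewrite addr_ge0 ?ltW.
have ie := integrable_nu_exp (ltW t0) w2; have iee := integrable_nu_exp tt0 w2.
have i1 := nu_integrable_cst hE 1 w2.
have i2e := RintegrableZl measurableT 2 ie.
have -> : rip mu (fun x => w x - T t w x) (fun x => w x - T t w x) =
    rip mu w w - 2 * rip mu (T t w) w + rip mu (T (t + t) w) w.
  rewrite ripBl ?ripBr//; last exact: L2B.
  rewrite [rip mu w (T t w)]ripC -(heat_op_semigroup t0 w2) (rip_heat_sym t0 Tw2 w2).
  by ring.
have -> : rip mu w w = \int[nu w]_l 1.
  rewrite -{1}[w]heat_op0 rip_heat_self//.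
  by apply: eq_Rintegral => l _; rewrite mul0r oppr0 expR0.
rewrite !rip_heat_self ?(ltW t0)// -RintegralZl// -RintegralB// -RintegralD//; last first.
  exact: RintegrableB.
rewrite EFin_Rintegral//; last by apply: RintegrableD => //; exact: RintegrableB.
apply: eq_integral => l _; congr (_%:E).
by rewrite [(t + t) * l]mulrDl opprD expRD; ring.
Qed.

End heat_spectral.

Section fatou.
Context {d : measure_display} {X : measurableType d} {R : realType}.
Variable mu : {measure set X -> \bar R}.

(** Serves twice: on a spectral measure, for the domain of H, and on [mu], for the completeness of
    L^2. *)
Lemma fatou_bound (F : nat -> X -> R) (f : X -> R) (c : \bar R) :
  (forall n, measurable_fun setT (F n)) -> (forall n x, 0 <= F n x) ->
  measurable_fun setT f -> (forall x, 0 <= f x) ->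
  {ae mu, forall x, F n x @[n --> \oo] --> f x} ->
  (forall n, \int[mu]_x (F n x)%:E <= c)%E -> (\int[mu]_x (f x)%:E <= c)%E.
Proof.
move=> mF F0 mf f0 Ff hc.
have mFE n : measurable_fun setT (fun x => (F n x)%:E) by exact/measurable_EFinP.
have F0E n x : setT x -> (0 <= (F n x)%:E)%E by rewrite lee_fin.
have lf0 x : (0 <= limn_einf (fun n => (F n x)%:E))%E.
  rewrite limn_einf_lim; apply: lime_ge; first exact: is_cvg_einfs.
  by apply: nearW => n; apply: le_ereal_inf_tmp => _ [k _ <-]; rewrite lee_fin.
have -> : (\int[mu]_x (f x)%:E = \int[mu]_x limn_einf (fun n => (F n x)%:E))%E.
  apply: ge0_ae_eq_integral => //.
  - exact/measurable_EFinP.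
  - have := measurable_fun_limn_esup (fun n => measurableT_comp (@oppe_measurable R setT) (mFE n)).
    move=> /(measurableT_comp (@oppe_measurable R setT)).
    by congr measurable_fun; apply/funext => x.
  - by move=> x _; rewrite lee_fin.
  apply: filterS Ff => x Fx _; apply/esym; apply: (cvg_limn_einf_sup _).1.
  by apply: cvg_EFin; [exact: nearW|exact: Fx].
apply: le_trans (fatou _ measurableT mFE F0E) _.
by apply: le_trans (limn_einf_sup _) _; rewrite limn_esup_lim;
  apply: lime_le; [exact: is_cvg_esups|apply: nearW => n; apply: ge_ereal_sup => _ [k _ <-]].
Qed.

End fatou.

(** * The spectral symbol of the difference quotient of the semigroup *)

Section difference_quotient.
Context {R : realType}.
Implicit Types t l : R.

Definition dquot t l : R := t^-1 * (1 - expR (- (t * l))).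

(** [exp x >= 1 + x] at [x = - t l] gives the upper bound, and at [x = t l], multiplied by
    [exp (- t l)], the lower one. Both hold for either sign of [l]. *)
Lemma dquot_bounds t l : 0 < t -> l * expR (- (t * l)) <= dquot t l <= l.
Proof.
move=> t0; apply/andP; split; last first.
  by rewrite /dquot ler_pdivrMl//; have := expR_ge1Dx (- (t * l)); lra.
rewrite /dquot ler_pdivlMl//.
have h := expR_ge1Dx (t * l).
have := ler_wpM2r (expR_ge0 (- (t * l))) h; rewrite -expRD subrr expR0.
lra.
Qed.

(** A majorant independent of [t]. By [dquot_bounds] the quotient is at most
    [|l| (1 + exp (- t l))]; for negative [l] the exponential is at most [exp (- l)], and
    [|l| exp (- l)] is absorbed by the squares [l^2] and [exp (- 2 l)]. *)
Lemma dquot_norm_le t l : 0 < t <= 1 ->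
  `|dquot t l| <= 1 + 2 * l ^+ 2 + expR (- (2 * l)).
Proof.
move=> /andP[t0 t1]; have /andP[d1 d2] := dquot_bounds l t0.
have e2 : expR (- (2 * l)) = expR (- l) ^+ 2 by rewrite -expRM_natl; congr expR; ring.
have e1 : expR (- (t * l)) <= 1 + expR (- l).
  have [l0|l0] := leP 0 l.
    rewrite -[leLHS]addr0 lerD ?expR_ge0// -[leRHS]expR0 ler_expR oppr_le0.
    by rewrite mulr_ge0// ltW.
  by rewrite -[leLHS]add0r lerD// ler_expR lerN2; nra.
rewrite e2; have q0 := expR_ge0 (- l); have x0 := expR_ge0 (- (t * l)).
set q := expR (- l) in e1 q0 *; set x := expR (- (t * l)) in e1 x0 d1 *.
have s1 := sqr_ge0 (1 - `|l|); have s2 := sqr_ge0 (`|l| - q).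
have lE : l ^+ 2 = `|l| ^+ 2 by rewrite real_normK ?num_real.
have lx : `|l| * x <= `|l| * (1 + q) by rewrite ler_wpM2l.
apply: (@le_trans _ _ (`|l| + `|l| * x)); last by rewrite lE; nra.
have nl := normr_ge0 l; have lx0 : 0 <= `|l| * x by rewrite mulr_ge0.
have := ler_norm l; have := ler_norm (- l); rewrite normrN => n1 n2.
have n3 : - (`|l| * x) <= l * x by rewrite -mulNr ler_wpM2r// lerNl.
by rewrite ler_norml; apply/andP; split; lra.
Qed.

Lemma cvg_dquot l : dquot t l @[t --> 0^'+] --> l.
Proof.
apply: (@squeeze_cvgr _ _ _ _ (fun t => l * expR (- (t * l))) (fun=> l)).
- near=> t; apply: dquot_bounds; near: t; exact: nbhs_right_gt.
- rewrite -[X in _ --> X]mulr1; apply: cvgM; first exact: cvg_cst.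
  have -> : (1 : R) = expR (- (0 * l)) by rewrite mul0r oppr0 expR0.
  apply: cvg_at_right_filter; apply: continuous_comp; last exact: continuous_expR.
  by apply: cvgN; apply: cvgMl; exact: cvg_id.
- exact: cvg_cst.
Unshelve. all: end_near.
Qed.

Lemma measurable_dquot t : measurable_fun setT (dquot t).
Proof.
apply: measurable_funM => //; apply: measurable_funB => //.
by apply: measurableT_comp => //; apply: measurableT_comp => //; exact: measurable_funM.
Qed.

End difference_quotient.

(** * The Green operator against the generator *)

Section generator.
Context {d : measure_display} {X : measurableType d} {R : realType}.
Variable mu : {sigma_finite_measure set X -> \bar R}.
Variables (p : R -> X -> X -> R) (hp : heat_kernel mu p).
Local Notation C := R[i].
Local Notation T t := (heat_op mu p t).
Implicit Types (f g h u v w : X -> C) (t : R).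

Definition green_op f : X -> C := fun x =>
  (kop mu (green p) (re f) x +i* kop mu (green p) (im f) x)%C.

Lemma L2_green_op f : L2 mu f -> L2 mu (green_op f).
Proof. by move=> /L2P[f1 f2]; apply/L2P; split; exact: rL2_green. Qed.

(** Starts at 1/2, so that every term is in the range of [nrm_green_increment]. *)
Definition tseq n : R := n.+2%:R^-1.

Lemma tseq_gt0 n : 0 < tseq n. Proof. by rewrite invr_gt0. Qed.

Lemma tseq_le n : 0 < tseq n <= 2^-1.
Proof. by rewrite tseq_gt0/= lef_pV2 ?posrE// ler_nat. Qed.

Lemma tseq_le1 n : 0 < tseq n <= 1.
Proof. by have /andP[-> h] := tseq_le n; apply: le_trans h _; lra. Qed.

Lemma cvg_tseq : tseq n @[n --> \oo] --> 0.
Proof. by have := @cvg_harmonic R; rewrite -cvg_shiftS. Qed.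

Lemma cvg_tseq_at_right (F : R -> R) (l : R) :
  F t @[t --> 0^'+] --> l -> F (tseq n) @[n --> \oo] --> l.
Proof.
move=> /cvg_at_rightP; apply; split; [exact: tseq_gt0|exact: cvg_tseq].
Qed.

Lemma rip_green_op_increment t f : 0 < t <= 2^-1 -> L2 mu f ->
  rip mu (fun x => green_op f x - T t (green_op f) x) (fun x => green_op f x - T t (green_op f) x) <=
  9 * t ^+ 2 * rip mu f f.
Proof.
move=> t12 /L2P[f1 f2]; have /andP[t0 _] := t12.
have key (a : X -> R) : rL2 mu a ->
    ip mu (fun x => kop mu (green p) a x - kop mu (hk p t) (kop mu (green p) a) x)
          (fun x => kop mu (green p) a x - kop mu (hk p t) (kop mu (green p) a) x) <=
    9 * t ^+ 2 * ip mu a a.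
  move=> a2; rewrite -[X in X <= _]nrm_sqr -[X in _ <= _ * X]nrm_sqr.
  have -> : 9 * t ^+ 2 * nrm mu a ^+ 2 = (3 * t * nrm mu a) ^+ 2 by ring.
  rewrite lerXn2r ?nnegrE ?nrm_ge0//; first by rewrite !mulr_ge0 ?nrm_ge0// ltW.
  exact: nrm_green_increment.
by rewrite /rip !reB !imB !re_heat_op// !im_heat_op// mulrDr lerD// key.
Qed.

Lemma cvg_rip_green_op_increment u f : L2 mu u -> L2 mu f ->
  t^-1 * rip mu (fun x => green_op f x - T t (green_op f) x) u @[t --> 0^'+] -->
  rip mu (fun x => f x - green_op f x) u.
Proof.
move=> /L2P[u1 u2] /L2P[f1 f2].
have h : t^-1 * ip mu (fun x => kop mu (green p) (re f) x - kop mu (hk p t) (kop mu (green p) (re f)) x) (re u) +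
      t^-1 * ip mu (fun x => kop mu (green p) (im f) x - kop mu (hk p t) (kop mu (green p) (im f)) x) (im u)
      @[t --> 0^'+] --> rip mu (fun x => f x - green_op f x) u.
  by rewrite /rip reB imB; apply: cvgD; exact: cvg_green_increment.
apply: cvg_trans h; apply: near_eq_cvg; near=> t.
have t0 : 0 < t by near: t; exact: nbhs_right_gt.
by rewrite /rip !reB !imB !re_heat_op// !im_heat_op// mulrDr.
Unshelve. all: end_near.
Qed.

Variables (E : set R -> (X -> C) -> X -> C) (nu : (X -> C) -> {measure set R -> \bar R}).
Hypothesis hE : spectral_measure mu E nu.
Hypothesis hP : forall (t : R) f, 0 <= t -> L2 mu f ->
  spectral_integral mu nu (fun l => expR (- (t * l))) f (T t f).

(** The squared difference quotients have integral [t^-2] times the squared norm of the increment,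
    at most 9 times that of [f] uniformly in [t]; Fatou's lemma passes to the limit [l ^+ 2]. *)
Lemma green_op_domain f : L2 mu f -> (\int[nu (green_op f)]_l (l ^+ 2)%:E < +oo)%E.
Proof.
move=> f2; have w2 := L2_green_op f2.
apply: (@le_lt_trans _ _ (9 * rip mu f f)%:E); last exact: ltry.
apply: (@fatou_bound _ _ _ (nu (green_op f)) (fun n l => dquot (tseq n) l ^+ 2)).
- by move=> n; apply: measurable_funX; exact: measurable_dquot.
- by move=> n l; exact: sqr_ge0.
- exact: exprn_measurable.
- by move=> l; exact: sqr_ge0.
- apply: aeW => l; rewrite expr2; under eq_fun do rewrite expr2.
  by apply: cvgM; apply: (cvg_tseq_at_right (F := dquot^~ l)); exact: cvg_dquot.
move=> n; have t0 := tseq_gt0 n; have t12 := tseq_le n.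
under eq_integral do rewrite /dquot exprMn EFinM.
rewrite ge0_integralZl_EFin ?sqr_ge0//.
- rewrite (integral_nu_increment hp hE hP)// -EFinM lee_fin exprVn ler_pdivrMl ?exprn_gt0//.
  by apply: le_trans (rip_green_op_increment t12 f2) _; rewrite le_eqVlt; apply/orP; left; apply/eqP; ring.
- by move=> l _; rewrite lee_fin sqr_ge0.
- apply/measurable_EFinP; apply: measurable_funX; apply: measurable_funB => //.
  by apply: measurableT_comp => //; apply: measurableT_comp => //; exact: measurable_funM.
Qed.

Lemma nu_dominating g : L2 mu g -> (\int[nu g]_l (l ^+ 2)%:E < +oo)%E ->
  (nu g).-integrable setT (EFin \o (fun l => 1 + 2 * l ^+ 2 + expR (- (2 * l)))).
Proof.
move=> g2 hl; have ie := integrable_nu_exp hP (ler0n R 2) g2.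
have il : (nu g).-integrable setT (EFin \o (fun l => l ^+ 2)).
  by apply: ge0_Rintegrable => // l _; exact: sqr_ge0.
have i1 := nu_integrable_cst hE 1 g2.
exact: (RintegrableD measurableT
  (RintegrableD measurableT i1 (RintegrableZl measurableT 2 il)) ie).
Qed.

Lemma cvg_nu_dquot g : L2 mu g -> (\int[nu g]_l (l ^+ 2)%:E < +oo)%E ->
  \int[nu g]_l dquot (tseq n) l @[n --> \oo] --> \int[nu g]_l l.
Proof.
move=> g2 hl; have iD := nu_dominating g2 hl.
have [||||ii _ h] := @dominated_convergence _ _ _ (nu g) setT measurableT
  (fun n l => (dquot (tseq n) l)%:E) EFin _ _ _ _ iD.
- by move=> n; apply/measurable_EFinP; exact: measurable_dquot.
- exact/measurable_EFinP.
- apply: aeW => l _; apply: cvg_EFin; first exact: nearW.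
  by apply: (cvg_tseq_at_right (F := dquot^~ l)); exact: cvg_dquot.
- by apply: aeW => l n _; rewrite lee_fin dquot_norm_le// tseq_le1.
by apply: fine_cvg; rewrite /Rintegral fineK ?integrable_fin_num.
Qed.

(** Polarization of the pair [u], [w] integrates against the measures of [u + w] and [u - w], so
    both must have a finite second moment. *)
Lemma nu_sum_domain u w : L2 mu u -> L2 mu w ->
  (\int[nu u]_l (l ^+ 2)%:E < +oo)%E -> (\int[nu w]_l (l ^+ 2)%:E < +oo)%E ->
  (\int[nu (fun x => (u x + w x)%R)]_l (l ^+ 2)%:E < +oo)%E /\
  (\int[nu (fun x => (u x - w x)%R)]_l (l ^+ 2)%:E < +oo)%E.
Proof.
move=> u2 w2 hu hw.
have sq0 (m : {measure set R -> \bar R}) : (0 <= \int[m]_l (l ^+ 2)%:E)%E.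
  by apply: integral_ge0 => l _; rewrite lee_fin sqr_ge0.
have := integral_nu_parallelogram hE (phi := fun l => l ^+ 2) (exprn_measurable 2)
  (fun l => sqr_ge0 l) u2 w2 => par.
have fin : (2%:E * \int[nu u]_l (l ^+ 2)%:E + 2%:E * \int[nu w]_l (l ^+ 2)%:E < +oo)%E.
  by rewrite lte_add_pinfty// lte_mul_pinfty// lee_fin.
by split; apply: le_lt_trans fin; rewrite -par ?leeDl ?leeDr.
Qed.

Lemma rip_green_op_generator u v f : L2 mu f ->
  spectral_integral mu nu (fun l => l) u v ->
  rip mu v (green_op f) = rip mu u (fun x => f x - green_op f x).
Proof.
move=> f2 [u2 v2 hu hv]; have w2 := L2_green_op f2; have hw := green_op_domain f2.
have [hp1 hm1] := nu_sum_domain u2 w2 hu hw.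
have up2 := L2D u2 w2; have um2 := L2B u2 w2.
rewrite -[LHS]Re_L2inner// hv// Re_polar_integral [RHS]ripC.
have lim1 := cvg_tseq_at_right (cvg_rip_green_op_increment u2 f2).
suff lim2 : (tseq n)^-1 * rip mu (fun x => green_op f x - T (tseq n) (green_op f) x) u @[n --> \oo] -->
    4^-1 * (\int[nu (fun x => u x + green_op f x)]_l l - \int[nu (fun x => u x - green_op f x)]_l l).
  exact: (cvg_unique _ lim2 lim1).
have lim3 : 4^-1 * (\int[nu (fun x => u x + green_op f x)]_l dquot (tseq n) l -
    \int[nu (fun x => u x - green_op f x)]_l dquot (tseq n) l) @[n --> \oo] -->
    4^-1 * (\int[nu (fun x => u x + green_op f x)]_l l - \int[nu (fun x => u x - green_op f x)]_l l).
  by apply: cvgM; [exact: cvg_cst|apply: cvgB; exact: cvg_nu_dquot].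
apply: cvg_trans lim3; apply: near_eq_cvg; apply: nearW => n.
have t0 := tseq_gt0 n; set t := tseq n in t0 *.
have dq g : L2 mu g -> \int[nu g]_l dquot t l =
    t^-1 * (\int[nu g]_l expR (- (0 * l)) - \int[nu g]_l expR (- (t * l))).
  move=> g2; have i1 := integrable_nu_exp hP (lexx 0) g2.
  have i2 := integrable_nu_exp hP (ltW t0) g2.
  rewrite -RintegralB// -RintegralZl//; last exact: RintegrableB.
  by apply: eq_Rintegral => l _; rewrite /dquot mul0r oppr0 expR0.
(* At time 0 the semigroup is the identity, which expresses [rip u (green_op f)] by the same
   polarized formula; hence the constant 1 is written [exp (- (0 * l))] in [dq]. *)
have e1 := rip_heatE hP (lexx 0) u2 w2; rewrite heat_op0 in e1.
have e2 := rip_heatE hP (ltW t0) u2 w2.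
rewrite !dq// ripBl//; last exact: L2_heat.
rewrite (rip_heat_sym hp t0 w2 u2) [rip mu (green_op f) _]ripC [rip mu (green_op f) (T t u)]ripC e1 e2.
by ring.
Qed.

End generator.

(** * The Green operator is the resolvent *)

Section resolvent_operator.
Context {d : measure_display} {X : measurableType d} {R : realType}.
Variable mu : {sigma_finite_measure set X -> \bar R}.
Variables (p : R -> X -> X -> R) (hp : heat_kernel mu p).
Local Notation C := R[i].
Variables (H : @graph d X R) (hH : heat_operator mu p H).
Implicit Types (f g h u v w : X -> C).

Let rip_green_op u v f : H u v -> L2 mu f ->
  rip mu v (green_op mu p f) = rip mu u (fun x => f x - green_op mu p f x).
Proof.
have [_ _ [E [nu [hE hHE hP]]]] := hH => /hHE huv f2.
exact: (rip_green_op_generator hp hE hP f2 huv).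
Qed.

Lemma green_op_resolvent f : L2 mu f -> H (green_op mu p f) (fun x => f x - green_op mu p f x).
Proof.
move=> f2; have [[opH _ adjH] _ _] := hH.
have w2 := L2_green_op hp f2; have fw2 := L2B f2 w2.
apply/adjH; split => // u v huv; have [u2 v2] := operator_L2 opH huv.
(* The domain is stable under multiplication by i, which gives the imaginary part of the adjoint
   identity. *)
have hiuv : H (fun x => 'i%C * u x) (fun x => 'i%C * v x).
  have := operator_linear opH 'i%C huv (operator0 opH).
  by congr H; apply/funext => x; rewrite addr0.
have [iu2 iv2] := operator_L2 opH hiuv.
apply/eqP; rewrite eq_complex; apply/andP; split; apply/eqP.
  by rewrite !Re_L2inner//; exact: rip_green_op.
by rewrite !Im_L2inner//; congr (- _); exact: rip_green_op.
Qed.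

(** The difference D of two solutions satisfies H D = - D, and nonnegativity of H forces its norm to
    vanish. *)
Lemma resolvent_unique f g : L2 mu f -> H g (fun x => f x - g x) ->
  g = green_op mu p f %[ae mu].
Proof.
move=> f2 hg; have [[opH _ _] nonnegH _] := hH.
have hw := green_op_resolvent f2; have w2 := L2_green_op hp f2.
have [g2 _] := operator_L2 opH hg.
have := operator_linear opH (-1) hw hg.
have -> : (fun x => -1 * green_op mu p f x + g x) = (fun x => g x - green_op mu p f x).
  by apply/funext => x; rewrite mulN1r addrC.
have -> : (fun x => -1 * (f x - green_op mu p f x) + (f x - g x)) = (fun x => green_op mu p f x - g x).
  by apply/funext => x; rewrite mulN1r opprB -addrA [- f x + _]addrC; ring.
move=> /nonnegH; rewrite lecE => /andP[_].
have gw2 := L2B g2 w2; have wg2 := L2B w2 g2.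
rewrite Re_L2inner// => h.
have r0 : rip mu (fun x => g x - green_op mu p f x) (fun x => g x - green_op mu p f x) = 0.
  apply/eqP; rewrite eq_le rip_ge0 andbT -oppr_ge0; apply: le_trans h _.
  by rewrite !ripBl//; lra.
have := rip_eq0 gw2 r0; apply: filterS => x /= e xT.
by apply/eqP; rewrite -subr_eq0 e.
Qed.

End resolvent_operator.

(** * Potentials composed with the resolvent *)

Section potential.
Context {d : measure_display} {X : measurableType d} {R : realType}.
Variable mu : {sigma_finite_measure set X -> \bar R}.
Variables (p : R -> X -> X -> R) (hp : heat_kernel mu p).
Variables (F1 : X -> R) (mF1 : measurable_fun setT F1) (F1_gt0 : forall x, 0 < F1 x)
  (F2 : R -> R) (mF2 : measurable_fun [set t : R | 0 < t] F2)
  (F2_gt0 : forall t : R, 0 < t -> 0 < F2 t)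
  (q : R) (q_ge1 : 1 <= q)
  (p_le : forall (t : R) (x : X), 0 < t -> p t x x <= F1 x * F2 t).
Local Notation leb := (@lebesgue_measure R).
Local Notation P t := (kop mu (hk p t)).
Local Notation G := (kop mu (green p)).
Implicit Types (f V : X -> R).

(** The factor of [exp (- t)] in the hypothesis on [F2]. Its value 1 for [t <= 0], where
    [exp_weight] is 0, keeps it positive so that it can be divided by. *)
Definition time_weight (t : R) : R := if 0 < t then F2 t `^ (1 / (2 * q)) else 1.

Lemma time_weight_gt0 t : 0 < time_weight t.
Proof. by rewrite /time_weight; case: ifPn => // t0; exact: powR_gt0 (F2_gt0 t0). Qed.

Lemma measurable_time_weight : measurable_fun setT time_weight.
Proof.
apply: measurable_fun_if => //; first exact: measurable_fun_ltr.
rewrite (_ : _ `&` _ = [set t | 0 < t]); first exact: (measurableT_comp (measurable_powR _) mF2).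
by rewrite setTI; apply/seteqP; split.
Qed.

Let q0 : 0 < q. Proof. exact: lt_le_trans q_ge1. Qed.

(** After scaling by [r = y^(1/q)] this is [x <= x^q + 1] for [x = v^2 / r]. The free parameter [y]
    serves to balance two estimates. *)
Lemma sqr_le_powR (y v : R) : 0 < y ->
  v ^+ 2 <= y `^ q^-1 * (`|v| `^ (2 * q) / y + 1).
Proof.
move=> y0; set r := y `^ q^-1.
have r0 : 0 < r by exact: powR_gt0.
have rq : r `^ q = y by rewrite /r -powRrM mulVf ?gt_eqF// powRr1// ltW.
have -> : `|v| `^ (2 * q) / y = (v ^+ 2 / r) `^ q.
  rewrite powRrM powR_mulrn// real_normK ?num_real//.
  rewrite powRM ?sqr_ge0 ?invr_ge0 ?(ltW r0)//; congr (_ * _).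
  by rewrite -[in LHS]rq -[r^-1]powR_inv1 ?(ltW r0)// -powRrM mulN1r powRN.
rewrite -ler_pdivrMl// mulrC; set x := v ^+ 2 / r.
have x0 : 0 <= x by rewrite divr_ge0 ?sqr_ge0 ?ltW.
have [x1|x1] := leP x 1; first by apply: le_trans x1 _; rewrite lerDr powR_ge0.
apply: (@le_trans _ _ (x `^ q)); last by rewrite lerDl.
by rewrite -[leLHS]powRr1// ler_powR// ltW.
Qed.

(* Interpolates between the L^oo bound [(P t f x) ^+ 2 <= F1 x * F2 t * |f| ^+ 2]
   and the L^2 contraction. *)
Lemma integral_potential_hk V f (S t : R) : measurable_fun setT V -> rL2 mu f -> 0 < S ->
  (\int[mu]_x (`|V x| `^ (2 * q) * F1 x)%:E <= S%:E)%E -> 0 < t ->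
  (\int[mu]_x ((V x * P t f x) ^+ 2)%:E <=
    (2 * S `^ q^-1 * ip mu f f * time_weight t ^+ 2)%:E)%E.
Proof.
move=> mV f2 S0 VS t0; have [mf _] := f2.
(* With this choice the L^oo part and the contraction part are both at most [r * N], whence the
   factor 2; and [r] is [S^(1/q)] times the square of [time_weight t]. *)
pose y := S * F2 t; have y0 : 0 < y by rewrite mulr_gt0// F2_gt0.
set r := y `^ q^-1; have r0 : 0 <= r by exact: powR_ge0.
have Pf2 := rL2_hkop hp t f2; have [mPf _] := Pf2.
set N := ip mu f f; have N0 : 0 <= N := ip_ge0 _ _.
have mVq : measurable_fun setT (fun x => `|V x| `^ (2 * q) * F1 x).
  apply: measurable_funM => //; apply: (measurableT_comp (measurable_powR (2 * q))).
  exact: measurableT_comp.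
have le1 x : (V x * P t f x) ^+ 2 <=
    r * (N / S * (`|V x| `^ (2 * q) * F1 x)) + r * P t f x ^+ 2.
  have a2 : P t f x ^+ 2 <= F1 x * F2 t * N.
    apply: le_trans (sqr_kop_hk_le hp x t0 f2) _.
    by rewrite ler_wpM2r// hkE// p_le.
  rewrite exprMn; apply: le_trans (ler_wpM2r (sqr_ge0 _) (sqr_le_powR (V x) y0)) _.
  rewrite -/r; set a := P t f x ^+ 2 in a2 *; set B := `|V x| `^ (2 * q).
  have -> : r * (B / y + 1) * a = r * (B / y * a + a) by ring.
  rewrite -mulrDr ler_wpM2l// lerD2r.
  have w0 : 0 <= B by exact: powR_ge0.
  apply: le_trans (ler_wpM2l (divr_ge0 w0 (ltW y0)) a2) _.
  rewrite le_eqVlt; apply/orP; left; apply/eqP; rewrite /y.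
  by field; rewrite !gt_eqF// F2_gt0.
apply: (@le_trans _ _ (\int[mu]_x ((r * (N / S))%:E * (`|V x| `^ (2 * q) * F1 x)%:E +
    r%:E * (P t f x ^+ 2)%:E))%E).
  apply: ge0_le_integral => //.
  - by move=> x _; rewrite lee_fin sqr_ge0.
  - by apply: measurable_sqr; exact: measurable_funM.
  - apply: emeasurable_funD; apply: measurable_funeM; first exact/measurable_EFinP.
    exact: measurable_sqr.
  - by move=> x _; rewrite -!EFinM -EFinD lee_fin -mulrA.
have mVqE : measurable_fun setT (fun x => (`|V x| `^ (2 * q) * F1 x)%:E).
  exact/measurable_EFinP.
have mPE := measurable_sqr mPf.
have rN0 : 0 <= r * (N / S) by rewrite mulr_ge0// divr_ge0// ltW.
have VF0 x : setT x -> (0 <= (`|V x| `^ (2 * q) * F1 x)%:E)%E.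
  by move=> _; rewrite lee_fin mulr_ge0 ?powR_ge0// ltW.
have Psq0 x : setT x -> (0 <= (P t f x ^+ 2)%:E)%E.
  by move=> _; rewrite lee_fin sqr_ge0.
rewrite (ge0_integralD _ measurableT
  (fun x xT => mule_ge0 (_ : 0 <= (r * (N / S))%:E)%E (VF0 x xT)) (measurable_funeM _ mVqE)
  (fun x xT => mule_ge0 (_ : 0 <= r%:E)%E (Psq0 x xT)) (measurable_funeM _ mPE)) ?lee_fin//.
rewrite (ge0_integralZl_EFin _ measurableT VF0 mVqE rN0).
rewrite (ge0_integralZl_EFin _ measurableT Psq0 mPE r0).
rewrite integral_sqrE//.
apply: (@le_trans _ _ ((r * (N / S))%:E * S%:E + r%:E * N%:E)%E).
  apply: leeD; first by rewrite lee_wpmul2l// lee_fin mulr_ge0 ?divr_ge0 ?ltW.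
  by rewrite lee_wpmul2l ?lee_fin// ip_kop_le//; exact: subker_hk.
rewrite -!EFinM -EFinD lee_fin /time_weight t0.
have -> : r = S `^ q^-1 * (F2 t `^ (1 / (2 * q))) ^+ 2.
  rewrite /r /y powRM ?(ltW S0) ?(ltW (F2_gt0 t0))//; congr (_ * _).
  rewrite -powR_mulrn ?powR_ge0// -powRrM; congr (_ `^ _); field; exact: lt0r_neq0.
rewrite le_eqVlt; apply/orP; left; apply/eqP; field; exact: lt0r_neq0.
Qed.

(** [sqr_kop_mixk_le] with weight [time_weight] costs one factor [C] and divides by the weight.
    After Tonelli, [integral_potential_hk] contributes the square of the weight, so a single power
    is left and its integral gives the second [C]. *)
Lemma integral_potential_green V f (S C : R) : measurable_fun setT V -> rL2 mu f -> 0 < S ->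
  (\int[mu]_x (`|V x| `^ (2 * q) * F1 x)%:E <= S%:E)%E ->
  0 < C -> (\int[leb]_t (exp_weight t * time_weight t)%:E <= C%:E)%E ->
  (\int[mu]_x ((V x * G f x) ^+ 2)%:E <= (2 * C ^+ 2 * S `^ q^-1 * ip mu f f)%:E)%E.
Proof.
move=> mV f2 S0 VS C0 hC; have [mf _] := f2.
pose A t x := P t (fun y => `|f y|) x.
have nf2 := rL2_norm f2.
have mA : measurable_fun setT (fun z : R * X => A z.1 z.2).
  apply: (@measurable_Rintegral _ _ _ _ _ mu (fun u : R * X * X => hk p u.1.1 u.1.2 u.2 * `|f u.2|)).
  apply: measurable_funM; first exact: (measurable_hk hp).
  by apply: measurableT_comp => //; exact: (measurableT_comp mf measurable_snd).
have mtw := measurable_time_weight; have mew := @measurable_exp_weight R.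
have mtw' : measurable_fun setT (fun t => (time_weight t)^-1).
  rewrite (_ : (fun t => _) = (fun t => time_weight t `^ (-1))).
    exact: (measurableT_comp (measurable_powR (-1)) mtw).
  by apply/funext => t; rewrite powR_inv1// ltW// time_weight_gt0.
pose K (z : R * X) := exp_weight z.1 / time_weight z.1 * (V z.2 * A z.1 z.2) ^+ 2.
have mK : measurable_fun setT (fun z => (K z)%:E).
  apply/measurable_EFinP; apply: measurable_funM.
    by apply: measurable_funM; [exact: measurableT_comp mew measurable_fst|
      exact: (measurableT_comp mtw' measurable_fst)].
  by apply: measurable_funX; apply: measurable_funM => //; exact: measurableT_comp mV measurable_snd.
have mK' : @measurable_fun _ _ (measurableTypeR R * X)%type _ setT (fun z => (K z)%:E) by exact: mK.
have K0 z : (0 <= (K z)%:E)%E.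
  by rewrite lee_fin mulr_ge0 ?sqr_ge0// divr_ge0 ?exp_weight_ge0 ?ltW ?time_weight_gt0.
have pw x : (((V x * G f x) ^+ 2)%:E <= C%:E * \int[leb]_t (K (t, x))%:E)%E.
  rewrite exprMn EFinM.
  (* Holds for every [x], as the slices of the heat kernel are square integrable, and not merely
     almost every one. *)
  have hx : forall t, mu.-integrable setT (EFin \o (fun y => hk p t x y * f y)).
    move=> t; have [t0|t0] := ltP 0 t.
      by apply: integrable_mul => //; exact: rL2_hk.
    rewrite (_ : (fun y => _) = (fun=> 0)); first exact: integrable0.
    by apply/funext => y; rewrite /hk ltNge t0 mul0r.
  have : ((G f x ^+ 2)%:E <=
      C%:E * \int[leb]_t (exp_weight t / time_weight t * A t x ^+ 2)%:E)%E.
    apply: sqr_kop_mixk_le => //.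
    - exact: exp_weight_ge0.
    - exact: exp_weight_le1.
    - exact: (measurable_hk hp).
    - exact: (subker_hk hp).
    - exact: time_weight_gt0.
  move=> /(lee_wpmul2l (_ : 0 <= (V x ^+ 2)%:E)%E); rewrite lee_fin sqr_ge0 => /(_ erefl).
  move/le_trans; apply; rewrite muleCA lee_wpmul2l ?lee_fin ?(ltW C0)//.
  rewrite -ge0_integralZl_EFin ?sqr_ge0//.
  - rewrite le_eqVlt; apply/orP; left; apply/eqP; apply: eq_integral => t _.
    by rewrite -EFinM; congr (_%:E); rewrite /K/= exprMn /A; ring.
  - move=> t _; rewrite lee_fin mulr_ge0 ?sqr_ge0// divr_ge0 ?exp_weight_ge0 ?ltW ?time_weight_gt0//.
  - apply/measurable_EFinP; apply: measurable_funM; first exact: measurable_funM.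
    by apply: measurable_funX; exact: (measurableT_comp mA (pair2_measurable x)).
have mGf : measurable_fun setT (G f) by case: (rL2_green hp f2).
have mIK : measurable_fun setT (fun x => \int[leb]_t (K (t, x))%:E)%E.
  exact: (measurable_fun_fubini_tonelli_G _ mK' K0).
apply: (@le_trans _ _ (\int[mu]_x (C%:E * \int[leb]_t (K (t, x))%:E))%E).
  apply: ge0_le_integral => //.
  - by move=> x _; rewrite lee_fin sqr_ge0.
  - by apply: measurable_sqr; exact: measurable_funM.
  - exact: measurable_funeM.
rewrite ge0_integralZl_EFin ?(ltW C0)//; last by move=> x _; apply: integral_ge0.
rewrite -(fubini_tonelli _ mK' K0).
pose c := 2 * S `^ q^-1 * ip mu f f.
have c0 : 0 <= c by rewrite !mulr_ge0 ?powR_ge0 ?ip_ge0.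
have -> : (2 * C ^+ 2 * S `^ q^-1 * ip mu f f)%:E = (C%:E * (c%:E * C%:E))%E.
  by rewrite -!EFinM; congr (_%:E); rewrite /c; ring.
rewrite lee_wpmul2l ?lee_fin ?(ltW C0)//.
apply: (@le_trans _ _ (\int[leb]_t (c%:E * (exp_weight t * time_weight t)%:E))%E); last first.
  rewrite ge0_integralZl_EFin//.
  - by rewrite lee_wpmul2l ?lee_fin.
  - by move=> t _; rewrite lee_fin mulr_ge0 ?exp_weight_ge0 ?ltW ?time_weight_gt0.
  - by apply/measurable_EFinP; exact: measurable_funM.
apply: ge0_le_integral => //.
- by move=> t _; apply: integral_ge0.
- exact: (measurable_fun_fubini_tonelli_F _ mK' K0).
- by apply: measurable_funeM; apply/measurable_EFinP; exact: measurable_funM.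
move=> t _; rewrite /K /=; under eq_integral do rewrite EFinM.
have e0 : 0 <= exp_weight t / time_weight t.
  by rewrite divr_ge0 ?exp_weight_ge0 ?ltW ?time_weight_gt0.
have mVA : measurable_fun setT (fun x => V x * A t x).
  by apply: measurable_funM => //; exact: (measurableT_comp mA (pair1_measurable t)).
rewrite ge0_integralZl_EFin//; last 2 first.
- by move=> x _; rewrite lee_fin sqr_ge0.
- exact: measurable_sqr.
have [t0|t0] := ltP 0 t; last by rewrite /exp_weight ltNge t0/= !mul0r !mul0e mule0.
apply: le_trans (lee_wpmul2l _ (integral_potential_hk mV nf2 S0 VS t0)) _.
  by rewrite lee_fin.
have -> : ip mu (fun x => `|f x|) (fun x => `|f x|) = ip mu f f.
  by rewrite -!nrm_sqr nrm_norm.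
rewrite -!EFinM lee_fin le_eqVlt; apply/orP; left; apply/eqP; rewrite /c.
by field; rewrite gt_eqF// time_weight_gt0.
Qed.

End potential.

Lemma cauchy_cvgn {R : realType} (u : nat -> R) :
  (forall e : R, 0 < e -> exists N, forall n m, (N <= n)%N -> (N <= m)%N -> `|u n - u m| <= e) ->
  cvgn u.
Proof.
move=> hu; apply/cauchy_cvgP; apply: cauchy_exP => e e0.
have e20 : 0 < e / 2 by rewrite divr_gt0.
have [N hN] := hu _ e20; exists (u N); exists N => // n /= Nn; rewrite -ball_normE /=.
apply: le_lt_trans (hN N n (leqnn N) Nn) _.
by rewrite ltr_pdivrMr// ltr_pMr// ltr1n.
Qed.

Lemma homo_ltn_geid (s : nat -> nat) : {homo s : m n / (m < n)%N} -> forall n, (n <= s n)%N.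
Proof. by move=> hs; elim=> // n ih; apply: leq_ltn_trans ih (hs _ _ _). Qed.

(** * Compactness *)

Section diagonal.
Context {R : realType}.

(* The values of [l] are limits along an ultrafilter finer than [\oo], whose
   members are infinite sets: this replaces the diagonal extraction. *)
Lemma bounded_double_sequence (u : nat -> nat -> R) (M : R) :
  (forall m n, `|u m n| <= M) ->
  exists s : nat -> nat, {homo s : m n / (m < n)%N} /\
    forall m, cvgn (fun n => u m (s n)).
Proof.
move=> uM; have [U [UU sU]] := ultraFilterLemma (@eventually_filter).
have lim m : exists l : R, u m @ U --> l.
  have UM : (u m @ U) `[- M, M]%classic.
    apply: (@filterS _ U _ setT); last exact: filterT.
    by move=> n _; rewrite /= in_itv/= -ler_norml.
  have [l [_ hl]] := @segment_compact R (- M) M (u m @ U) _ UM.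
  exists l; apply/cvgrPdist_lt => e e0.
  have [//|US] := in_ultra_setVsetC [set n | `|l - u m n| < e] UU.
  have UI : U (u m @^-1` (u m @` ~` [set n | `|l - u m n| < e])).
    by move: US; apply: filterS => n nS; exists n.
  have [_ [[n nS <-]]] := hl _ _ UI (nbhsx_ballx l e e0).
  by rewrite -ball_normE.
have [l hl] := choice lim.
have pick (kN : nat * nat) : exists n, (kN.2 <= n)%N /\
    forall m, (m <= kN.1)%N -> `|l m - u m n| < kN.1.+1%:R^-1.
  case: kN => k N /=.
  have hk j : U [set n | forall m, (m < j)%N -> `|l m - u m n| < k.+1%:R^-1].
    elim: j => [|j ih]; first by apply: filterS filterT => n _ m.
    have k0 : 0 < k.+1%:R^-1 :> R by rewrite invr_gt0.
    have /cvgrPdist_lt/(_ _ k0) := hl j; apply: filterS2 ih => n h1 h2 m.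
    by rewrite ltnS leq_eqVlt => /orP[/eqP ->|mj]; [exact: h2|exact: h1].
  have hN : U [set n | (N <= n)%N] by apply: sU; exists N.
  have UP : ProperFilter U by exact: ultra_proper.
  have [n [n1 n2]] := filter_ex (@filterI _ U _ _ _ hN (hk k.+1)).
  by exists n; split=> // m mk; apply: n2.
have [c hc] := choice pick.
(* Each index is chosen beyond the previous one, with precision [1 / (n + 1)] for the first [n + 1]
   sequences at once. *)
pose s := fix s n := if n is k.+1 then c (k.+1, (s k).+1) else c (0, 0)%N.
have sS n : (s n < s n.+1)%N by have [] := hc (n.+1, (s n).+1).
exists s; split; first exact: (homo_ltn ltn_trans sS).
have sE n m : (m <= n)%N -> `|l m - u m (s n)| < n.+1%:R^-1.
  by case: n => [|n] mn; [have [_] := hc (0, 0)%N|have [_] := hc (n.+1, (s n).+1)]; apply.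
move=> m; apply/cvg_ex; exists (l m); apply/cvgrPdist_lt => e e0.
near=> n; apply: (@lt_trans _ _ n.+1%:R^-1); last by near: n; exact: near_infty_natSinv_lt (PosNum e0).
have mn : (m <= n)%N by near: n; exact: nbhs_infty_ge.
exact: sE.
Unshelve. all: end_near.
Qed.

End diagonal.

Section weak_compactness.
Context {d : measure_display} {X : measurableType d} {R : realType}.
Variable mu : {measure set X -> \bar R}.
Implicit Types (f h c : X -> R).

Inductive combination (g : nat -> X -> R) : (X -> R) -> Prop :=
| combination0 : combination g (fun=> 0)
| combinationD c (a : R) m : combination g c ->
    combination g (fun x => c x + a * g m x).

Lemma rL2_combination g c : (forall n, rL2 mu (g n)) -> combination g c -> rL2 mu c.
Proof.
move=> g2; elim=> [|{}c a m _ c2]; first exact: rL20.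
by apply: rL2D => //; exact: rL2Z.
Qed.

(* A combination [c] of the [g m] that nearly minimizes the distance to [h]:
   [h - c] is then nearly orthogonal to all of them. *)
Lemma combination_projection g h (M e : R) : (forall n, rL2 mu (g n)) ->
  (forall n, nrm mu (g n) <= M) -> rL2 mu h -> 0 < e ->
  exists2 c, combination g c & forall n, `|ip mu (g n) (fun x => h x - c x)| <= e.
Proof.
move=> g2 gM h2 e0.
have M0 : 0 <= M by apply: le_trans (gM 0%N); exact: nrm_ge0.
pose K := M + 1; have K0 : 0 < K by rewrite ltr_wpDl.
pose A := [set r : R | exists2 c, combination g c &
  r = ip mu (fun x => h x - c x) (fun x => h x - c x)].
have A0 : A !=set0.
  by exists (ip mu (fun x => h x - 0) (fun x => h x - 0)); exists (fun=> 0) => //; constructor.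
have Alb : has_lbound A by exists 0 => r [c _ ->]; exact: ip_ge0.
have e'0 : 0 < (e / K) ^+ 2 by rewrite exprn_gt0// divr_gt0.
have [r [c hc rE] rlt] := inf_adherent e'0 (conj A0 Alb).
exists c => // n; have c2 := rL2_combination g2 hc.
have hc2 := rL2B h2 c2; set b := ip mu (g n) _.
have G2 : ip mu (g n) (g n) <= K ^+ 2.
  rewrite -nrm_sqr lerXn2r ?nnegrE ?nrm_ge0 ?(ltW K0)//.
  by apply: le_trans (gM n) _; rewrite lerDl.
(* Adding [a * g n] to [c] lowers the squared distance by at least [b^2 / K^2]; since [c] is within
   [(e / K)^2] of the infimum, [|b| <= e]. *)
pose a := b / K ^+ 2.
have hA : inf A <= ip mu (fun x => h x - (c x + a * g n x)) (fun x => h x - (c x + a * g n x)).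
  by apply: ge_inf => //; exists (fun x => c x + a * g n x) => //; constructor.
have ag2 := rL2Z a (g2 n).
have E : ip mu (fun x => h x - (c x + a * g n x)) (fun x => h x - (c x + a * g n x)) =
    r - 2 * a * b + a ^+ 2 * ip mu (g n) (g n).
  have -> : (fun x => h x - (c x + a * g n x)) = (fun x => (h x - c x) - a * g n x).
    by apply/funext => x; rewrite opprD addrA.
  have E0 D : rL2 mu D -> ip mu (fun x => D x - a * g n x) (fun x => D x - a * g n x) =
      ip mu D D - 2 * a * ip mu (g n) D + a ^+ 2 * ip mu (g n) (g n).
    move=> D2; rewrite ipBl ?ipBr//; last exact: rL2B.
    by rewrite (ipC mu D (fun x => a * g n x)) !ipZl ?ipZr//; ring.
  by rewrite E0// -rE.
rewrite E in hA.
have aG : a ^+ 2 * ip mu (g n) (g n) <= a ^+ 2 * K ^+ 2 by rewrite ler_wpM2l ?sqr_ge0.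
have aK : a ^+ 2 * K ^+ 2 = a * b by rewrite /a; field; rewrite gt_eqF.
have ab : a * b <= (e / K) ^+ 2 by lra.
have b2 : b ^+ 2 <= e ^+ 2.
  have -> : b ^+ 2 = a * b * K ^+ 2 by rewrite /a; field; rewrite gt_eqF.
  have -> : e ^+ 2 = (e / K) ^+ 2 * K ^+ 2 by field; rewrite gt_eqF.
  by rewrite ler_wpM2r ?sqr_ge0.
by rewrite -(@ler_pXn2r _ 2)//= ?nnegrE ?(ltW e0)// real_normK ?num_real.
Qed.

(** Diagonal extraction gives convergence against each [g m], hence against their combinations. Any
    other [h] is replaced by a combination, with an error that is uniform over the sequence. *)
Lemma weakly_cauchy_subsequence g (M : R) : (forall n, rL2 mu (g n)) ->
  (forall n, nrm mu (g n) <= M) ->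
  exists s : nat -> nat, {homo s : m n / (m < n)%N} /\
    forall h, rL2 mu h -> cvgn (fun n => ip mu (g (s n)) h).
Proof.
move=> g2 gM; have M0 : 0 <= M by apply: le_trans (gM 0%N); exact: nrm_ge0.
have [|s [hs hcv]] := @bounded_double_sequence R (fun m n => ip mu (g n) (g m)) (M * M).
  move=> m n; apply: le_trans (cauchy_schwarz (g2 n) (g2 m)) _.
  by rewrite ler_pM ?nrm_ge0.
exists s; split=> // h h2.
have hcomb c : combination g c -> cvgn (fun n => ip mu (g (s n)) c).
  elim=> [|{}c a m hc ih].
    rewrite (_ : (fun n => _) = (fun=> 0)); first exact: is_cvg_cst.
    apply/funext => n; rewrite /ip (eq_Rintegral _ (g := fun=> 0)).
      by rewrite /Rintegral integral0.
    by move=> x _; rewrite mulr0.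
  have c2 := rL2_combination g2 hc.
  rewrite (_ : (fun n => _) = (fun n => ip mu (g (s n)) c + a * ip mu (g (s n)) (g m))).
    by apply: is_cvgD => //; apply: is_cvgMr; exact: hcv.
  by apply/funext => n; rewrite ipDr ?ipZr//; exact: rL2Z.
apply: cauchy_cvgn => e e0.
have e30 : 0 < e / 3 by rewrite divr_gt0.
have [c hc ce] := combination_projection g2 gM h2 e30.
have c2 := rL2_combination g2 hc.
have /cvg_ex[l /cvgrPdist_le/(_ (e / 6) _)[|N _ hN]] := hcomb c hc; first by rewrite divr_gt0.
exists N => n m Nn Nm.
have d1 := hN _ Nn; have d2 := hN _ Nm; have p1 := ce (s n); have p2 := ce (s m).
rewrite !ipBr// in p1 p2; move: d1 d2 p1 p2; rewrite /= !ler_norml.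
move=> /andP[? ?] /andP[? ?] /andP[? ?] /andP[? ?]; apply/andP; split; lra.
Qed.

End weak_compactness.

(** * Completeness of L^2 *)

Section completeness.
Context {d : measure_display} {X : measurableType d} {R : realType}.
Variable mu : {measure set X -> \bar R}.

(* Fast Cauchy sequences converge almost everywhere: the series
   [\sum_k 4 ^ k * (w k.+1 - w k) ^ 2] is integrable, hence finite a.e. *)
Lemma fast_cauchy_cvg_ae (w : nat -> X -> R) : (forall n, rL2 mu (w n)) ->
  (forall k, nrm mu (fun x => w k.+1 x - w k x) <= 4^-1 ^+ k) ->
  {ae mu, forall x, cvgn (fun k => w k x)}.
Proof.
move=> w2 wk.
pose D k x := (4 ^+ k * (w k.+1 x - w k x) ^+ 2)%:E.
have D0 k x : (0 <= D k x)%E by rewrite lee_fin mulr_ge0 ?sqr_ge0 ?exprn_ge0.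
have mw2 k : measurable_fun setT (fun x => ((w k.+1 x - w k x) ^+ 2)%:E).
  by apply: measurable_sqr; case: (rL2B (w2 k.+1) (w2 k)).
have mD k : measurable_fun setT (D k).
  rewrite (_ : D k = fun x => (4 ^+ k)%:E * ((w k.+1 x - w k x) ^+ 2)%:E)%E//.
  exact: measurable_funeM.
have intD k : (\int[mu]_x D k x <= (4^-1 ^+ k)%:E)%E.
  under eq_integral do rewrite /D EFinM.
  rewrite ge0_integralZl_EFin ?exprn_ge0//; last by move=> x _; rewrite lee_fin sqr_ge0.
  rewrite integral_sqrE; last exact: rL2B.
  rewrite -EFinM lee_fin -nrm_sqr.
  have := wk k; set y := nrm _ _ => yk.
  have y0 : 0 <= y := nrm_ge0 _ _.
  have y2 : y ^+ 2 <= (4^-1 ^+ k) ^+ 2 by rewrite lerXn2r ?nnegrE ?exprn_ge0 ?invr_ge0.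
  apply: le_trans (ler_wpM2l _ y2) _; first exact: exprn_ge0.
  by rewrite expr2 mulrA -exprMn divff ?pnatr_eq0// expr1n mul1r.
have intS : (\int[mu]_x (\sum_(0 <= k <oo) D k x) < +oo)%E.
  rewrite integral_nneseries//.
  apply: (@le_lt_trans _ _ (\sum_(0 <= k <oo) (4^-1 ^+ k)%:E)%E).
    by apply: lee_nneseries => [k _ _|k _]; [apply: integral_ge0|exact: intD].
  rewrite (_ : (fun k => _) = (fun k => \sum_(0 <= i < k) (4^-1 ^+ i : R)%:E)%E)//.
  apply: (@le_lt_trans _ _ (2 : R)%:E); last exact: ltry.
  apply: lime_le; first by apply: is_cvg_nneseries => k _ _; rewrite lee_fin exprn_ge0 ?invr_ge0.
  apply: nearW => n; rewrite sumEFin lee_fin.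
  have : \sum_(0 <= i < n) (4^-1 ^+ i : R) + 4 / 3 * 4^-1 ^+ n = 4 / 3.
    elim: n => [|n ih]; first by rewrite big_nil expr0; field.
    by rewrite big_nat_recr//= -[RHS]ih exprS; field.
  have : 0 <= 4^-1 ^+ n :> R by rewrite exprn_ge0 ?invr_ge0.
  by set s := \sum_(_ <= _ < _) _; lra.
have mS : measurable_fun setT (fun x => \sum_(0 <= k <oo) D k x)%E.
  exact: ge0_emeasurable_sum.
have S0 x : (0 <= \sum_(0 <= k <oo) D k x)%E by exact: nneseries_ge0.
have iS : mu.-integrable setT (fun x => \sum_(0 <= k <oo) D k x)%E.
  by apply/integrableP; split => //; under eq_integral do rewrite gee0_abs//.
have := integrable_ae measurableT iS; apply: filterS => x /(_ Logic.I) fin.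
pose B := fine (\sum_(0 <= k <oo) D k x)%E.
have B0 : 0 <= B by exact: fine_ge0.
have DB k : 4 ^+ k * (w k.+1 x - w k x) ^+ 2 <= B.
  rewrite -lee_fin fineK// -/(D k x).
  apply: le_trans (nneseries_lim_ge k.+1 (fun i _ _ => D0 i x)).
  by rewrite big_nat_recr//= leeDr// sume_ge0.
(* Each term of the convergent series is at most its sum [B], so the increments at [x] decay like
   [2^-k]. *)
pose b := Num.sqrt B; have b0 : 0 <= b := sqrtr_ge0 _.
have step k : `|w k.+1 x - w k x| <= b * 2^-1 ^+ k.
  have h2 : 0 <= 2^-1 ^+ k :> R by rewrite exprn_ge0 ?invr_ge0.
  rewrite -(@ler_pXn2r _ 2)//= ?nnegrE ?mulr_ge0// real_normK ?num_real//.
  rewrite exprMn sqr_sqrtr// -exprM mulnC exprM.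
  rewrite (_ : 2^-1 ^+ 2 = 4^-1 :> R); last by field.
  by rewrite exprVn ler_pdivlMr ?exprn_gt0// mulrC.
have tail n m : `|w (n + m)%N x - w n x| <= 2 * b * 2^-1 ^+ n.
  (* The subtracted remainder of the geometric series lets the induction on [m] close. *)
  have : `|w (n + m)%N x - w n x| <= 2 * b * 2^-1 ^+ n - 2 * b * 2^-1 ^+ (n + m).
    elim: m => [|m ih]; first by rewrite addn0 !subrr normr0.
    rewrite addnS (_ : _ - w n x = (w (n + m).+1 x - w (n + m)%N x) + (w (n + m)%N x - w n x)); last by ring.
    apply: le_trans (ler_normD _ _) _; apply: le_trans (lerD (step _) ih) _.
    by rewrite exprS; lra.
  have : 0 <= 2 * b * 2^-1 ^+ (n + m) by rewrite !mulr_ge0 ?exprn_ge0 ?invr_ge0.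
  lra.
apply: cauchy_cvgn => e e0.
have : geometric (2 * b) 2^-1 n @[n --> \oo] --> (0 : R).
  by apply: cvg_geometric; rewrite ger0_norm ?invr_ge0// invf_lt1// ltr1n.
have e20 : 0 < e / 2 by rewrite divr_gt0.
move=> /cvgrPdist_le/(_ _ e20)[N _ hN].
exists N => n m Nn Nm.
have := hN N (leqnn N); rewrite /geometric/= sub0r normrN => h.
have {}h := le_trans (ler_norm _) h.
have := tail N (n - N)%N; have := tail N (m - N)%N; rewrite !subnKC//.
rewrite !ler_norml => /andP[? ?] /andP[? ?]; apply/andP; split; lra.
Qed.

(** The limit is the upper limit of a fast subsequence, measurable everywhere by construction
    although convergence is only almost everywhere. Fatou's lemma along the subsequence then bounds
    the distance of each late [v n] to it. *)
Lemma rL2_complete (v : nat -> X -> R) : (forall n, rL2 mu (v n)) ->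
  (forall e : R, 0 < e -> exists N, forall n m, (N <= n)%N -> (N <= m)%N ->
    nrm mu (fun x => v n x - v m x) <= e) ->
  exists2 g, rL2 mu g & nrm mu (fun x => v n x - g x) @[n --> \oo] --> 0.
Proof.
move=> v2 vC.
have q0 k : 0 < 4^-1 ^+ k :> R by rewrite exprn_gt0 ?invr_gt0.
have [N hN] := choice (fun k => vC _ (q0 k)).
pose s := fix s k := if k is j.+1 then maxn (s j).+1 (N k) else N 0%N.
have sS k : (s k < s k.+1)%N by rewrite /= leq_maxl.
have sN k : (N k <= s k)%N by case: k => //= k; rewrite leq_maxr.
have hs : {homo s : m n / (m < n)%N} by exact: (homo_ltn ltn_trans sS).
pose w k := v (s k).
have wk k : nrm mu (fun x => w k.+1 x - w k x) <= 4^-1 ^+ k.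
  by apply: hN => //; apply: leq_trans (sN k) _; exact: ltnW.
have w2 k : rL2 mu (w k) by exact: v2.
have wae := fast_cauchy_cvg_ae w2 wk.
pose g x := fine (limn_esup (fun k => (w k x)%:E)).
have mg : measurable_fun setT g.
  apply: measurableT_comp => //; apply: measurable_fun_limn_esup => k.
  by apply/measurable_EFinP; case: (w2 k).
have wg : {ae mu, forall x, w k x @[k --> \oo] --> g x}.
  apply: filterS wae => x /cvg_ex[/= l wl]; rewrite /g.
  have wlE : (w k x)%:E @[k --> \oo] --> l%:E by apply: cvg_EFin => //; exact: nearW.
  by rewrite (cvg_limn_einf_sup wlE).2.
have est (e : R) : 0 <= e -> forall n, (exists K, forall k, (K <= k)%N -> nrm mu (fun x => v n x - w k x) <= e) ->
    (\int[mu]_x ((v n x - g x) ^+ 2)%:E <= (e ^+ 2)%:E)%E.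
  move=> e0 n [K hK]; have [mv _] := v2 n.
  apply: (@fatou_bound _ _ _ mu (fun k x => (v n x - w (k + K)%N x) ^+ 2)).
  - by move=> k; apply: measurable_funX; case: (rL2B (v2 n) (w2 (k + K)%N)).
  - by move=> k x; exact: sqr_ge0.
  - by apply: measurable_funX; exact: measurable_funB.
  - by move=> x; exact: sqr_ge0.
  - apply: filterS wg => x wgx.
    have h : v n x - w (k + K)%N x @[k --> \oo] --> v n x - g x.
      apply: cvgB; first exact: cvg_cst.
      by rewrite (cvg_shiftn K (fun k => w k x)).
    by rewrite expr2; under eq_fun do rewrite expr2; exact: cvgM.
  move=> k; rewrite integral_sqrE; last exact: rL2B.
  by rewrite lee_fin -nrm_sqr lerXn2r ?nnegrE ?nrm_ge0// hK// leq_addl.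
have gest (e : R) : 0 < e -> exists N0, forall n, (N0 <= n)%N ->
    (\int[mu]_x ((v n x - g x) ^+ 2)%:E <= (e ^+ 2)%:E)%E.
  move=> e0; have [N0 hN0] := vC e e0; exists N0 => n N0n.
  apply: est; first exact: ltW.
  exists N0 => k N0k; apply: hN0 => //; apply: leq_trans N0k _.
  exact: homo_ltn_geid.
have vg2 n0 : (\int[mu]_x ((v n0 x - g x) ^+ 2)%:E <= (1 ^+ 2)%:E)%E ->
    rL2 mu (fun x => v n0 x - g x).
  by move=> h; apply: rL2_leW h; have [mv _] := v2 n0; exact: measurable_funB.
have g2 : rL2 mu g.
  have [N0 hN0] := gest 1 ltr01; have := rL2B (v2 N0) (vg2 _ (hN0 N0 (leqnn _))).
  by congr rL2; apply/funext => x; ring.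
exists g => //; apply/cvgrPdist_le => e e0; have [N0 hN0] := gest e e0.
exists N0 => // n /= N0n; rewrite sub0r normrN ger0_norm ?nrm_ge0//.
apply: nrm_le; first exact: ltW.
by apply: rL2_le (hN0 n N0n); exact: rL2B.
Qed.

End completeness.

(** * Compactness of the potential composed with the Green operator *)

Section compactness.
Context {d : measure_display} {X : measurableType d} {R : realType}.
Variable mu : {sigma_finite_measure set X -> \bar R}.
Variables (p : R -> X -> X -> R) (hp : heat_kernel mu p).
Variables (F1 : X -> R) (mF1 : measurable_fun setT F1) (F1_gt0 : forall x, 0 < F1 x)
  (F2 : R -> R) (F2_gt0 : forall t : R, 0 < t -> 0 < F2 t)
  (p_le : forall (t : R) (x : X), 0 < t -> p t x x <= F1 x * F2 t).
Local Notation P t := (kop mu (hk p t)).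
Local Notation G := (kop mu (green p)).
Variables (V : X -> R) (mV : measurable_fun setT V).
Hypothesis approx : forall e : R, 0 < e -> exists W : X -> R,
  [/\ measurable_fun setT W, exists B : R, forall x, `|W x| <= B,
      (\int[mu]_x (W x ^+ 2 * F1 x)%:E < +oo)%E
    & forall f, rL2 mu f ->
        (\int[mu]_x (((V x - W x) * G f x) ^+ 2)%:E <= (e ^+ 2 * ip mu f f)%:E)%E].

Lemma rL2_bounded_mul (W h : X -> R) (B : R) : measurable_fun setT W ->
  (forall x, `|W x| <= B) -> rL2 mu h ->
  rL2 mu (fun x => W x * h x) /\ nrm mu (fun x => W x * h x) <= B * nrm mu h.
Proof.
move=> mW WB h2; have [mh _] := h2.
have B0 (x : X) : 0 <= B by apply: le_trans (WB x).
have mWh : measurable_fun setT (fun x => W x * h x) by exact: measurable_funM.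
have le1 : (\int[mu]_x ((W x * h x) ^+ 2)%:E <= (B ^+ 2 * ip mu h h)%:E)%E.
  apply: (@le_trans _ _ (\int[mu]_x ((B ^+ 2)%:E * (h x ^+ 2)%:E))%E).
    apply: ge0_le_integral => //.
    - by move=> x _; rewrite lee_fin sqr_ge0.
    - exact: measurable_sqr.
    - by apply: measurable_funeM; exact: measurable_sqr.
    move=> x _; rewrite -EFinM lee_fin exprMn ler_wpM2r ?sqr_ge0//.
    by rewrite -[leLHS]real_normK ?num_real// lerXn2r ?nnegrE// (B0 x).
  rewrite ge0_integralZl_EFin ?sqr_ge0//; last exact: measurable_sqr.
  - by rewrite integral_sqrE.
  - by move=> x _; rewrite lee_fin sqr_ge0.
have Wh2 := rL2_leW mWh le1; split => //.
(* On an empty space [B] could be negative, but all norms are then 0. *)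
have [X0|/existsNP[x _]] := pselect (forall x : X, False); last first.
  have Bx := B0 x; apply: nrm_le; first by rewrite mulr_ge0 ?nrm_ge0.
  by rewrite exprMn nrm_sqr; exact: rL2_le.
have nul f : nrm mu f = 0.
  by rewrite /nrm /ip (eq_Rintegral _ (g := fun=> 0)) ?/Rintegral ?integral0 ?sqrtr0// => x; have := X0 x.
by rewrite !nul mulr0.
Qed.

Lemma rL2_potential_green f : rL2 mu f -> rL2 mu (fun x => V x * G f x).
Proof.
move=> f2; have [W [mW [B WB] _ hW]] := approx ltr01.
have Gf2 := rL2_green hp f2; have [mGf _] := Gf2.
have [WG2 _] := rL2_bounded_mul mW WB Gf2.
have VW2 : rL2 mu (fun x => (V x - W x) * G f x).
  by apply: rL2_leW (hW f f2); apply: measurable_funM => //; exact: measurable_funB.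
have := rL2D VW2 WG2; congr rL2; apply/funext => x; ring.
Qed.

Lemma nrm_potential_le (e : R) (W f : X -> R) : 0 <= e -> measurable_fun setT W -> rL2 mu f ->
  (\int[mu]_x (((V x - W x) * G f x) ^+ 2)%:E <= (e ^+ 2 * ip mu f f)%:E)%E ->
  rL2 mu (fun x => (V x - W x) * G f x) /\ nrm mu (fun x => (V x - W x) * G f x) <= e * nrm mu f.
Proof.
move=> e0 mW f2 h; have [mGf _] := rL2_green hp f2.
have VW2 : rL2 mu (fun x => (V x - W x) * G f x).
  by apply: rL2_leW h; apply: measurable_funM => //; exact: measurable_funB.
split => //; apply: nrm_le; first by rewrite mulr_ge0 ?nrm_ge0.
by rewrite exprMn nrm_sqr; exact: rL2_le.
Qed.

(* [W P_t] maps weakly Cauchy sequences to norm convergent ones: pointwise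
   convergence since the slices of [p t] are square integrable, and domination by
   [W ^+ 2 * F1]. *)
Lemma weakly_cauchy_hk_cvg (t M : R) (W : X -> R) (g : nat -> X -> R) : 0 < t ->
  measurable_fun setT W -> (\int[mu]_x (W x ^+ 2 * F1 x)%:E < +oo)%E ->
  (forall n, rL2 mu (g n)) -> (forall n, nrm mu (g n) <= M) ->
  (forall h, rL2 mu h -> cvgn (fun n => ip mu (g n) h)) ->
  exists2 c, rL2 mu c & forall e : R, 0 < e -> exists N, forall n, (N <= n)%N ->
    rL2 mu (fun x => W x * P t (g n) x - c x) /\
    nrm mu (fun x => W x * P t (g n) x - c x) <= e.
Proof.
move=> t0 mW WF g2 gM gw.
have M0 : 0 <= M by apply: le_trans (gM 0%N); exact: nrm_ge0.
pose c x := limn (fun n => P t (g n) x).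
have cE x : P t (g n) x @[n --> \oo] --> c x.
  have := gw _ (rL2_hk hp x t0); rewrite /c.
  by under eq_fun do rewrite ipC.
have mP n : measurable_fun setT (P t (g n)) by case: (rL2_hkop hp t (g2 n)).
have mc : measurable_fun setT c by apply: (measurable_fun_cvg mP) => x _; exact: cE.
pose K := F2 t * M ^+ 2; have K0 : 0 <= K by rewrite mulr_ge0 ?sqr_ge0// ltW// F2_gt0.
have PK n x : P t (g n) x ^+ 2 <= F1 x * K.
  apply: le_trans (sqr_kop_hk_le hp x t0 (g2 n)) _; rewrite hkE// /K mulrA.
  apply: ler_pM; rewrite ?ip_ge0 ?(heat_kernel_ge0 hp) ?p_le//.
  by rewrite -nrm_sqr lerXn2r ?nnegrE ?nrm_ge0.
have cvgsq (a : nat -> R) (l : R) : a n @[n --> \oo] --> l -> a n ^+ 2 @[n --> \oo] --> l ^+ 2.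
  by move=> al; rewrite expr2; under eq_fun do rewrite expr2; exact: cvgM.
have cK x : c x ^+ 2 <= F1 x * K.
  have := cvgsq _ _ (cE x) => h.
  rewrite -(cvg_lim _ h)//; apply: limr_le; first exact: cvgP h.
  by apply: nearW => n; exact: PK.
(* The factor 4 comes from [(a - b)^2 <= 2 a^2 + 2 b^2], both squares being at most [F1 x * K]. *)
have iD : mu.-integrable setT (EFin \o (fun x => 4 * K * (W x ^+ 2 * F1 x))).
  apply: RintegrableZl => //; apply: ge0_Rintegrable => //.
    by apply: measurable_funM => //; exact: measurable_funX.
  by move=> x _; rewrite mulr_ge0 ?sqr_ge0// ltW.
have mWP n : measurable_fun setT (fun x => W x * P t (g n) x - W x * c x).
  by apply: measurable_funB; exact: measurable_funM.
have [||||_ _ lim] := @dominated_convergence _ _ _ mu setT measurableT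
  (fun n x => ((W x * P t (g n) x - W x * c x) ^+ 2)%:E) (cst 0%E) _ _ _ _ iD.
- by move=> n; exact: measurable_sqr.
- exact: measurable_cst.
- apply: aeW => x _; apply: cvg_EFin; first exact: nearW.
  rewrite -[X in _ --> X](_ : (W x * c x - W x * c x) ^+ 2 = 0); last by rewrite subrr expr0n.
  apply: cvgsq; apply: cvgB; last exact: cvg_cst.
  by apply: cvgM => //; exact: cvg_cst.
- apply: aeW => x n _; rewrite /= lee_fin ger0_norm ?sqr_ge0//.
  rewrite -mulrBr exprMn [leRHS]mulrCA ler_wpM2l ?sqr_ge0//.
  have := PK n x; have := cK x; have := sqr_ge0 (P t (g n) x + c x).
  set a := P t (g n) x; set b := c x; rewrite sqrrB sqrrD; lra.
rewrite integral0 in lim.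
exists (fun x => W x * c x).
  split; first exact: measurable_funM.
  apply: (@le_lt_trans _ _ (\int[mu]_x (4 * K * (W x ^+ 2 * F1 x))%:E)%E); last first.
    exact: (integrable_lty measurableT iD).
  apply: ge0_le_integral => //.
  - by move=> x _; rewrite lee_fin sqr_ge0.
  - by apply: measurable_sqr; exact: measurable_funM.
  - exact: (measurable_int _ iD).
  - move=> x _; rewrite lee_fin exprMn [leRHS]mulrCA ler_wpM2l ?sqr_ge0//.
    by have := cK x; have := mulr_ge0 (ltW (F1_gt0 x)) K0; lra.
move=> e e0; have e2 : 0 < e ^+ 2 by rewrite exprn_gt0.
have := lim => /fine_cvgP[[N1 _ h1] /cvgrPdist_le/(_ _ e2)[N2 _ h2]].
exists (maxn N1 N2) => n; rewrite geq_max => /andP[n1 n2].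
have fin := h1 n n1; have le := h2 n n2; rewrite /= sub0r normrN in le.
have WP2 : rL2 mu (fun x => W x * P t (g n) x - W x * c x).
  by split=> //; move: fin; rewrite fin_numElt => /andP[].
split=> //; apply: nrm_le; first exact: ltW.
by move: le; rewrite integral_sqrE//= ger0_norm ?ip_ge0.
Qed.

(** Along the weakly convergent subsequence, [V G u_n] is within [e / 2] of a function [c] that
    depends on [e]. The three errors, each at most [e / 6], come from replacing [V] by [W], from
    inserting the heat operator after [W], and from the convergence of the resulting sequence. *)
Lemma potential_green_compact (u : nat -> X -> R) (M : R) : (forall n, rL2 mu (u n)) ->
  (forall n, nrm mu (u n) <= M) ->
  exists (s : nat -> nat) (g : X -> R), [/\ {homo s : m n / (m < n)%N}, rL2 mu g &
    nrm mu (fun x => V x * G (u (s n)) x - g x) @[n --> \oo] --> 0].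
Proof.
move=> u2 uM; have M0 : 0 <= M by apply: le_trans (uM 0%N); exact: nrm_ge0.
have Gu2 n : rL2 mu (G (u n)) by exact: rL2_green.
have GuM n : nrm mu (G (u n)) <= M.
  by apply: le_trans (nrm_kop (subker_green hp) (u2 n)) _.
have [s [hs gw]] := weakly_cauchy_subsequence Gu2 GuM.
pose v n x := V x * G (u (s n)) x.
have v2 n : rL2 mu (v n) by exact: rL2_potential_green.
suff [g g2 vg] : exists2 g, rL2 mu g & nrm mu (fun x => v n x - g x) @[n --> \oo] --> 0.
  by exists s, g; split.
apply: rL2_complete => // e e0.
pose e1 := e / 6 / (M + 1).
have M1 : 0 < M + 1 by rewrite ltr_wpDl.
have e10 : 0 < e1 by rewrite !divr_gt0.
have [W [mW [B0 WB0] WF hW]] := approx e10.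
pose B := `|B0| + 1; have B1 : 0 < B by rewrite ltr_wpDl.
have WB x : `|W x| <= B by apply: le_trans (WB0 x) _; rewrite /B; have := ler_norm B0; lra.
(* The first bound allows [nrm_green_increment]; the second makes its constant [3 t], multiplied by
   the bound [B] of [W], at most [e1]. *)
pose t := Num.min 2^-1 (e1 / (3 * B)).
have t0 : 0 < t by rewrite lt_min invr_gt0/= ltr0n/= divr_gt0// mulr_gt0.
have t12 : 0 < t <= 2^-1 by rewrite t0/= ge_min lexx.
have tB : B * (3 * t) <= e1.
  have : t <= e1 / (3 * B) by rewrite ge_min lexx orbT.
  by rewrite ler_pdivlMr ?mulr_gt0//; lra.
have [c c2 hc] := weakly_cauchy_hk_cvg t0 mW WF (fun n => Gu2 (s n)) (fun n => GuM (s n)) gw.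
have e60 : 0 < e / 6 by rewrite divr_gt0.
have [N hN] := hc _ e60.
have e1M : e1 * M <= e / 6.
  by rewrite /e1 mulrAC ler_pdivrMr// ler_wpM2l ?ltW// ltrDl.
have vc n : (N <= n)%N -> nrm mu (fun x => v n x - c x) <= e / 2.
  move=> Nn; have [A2 A] := hN n Nn.
  have [D2 D] := nrm_potential_le (ltW e10) mW (u2 (s n)) (hW _ (u2 (s n))).
  have I2 : rL2 mu (fun x => G (u (s n)) x - P t (G (u (s n))) x).
    by apply: rL2B => //; exact: rL2_hkop.
  have I := nrm_green_increment hp (u2 (s n)) t12.
  have [J2 J] := rL2_bounded_mul mW WB I2.
  have -> : (fun x => v n x - c x) = (fun x => (V x - W x) * G (u (s n)) x +
      W x * (G (u (s n)) x - P t (G (u (s n))) x) + (W x * P t (G (u (s n))) x - c x)).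
    by apply/funext => x; rewrite /v; ring.
  apply: le_trans (nrmD (rL2D D2 J2) A2) _.
  have := nrmD D2 J2.
  have uMn := uM (s n).
  have D' : e1 * nrm mu (u (s n)) <= e / 6.
    by apply: le_trans e1M; rewrite ler_wpM2l// ltW.
  have J' : B * nrm mu (fun x => G (u (s n)) x - P t (G (u (s n))) x) <= e / 6.
    apply: le_trans (ler_wpM2l (ltW B1) I) _; apply: le_trans e1M; rewrite mulrA.
    by apply: ler_pM; rewrite ?nrm_ge0 ?mulr_ge0 ?(ltW B1) ?(ltW t0).
  lra.
exists N => n m Nn Nm.
have -> : (fun x => v n x - v m x) = (fun x => (v n x - c x) - (v m x - c x)).
  by apply/funext => x; ring.
apply: le_trans (nrmB (rL2B (v2 n) c2) (rL2B (v2 m) c2)) _.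
by apply: le_trans (lerD (vc n Nn) (vc m Nm)) _; rewrite -splitr.
Qed.

End compactness.

(** * Integration against a measure with density *)

Section density_integral.
Context {d : measure_display} {X : measurableType d} {R : realType}.
Variables (mu : {measure set X -> \bar R}) (F : X -> R).
Hypotheses (mF : measurable_fun setT F) (F0 : forall x, 0 <= F x).

Import HBNNSimple.

Let integral_density_nnsfun (h : {nnsfun X >-> R}) :
  (\int[density mu mF F0]_x (h x)%:E = \int[mu]_x (h x * F x)%:E)%E.
Proof.
rewrite integralT_nnsfun sintegralE.
under [RHS]eq_integral.
  move=> x _; rewrite EFinM fimfunE -fsumEFin// ge0_mule_fsuml; last first.
    by move=> r; rewrite EFinM nnfun_muleindic_ge0.
  over.
rewrite ge0_integral_fsum//; last 2 first.
- move=> r; apply: emeasurable_funM; last exact/measurable_EFinP.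
  exact/measurable_EFinP/measurableT_comp.
- move=> r x _; apply: mule_ge0; last by rewrite lee_fin.
  by rewrite EFinM nnfun_muleindic_ge0.
apply: eq_fsbigr => r _.
under [RHS]eq_integral do rewrite EFinM -muleA.
have mh : measurable (h @^-1` [set r]) by exact: measurable_funPTI.
have [r0|r0] := ltP r 0.
  rewrite preimage_nnfun0// measure0 mule0 integral0_eq// => x _.
  by rewrite indicE in_set0 mul0e mule0.
rewrite ge0_integralZl_EFin//; last 2 first.
- by move=> x _; rewrite mule_ge0 ?lee_fin.
- by apply: emeasurable_funM; exact/measurable_EFinP.
congr (_ * _)%E; rewrite -[LHS]/(\int[mu]_(x in h @^-1` [set r]) (F x)%:E)%E [LHS]integral_mkcond.
apply: eq_integral => x _.
by rewrite epatch_indic muleC.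
Qed.

Lemma ge0_integral_density (f : X -> R) : measurable_fun setT f -> (forall x, 0 <= f x) ->
  (\int[density mu mF F0]_x (f x)%:E = \int[mu]_x (f x * F x)%:E)%E.
Proof.
move=> mf f0; have mfE : measurable_fun setT (EFin \o f) by exact/measurable_EFinP.
have f0E x : setT x -> (0 <= (EFin \o f) x)%E by rewrite lee_fin.
pose h := nnsfun_approx measurableT mfE.
have hf x : (h n x)%:E @[n --> \oo] --> (f x)%:E by exact: (cvg_nnsfun_approx measurableT mfE f0E).
have hnd x : {homo (fun n => h n x) : a b / (a <= b)%N >-> a <= b}.
  by move=> a b ab; exact/lefP/nd_nnsfun_approx.
transitivity (limn (fun n => \int[density mu mF F0]_x (h n x)%:E)%E).
  rewrite -monotone_convergence//.
  - by apply: eq_integral => x _; apply/esym/cvg_lim => //; exact: hf.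
  - by move=> n; exact/measurable_EFinP.
  - by move=> n x _; rewrite lee_fin.
  - by move=> x _ a b ab; rewrite lee_fin hnd.
transitivity (limn (fun n => \int[mu]_x (h n x * F x)%:E)%E).
  by congr (limn _); apply/funext => n; exact: integral_density_nnsfun.
rewrite -monotone_convergence//.
- apply: eq_integral => x _; apply/cvg_lim => //; rewrite EFinM muleC.
  under eq_fun do rewrite EFinM muleC.
  by apply: cvgeZl => //; exact: hf.
- by move=> n; apply/measurable_EFinP; exact: measurable_funM.
- by move=> n x _; rewrite lee_fin mulr_ge0.
- by move=> x _ a b ab; rewrite lee_fin ler_wpM2r// hnd.
Qed.

End density_integral.

(** * Approximation of the potential by bounded ones *)

Section approximation.
Context {d : measure_display} {X : measurableType d} {R : realType}.
Variable mu : {measure set X -> \bar R}.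
Variables (F1 : X -> R) (mF1 : measurable_fun setT F1) (F1_gt0 : forall x, 0 < F1 x).
Variables (q : R) (q0 : 0 < q).

Let measurable_pow (U : X -> R) : measurable_fun setT U ->
  measurable_fun setT (fun x => `|U x| `^ (2 * q) * F1 x).
Proof.
move=> mU; apply: measurable_funM => //; apply: (measurableT_comp (measurable_powR (2 * q))).
exact: measurableT_comp.
Qed.

Let pow_ge0 (U : X -> R) x : 0 <= `|U x| `^ (2 * q) * F1 x.
Proof. by rewrite mulr_ge0 ?powR_ge0// ltW. Qed.

(** Dominated convergence: at each point the truncated function is 0 once [n] exceeds [|V1 x|]. *)
Lemma truncation_cvg (V1 : X -> R) : measurable_fun setT V1 ->
  (\int[mu]_x (`|V1 x| `^ (2 * q) * F1 x)%:E < +oo)%E ->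
  (\int[mu]_x (`|if n%:R < `|V1 x| then V1 x else 0| `^ (2 * q) * F1 x)%:E)%E @[n --> \oo] --> 0%E.
Proof.
move=> mV1 fV1.
have mU n : measurable_fun setT (fun x => if n%:R < `|V1 x| then V1 x else 0).
  apply: measurable_fun_ifT => //; apply: measurable_fun_ltr => //.
  exact: measurableT_comp.
have iV1 : mu.-integrable setT (EFin \o (fun x => `|V1 x| `^ (2 * q) * F1 x)).
  by apply: ge0_Rintegrable => //; exact: measurable_pow.
have [||||_ _] := @dominated_convergence _ _ _ mu setT measurableT
  (fun n x => (`|if n%:R < `|V1 x| then V1 x else 0| `^ (2 * q) * F1 x)%:E) (cst 0%E) _ _ _ _ iV1.
- by move=> n; apply/measurable_EFinP; exact: measurable_pow.
- exact: measurable_cst.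
- apply: aeW => x _; apply: cvg_near_cst.
  exists (Num.bound `|V1 x|) => // n /= nx.
  rewrite ltNge (le_trans (ltW (archi_boundP (normr_ge0 _))) _) ?ler_nat//=.
  by rewrite normr0 powR0 ?mul0r// mulf_neq0 ?gt_eqF.
- apply: aeW => x n _ /=; rewrite lee_fin ger0_norm; last exact: (pow_ge0 (fun x => if n%:R < `|V1 x| then V1 x else 0)).
  rewrite ler_wpM2r ?(ltW (F1_gt0 x))//; case: ifP => // _.
  by rewrite normr0 powR0 ?powR_ge0// mulf_neq0 ?gt_eqF.
by rewrite integral0.
Qed.

Variables (V V1 V2 : X -> R) (mV : measurable_fun setT V) (mV1 : measurable_fun setT V1)
  (mV2 : measurable_fun setT V2) (V_def : forall x, V x = V1 x + V2 x).
Hypothesis fV1 : (\int[mu]_x (`|V1 x| `^ (2 * q) * F1 x)%:E < +oo)%E.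
Variables (M : R) (M0 : 0 <= M).
Hypothesis V2M : {ae mu, forall x, `|V2 x| <= M}.
Hypothesis V2F : forall c : R, 0 < c ->
  (\int[mu]_(x in [set x | (c <= `|V2 x|)%R]) (F1 x)%:E < +oo)%E.
Variables (G : (X -> R) -> X -> R) (K : R) (K0 : 0 <= K).
Hypothesis rL2G : forall f, rL2 mu f -> rL2 mu (G f).
Hypothesis ipG : forall f, rL2 mu f -> ip mu (G f) (G f) <= ip mu f f.
Hypothesis GK : forall (U f : X -> R) (S : R), measurable_fun setT U -> rL2 mu f -> 0 < S ->
  (\int[mu]_x (`|U x| `^ (2 * q) * F1 x)%:E <= S%:E)%E ->
  (\int[mu]_x ((U x * G f x) ^+ 2)%:E <= (K * S `^ q^-1 * ip mu f f)%:E)%E.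

(* [W] cuts [V] off where [V1] is large, and where [V1] and [V2] are both small. *)
Lemma potential_approximation (e : R) : 0 < e -> exists W : X -> R,
  [/\ measurable_fun setT W, exists B : R, forall x, `|W x| <= B,
      (\int[mu]_x (W x ^+ 2 * F1 x)%:E < +oo)%E
    & forall f, rL2 mu f ->
        (\int[mu]_x (((V x - W x) * G f x) ^+ 2)%:E <= (e ^+ 2 * ip mu f f)%:E)%E].
Proof.
move=> e0; have e2 : 0 < e ^+ 2 by rewrite exprn_gt0.
(* [S] is chosen so that [(1 + M)^2 * K * S^(1/q) <= e^2 / 2]; the added 1 keeps [L] positive. The
   other half of [e^2] goes to the region where [V] is small. *)
pose L := (1 + M) ^+ 2 * K + 1; have L0 : 0 < L by rewrite ltr_wpDl// mulr_ge0// sqr_ge0.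
pose eta := e ^+ 2 / (2 * L); have eta0 : 0 < eta by rewrite divr_gt0// mulr_gt0.
pose S := eta `^ q; have S0 : 0 < S by exact: powR_gt0.
have Seta : S `^ q^-1 = eta by rewrite /S -powRrM mulfV ?gt_eqF// powRr1// ltW.
pose U n x := if n%:R < `|V1 x| then V1 x else 0.
have mU n : measurable_fun setT (U n).
  apply: measurable_fun_ifT => //; apply: measurable_fun_ltr => //.
  exact: measurableT_comp.
have [n [n1 nS ne]] : exists n : nat, [/\ (0 < n)%N,
    (\int[mu]_x (`|U n x| `^ (2 * q) * F1 x)%:E <= S%:E)%E & 4 / n%:R ^+ 2 <= e ^+ 2 / 2].
  have /fine_cvgP[[N1 _ h1] /cvgrPdist_le/(_ _ S0)[N2 _ h2]] := truncation_cvg mV1 fV1.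
  pose N3 := Num.bound (4 * (e ^+ 2)^-1 * 2); pose n := maxn (maxn N1 N2) N3.+1.
  exists n; have n0 : (0 < n)%N by rewrite /n leq_max orbT.
  split => //.
    have n1 : (N1 <= n)%N by rewrite /n !leq_max leqnn.
    have n2 : (N2 <= n)%N by rewrite /n !leq_max leqnn orbT.
    have := h2 n n2; rewrite /= sub0r normrN => h; have fin := h1 n n1.
    by rewrite -(fineK fin) lee_fin; apply: le_trans (ler_norm _) h.
  have nR : (1 : R) <= n%:R by rewrite ler1n.
  have nN : 4 * (e ^+ 2)^-1 * 2 <= n%:R.
    apply: le_trans (ltW (archi_boundP _)) _; first by rewrite !mulr_ge0 ?invr_ge0 ?ltW.
    by rewrite ler_nat; apply: leq_trans (leqnSn _) _; rewrite /n leq_max leqnn orbT.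
  rewrite ler_pdivrMr ?exprn_gt0 ?ltr0n//.
  have n2 : n%:R <= n%:R ^+ 2 :> R by rewrite expr2 ler_peMl// (le_trans ler01).
  have : 4 * (e ^+ 2)^-1 * 2 <= n%:R ^+ 2 by exact: le_trans nN n2.
  rewrite -(ler_pM2l (divr_gt0 e2 (ltr0n R 2))); apply: le_trans.
  by rewrite le_eqVlt; apply/orP; left; apply/eqP; field; rewrite gt_eqF.
have nR0 : 0 < n%:R :> R by rewrite ltr0n.
have nR1 : 1 <= n%:R :> R by rewrite ler1n.
(* The condition on [V2] makes [W] bounded everywhere, as [M] bounds [V2] only almost everywhere. *)
pose D x := [&& `|V1 x| <= n%:R, `|V2 x| <= M & (n%:R^-1 <= `|V1 x|) || (n%:R^-1 <= `|V2 x|)].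
pose W x := if D x then V x else 0.
have mnV1 : measurable_fun setT (fun x => `|V1 x|) by exact: measurableT_comp.
have mnV2 : measurable_fun setT (fun x => `|V2 x|) by exact: measurableT_comp.
have mW : measurable_fun setT W.
  apply: measurable_fun_ifT => //; apply: measurable_and; first exact: measurable_fun_ler.
  apply: measurable_and; first exact: measurable_fun_ler.
  by apply: measurable_or; exact: measurable_fun_ler.
have WB x : `|W x| <= n%:R + M.
  rewrite /W; case: ifPn => [/and3P[h1 h2 _]|_]; last by rewrite normr0 addr_ge0.
  by rewrite V_def (le_trans (ler_normD _ _))// lerD.
exists W; split => //; first by exists (n%:R + M).
- pose I x := if n%:R^-1 <= `|V2 x| then F1 x else 0.
  have mI : measurable_fun setT I.
    by apply: measurable_fun_ifT => //; exact: measurable_fun_ler.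
  have I0 x : 0 <= I x by rewrite /I; case: ifP => // _; exact: ltW.
  have iI : mu.-integrable setT (EFin \o I).
    apply: ge0_Rintegrable => //; have n10 : 0 < n%:R^-1 :> R by rewrite invr_gt0.
    have := V2F n10; rewrite integral_mkcond; congr (_ < _)%E.
    apply: eq_integral => x _; rewrite patchE /I.
    have -> : (x \in [set x | n%:R^-1 <= `|V2 x|]) = (n%:R^-1 <= `|V2 x|).
      by apply/idP/idP; rewrite inE.
    by case: ifP.
  have iV1 : mu.-integrable setT (EFin \o (fun x => `|V1 x| `^ (2 * q) * F1 x)).
    by apply: ge0_Rintegrable => //; exact: measurable_pow.
  have iB := RintegrableZl measurableT ((n%:R + M) ^+ 2)
    (RintegrableD measurableT (RintegrableZl measurableT (n%:R `^ (2 * q)) iV1) iI).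
  apply: le_lt_trans (integrable_lty measurableT iB).
  apply: ge0_le_integral => //.
  + by move=> x _; rewrite lee_fin mulr_ge0 ?sqr_ge0// ltW.
  + apply/measurable_EFinP; apply: measurable_funM => //; exact: measurable_funX.
  + exact: (measurable_int _ iB).
  move=> x _; rewrite lee_fin.
  have F10 := F1_gt0 x; have nM : 0 <= (n%:R + M) ^+ 2 by exact: sqr_ge0.
  have p0 : 0 <= n%:R `^ (2 * q) * (`|V1 x| `^ (2 * q) * F1 x).
    by rewrite mulr_ge0 ?powR_ge0 ?pow_ge0.
  have [WD|WD] := boolP (D x); last first.
    by rewrite /W (negbTE WD) expr0n/= mul0r mulr_ge0// addr_ge0.
  have W2 : W x ^+ 2 <= (n%:R + M) ^+ 2.
    by rewrite -[leLHS]real_normK ?num_real// lerXn2r ?nnegrE// addr_ge0.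
  apply: (@le_trans _ _ ((n%:R + M) ^+ 2 * F1 x)); first by rewrite ler_wpM2r// ltW.
  (* Chebyshev: where [|V1| >= 1/n] one has [1 <= (n |V1|)^(2q)], and the set [|V2| >= 1/n] has
     finite mass for [F1 dmu]. *)
  rewrite ler_wpM2l//; move: WD => /and3P[_ _ /orP[h|h]].
    apply: (@le_trans _ _ (n%:R `^ (2 * q) * (`|V1 x| `^ (2 * q) * F1 x))); last by rewrite lerDl.
    rewrite mulrA -powRM// ler_peMl ?(ltW F10)//.
    apply: (@le_trans _ _ (1 `^ (2 * q))); first by rewrite powR1.
    apply: ge0_ler_powR; rewrite ?nnegrE ?mulr_ge0 ?(ltW q0)//.
    by rewrite -(ler_pdivrMl _ _ nR0) mulr1.
  by rewrite /I h lerDr.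
move=> f f2; have Gf2 := rL2G f2; have [mGf _] := Gf2.
(* Off [D], either [|V1| > n >= 1] and [|V| <= (1 + M) |V1|], or both parts are below [1/n] and
   [|V| <= 2/n]. *)
have VW : {ae mu, forall x, (V x - W x) ^+ 2 <= (1 + M) ^+ 2 * U n x ^+ 2 + 4 / n%:R ^+ 2}.
  apply: filterS V2M => x V2x; have c0 : 0 <= 4 / n%:R ^+ 2 :> R by rewrite divr_ge0 ?sqr_ge0.
  have Vx : `|V x| <= `|V1 x| + `|V2 x| by rewrite V_def ler_normD.
  have VV : V x ^+ 2 = `|V x| ^+ 2 by rewrite real_normK ?num_real.
  rewrite /W; case: ifPn => [_|].
    by rewrite subrr expr0n/= addr_ge0// mulr_ge0 ?sqr_ge0.
  rewrite subr0 !negb_and V2x/= -ltNge => /orP[h|].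
    rewrite /U h -exprMn VV; apply: ler_wpDr => //.
    rewrite -[leRHS]real_normK ?num_real// normrM (ger0_norm (addr_ge0 ler01 M0)).
    rewrite lerXn2r ?nnegrE ?mulr_ge0 ?addr_ge0//.
    apply: le_trans Vx _; have : 1 <= `|V1 x| by apply: le_trans nR1 (ltW h).
    by have := M0; nra.
  rewrite negb_or -!ltNge => /andP[h1 h2].
  rewrite VV; apply: (@le_trans _ _ (4 / n%:R ^+ 2)); last by rewrite lerDr mulr_ge0 ?sqr_ge0.
  have -> : 4 / n%:R ^+ 2 = (2 * n%:R^-1) ^+ 2 :> R by field; rewrite gt_eqF.
  rewrite lerXn2r ?nnegrE ?mulr_ge0 ?invr_ge0 ?(ltW nR0)//.
  by apply: le_trans Vx _; have := ltW h1; have := ltW h2; lra.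
have mUG : measurable_fun setT (fun x => U n x * G f x) by exact: measurable_funM.
have c0 : 0 <= 4 / n%:R ^+ 2 :> R by rewrite divr_ge0 ?sqr_ge0.
have A0 x : setT x -> (0 <= ((1 + M) ^+ 2)%:E * ((U n x * G f x) ^+ 2)%:E)%E.
  by move=> _; rewrite -EFinM lee_fin mulr_ge0 ?sqr_ge0.
have B0 x : setT x -> (0 <= (4 / n%:R ^+ 2)%:E * (G f x ^+ 2)%:E)%E.
  by move=> _; rewrite -EFinM lee_fin mulr_ge0 ?sqr_ge0.
have mA : measurable_fun setT (fun x => ((1 + M) ^+ 2)%:E * ((U n x * G f x) ^+ 2)%:E)%E.
  by apply: measurable_funeM; exact: measurable_sqr.
have mB : measurable_fun setT (fun x => (4 / n%:R ^+ 2)%:E * (G f x ^+ 2)%:E)%E.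
  by apply: measurable_funeM; exact: measurable_sqr.
apply: (@le_trans _ _ (\int[mu]_x (((1 + M) ^+ 2)%:E * ((U n x * G f x) ^+ 2)%:E +
    (4 / n%:R ^+ 2)%:E * (G f x ^+ 2)%:E))%E).
  apply: ae_ge0_le_integral => //.
  - by move=> x _; rewrite lee_fin sqr_ge0.
  - by apply: measurable_sqr; apply: measurable_funM => //; exact: measurable_funB.
  - by move=> x _; apply: adde_ge0; [exact: A0|exact: B0].
  - exact: emeasurable_funD.
  apply: filterS VW => x h _; rewrite -!EFinM -EFinD lee_fin.
  apply: le_trans (le_trans _ (ler_wpM2r (sqr_ge0 (G f x)) h)) _.
    by rewrite exprMn.
  by rewrite le_eqVlt; apply/orP; left; apply/eqP; ring.
rewrite (ge0_integralD _ measurableT A0 mA B0 mB).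
rewrite (ge0_integralZl_EFin _ measurableT _ (measurable_sqr mUG) (sqr_ge0 _)); last first.
  by move=> x _; rewrite lee_fin sqr_ge0.
rewrite (ge0_integralZl_EFin _ measurableT _ (measurable_sqr mGf) c0); last first.
  by move=> x _; rewrite lee_fin sqr_ge0.
apply: (@le_trans _ _ (((1 + M) ^+ 2)%:E * (K * S `^ q^-1 * ip mu f f)%:E +
    (4 / n%:R ^+ 2)%:E * (ip mu f f)%:E)%E).
  apply: leeD; apply: lee_wpmul2l.
  - by rewrite lee_fin sqr_ge0.
  - exact: (GK (mU n) f2 S0 nS).
  - by rewrite lee_fin.
  - by rewrite integral_sqrE// lee_fin ipG.
rewrite -!EFinM -EFinD lee_fin Seta.
have I0 : 0 <= ip mu f f := ip_ge0 _ _.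
have A1 : (1 + M) ^+ 2 * K * eta <= e ^+ 2 / 2.
  apply: (@le_trans _ _ (L * eta)); first by rewrite ler_wpM2r ?(ltW eta0)// lerDl.
  by rewrite le_eqVlt; apply/orP; left; apply/eqP; rewrite /eta; field; rewrite gt_eqF.
have A2 : (1 + M) ^+ 2 * K * eta + 4 / n%:R ^+ 2 <= e ^+ 2 by lra.
by have := ler_wpM2r I0 A2; lra.
Qed.

End approximation.

(** * From real functions to the graph of the complex operator *)

Section compact_resolvent.
Context {d : measure_display} {X : measurableType d} {R : realType}.
Variable mu : {sigma_finite_measure set X -> \bar R}.
Variables (p : R -> X -> X -> R) (hp : heat_kernel mu p).
Local Notation C := R[i].
Variables (H : @graph d X R) (hH : heat_operator mu p H).
Variables (V : X -> R) (mV : measurable_fun setT V).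
Local Notation G := (kop mu (green p)).
Hypothesis VG : forall f, rL2 mu f -> rL2 mu (fun x => V x * G f x).
Hypothesis VGc : forall (u : nat -> X -> R) (M : R), (forall n, rL2 mu (u n)) ->
  (forall n, nrm mu (u n) <= M) ->
  exists (s : nat -> nat) (g : X -> R), [/\ {homo s : m n / (m < n)%N}, rL2 mu g &
    nrm mu (fun x => V x * G (u (s n)) x - g x) @[n --> \oo] --> 0].
Implicit Types (f g h : X -> C).
Local Notation T := (compose (multiplication mu V) (inverse (plus_id H))).

Let opH : operator mu H. Proof. by have [[]] := hH. Qed.

Lemma cvg_subsequence (a : nat -> R) (l : R) (s : nat -> nat) :
  {homo s : m n / (m < n)%N} -> a n @[n --> \oo] --> l -> a (s n) @[n --> \oo] --> l.
Proof.
move=> hs /cvgrPdist_le al; apply/cvgrPdist_le => e e0.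
have [N _ hN] := al e e0; exists N => // n /= Nn; apply: hN => /=.
exact: leq_trans Nn (homo_ltn_geid hs n).
Qed.

Lemma L2Z (a : C) f : L2 mu f -> L2 mu (fun x => a * f x).
Proof.
move=> /L2P[f1 f2]; apply/L2P; case: a => a b; split.
  rewrite (_ : re _ = fun x => a * re f x - b * im f x); first by apply: rL2B; exact: rL2Z.
  by apply/funext => x; rewrite /re /im; case: (f x).
rewrite (_ : im _ = fun x => a * im f x + b * re f x); first by apply: rL2D; exact: rL2Z.
by apply/funext => x; rewrite /re /im; case: (f x).
Qed.

Lemma re_mulV f : re (fun x => (V x)%:C%C * f x) = (fun x => V x * re f x).
Proof. by apply/funext => x; rewrite /re Re_cscale. Qed.

Lemma im_mulV f : im (fun x => (V x)%:C%C * f x) = (fun x => V x * im f x).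
Proof. by apply/funext => x; rewrite /im Im_cscale. Qed.

Lemma L2_potential_green_op f : L2 mu f -> L2 mu (fun x => (V x)%:C%C * green_op mu p f x).
Proof.
by move=> /L2P[f1 f2]; apply/L2P; rewrite re_mulV im_mulV; split; exact: VG.
Qed.

(** The intermediate function of the composed graph solves the resolvent equation, so uniqueness
    identifies it almost everywhere with [green_op f]. *)
Lemma potential_resolventP f h : T f h -> [/\ L2 mu f, L2 mu h &
  h = (fun x => (V x)%:C%C * green_op mu p f x) %[ae mu]].
Proof.
move=> [g [hg [g2 h2 hE]]]; have [_ fg2] := operator_L2 opH hg.
have f2 : L2 mu f.
  by have := L2D fg2 g2; congr L2; apply/funext => x; rewrite subrK.
split => //; have := resolvent_unique hp hH f2 hg.
by apply: filterS2 hE => x /= hE gE xT; rewrite hE// gE.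
Qed.

Lemma potential_resolvent_intro f h : L2 mu f -> L2 mu h ->
  h = (fun x => (V x)%:C%C * green_op mu p f x) %[ae mu] -> T f h.
Proof.
move=> f2 h2 hE; exists (green_op mu p f); split; first exact: (green_op_resolvent hp hH).
by split => //; exact: (L2_green_op hp).
Qed.

Lemma operator_potential_resolvent : operator mu T.
Proof.
split.
- by move=> f h /potential_resolventP[].
- move=> f h f' h' [g [hg [g2 h2 hE]]] f'2 h'2 ff' hh'; exists g; split.
    have [_ fg2] := operator_L2 opH hg.
    apply: (operator_ae opH hg) => //; [exact: L2B|exact: aeW|].
    by apply: filterS ff' => x /= ff' xT; rewrite ff'.
  split=> //; apply: filterS2 hE hh' => x /= hE hh' xT.
  by rewrite -hh'// hE.
- move=> f h h' /potential_resolventP[f2 h2 hE] /potential_resolventP[_ _ h'E].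
  by apply: filterS2 hE h'E => x /= hE h'E xT; rewrite hE// h'E.
- exists (fun=> 0); split.
    rewrite /inverse /plus_id (_ : (fun x : X => 0 - 0) = (fun=> 0)); first exact: (operator0 opH).
    by apply/funext => x; rewrite subr0.
  have [z2 _] := operator_L2 opH (operator0 opH).
  by split => //; apply: aeW => x _; rewrite mulr0.
- move=> a f h f' h' [g [hg [g2 h2 hE]]] [g' [hg' [g'2 h'2 h'E]]].
  have hl := operator_linear opH a hg hg'.
  have [gg2 _] := operator_L2 opH hl.
  exists (fun x => a * g x + g' x); split.
    rewrite /inverse /plus_id; move: hl; congr H; apply/funext => x.
    by rewrite mulrBr opprD addrACA.
  split => //; first exact: L2D (L2Z a h2) h'2.
  apply: filterS2 hE h'E => x /= hE h'E xT; by rewrite hE// h'E// mulrDr mulrCA.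
Qed.

Lemma nrm_components f : L2 mu f ->
  nrm mu (re f) <= Num.sqrt (rip mu f f) /\ nrm mu (im f) <= Num.sqrt (rip mu f f).
Proof. by move=> f2; split; rewrite ler_wsqrtr// /rip ?lerDl ?lerDr ip_ge0. Qed.

Lemma compact_potential_resolvent : compact_operator mu T.
Proof.
split; first exact: operator_potential_resolvent.
  move=> f f2; exists (fun x => (V x)%:C%C * green_op mu p f x).
  by apply: potential_resolvent_intro => //; [exact: L2_potential_green_op|exact: aeW].
move=> u v uv [M uM].
have u2 n : L2 mu (u n) by have [] := potential_resolventP (uv n).
have v2 n : L2 mu (v n) by have [] := potential_resolventP (uv n).
have vE n : v n = (fun x => (V x)%:C%C * green_op mu p (u n) x) %[ae mu].
  by have [] := potential_resolventP (uv n).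
have re2 n : rL2 mu (re (u n)) by have /L2P[] := u2 n.
have im2 n : rL2 mu (im (u n)) by have /L2P[] := u2 n.
have uM' n : Num.sqrt (rip mu (u n) (u n)) <= M.
  by rewrite -lee_fin -L2normE.
have reM n : nrm mu (re (u n)) <= M.
  by apply: le_trans (uM' n); have [] := nrm_components (u2 n).
have imM n : nrm mu (im (u n)) <= M.
  by apply: le_trans (uM' n); have [] := nrm_components (u2 n).
(* A subsequence for the real parts, then a further one for the imaginary parts. *)
have [s1 [g1 [hs1 g12 lim1]]] := VGc re2 reM.
have [s2 [g2 [hs2 g22 lim2]]] := VGc (fun n => im2 (s1 n)) (fun n => imM (s1 n)).
pose s n := s1 (s2 n); pose g x : C := (g1 x +i* g2 x)%C.
have gL2 : L2 mu g by apply/L2P.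
exists s, g; split => //; first by move=> m n mn; apply: hs1; exact: hs2.
pose a n := nrm mu (fun x => V x * G (re (u (s n))) x - g1 x).
pose b n := nrm mu (fun x => V x * G (im (u (s n))) x - g2 x).
have lima : a n @[n --> \oo] --> 0 by exact: (cvg_subsequence hs2 lim1).
have E n : L2norm mu (fun x => (v (s n) x - g x)%R) = (Num.sqrt (a n ^+ 2 + b n ^+ 2))%:E.
  have vg2 := L2B (v2 (s n)) gL2; rewrite L2normE//; congr (Num.sqrt _)%:E.
  have w2 := L2_potential_green_op (u2 (s n)).
  have wg2 := L2B w2 gL2.
  have vw : (fun x => v (s n) x - g x) = (fun x => (V x)%:C%C * green_op mu p (u (s n)) x - g x) %[ae mu].
    by apply: filterS (vE (s n)) => x /= h xT; rewrite h.
  rewrite (eq_ae_rip vg2 wg2 vg2 vw) ripC (eq_ae_rip vg2 wg2 wg2 vw).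
  by rewrite /rip /a /b !nrm_sqr !reB !imB re_mulV im_mulV.
under eq_fun do rewrite E.
apply: cvg_EFin; first exact: nearW.
have -> : (0 : R) = Num.sqrt (0 ^+ 2 + 0 ^+ 2) by rewrite expr0n/= addr0 sqrtr0.
apply: (continuous_cvg _ (@sqrt_continuous R _)).
have sq (c : nat -> R) : c n @[n --> \oo] --> 0 -> c n ^+ 2 @[n --> \oo] --> (0 : R) ^+ 2.
  by move=> c0; rewrite expr2; under eq_fun do rewrite expr2; exact: cvgM.
by apply: cvgD; exact: sq.
Qed.

End compact_resolvent.

(** * The conditions on the potential in terms of real functions *)

Section hypotheses.
Context {d : measure_display} {X : measurableType d} {R : realType}.
Variable mu : {measure set X -> \bar R}.
Implicit Types (U : X -> R).

Lemma normc_real (a : R) : normc (a%:C%C) = `|a|.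
Proof. by rewrite /= expr0n/= addr0 sqrtr_sqr. Qed.

Lemma in_Lp_real (r : R) U : 0 < r -> in_Lp mu r%:E (fun x => (U x)%:C%C) ->
  measurable_fun setT U /\ (\int[mu]_x (`|U x| `^ r)%:E < +oo)%E.
Proof.
move=> r0 [[mU _] h]; split; first exact: mU.
have r1 : r^-1 != 0 by rewrite invr_eq0 gt_eqF.
move: h; rewrite /cLnorm unlock => /(lty_poweRy r1) h.
rewrite (eq_integral (fun x => `|(normc (U x)%:C%C)%:E| `^ r)%E) // => x _.
by rewrite normc_real /= normr_id.
Qed.

Lemma in_Loo_real U : in_Lp mu +oo%E (fun x => (U x)%:C%C) ->
  measurable_fun setT U /\ exists2 M, 0 <= M & {ae mu, forall x, `|U x| <= M}.
Proof.
move=> [[mU _]]; rewrite /cLnorm unlock => h; split; first exact: mU.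
move: h; case: ifPn => [_|].
  set y := ess_sup _ _ => yoo; exists (`|fine y|) => //.
  have : (y <= `|fine y|%:E)%E by move: yoo; case: y => [z _||//]; rewrite ?lee_fin ?ler_norm ?leNye.
  move=> /ess_supP; apply: filterS => x /=.
  by rewrite expr0n/= addr0 sqrtr_sqr normr_id lee_fin.
(* The essential supremum norm is defined separately when the whole space is null, and then any
   bound holds almost everywhere. *)
rewrite -leNgt => mu0; exists 0 => //; exists setT; split => //.
by apply/eqP; rewrite eq_le mu0 measure_ge0.
Qed.

Lemma vanishes_weakly_real U (c : R) : vanishes_weakly mu (fun x => (U x)%:C%C) -> 0 < c ->
  (mu [set x | (c <= `|U x|)%R] < +oo)%E.
Proof.
move=> [_ h] /h; congr (mu _ < _)%E.
by apply/seteqP; split=> x /=; rewrite expr0n/= addr0 sqrtr_sqr.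
Qed.

End hypotheses.

Theorem mainTheorem2 (R : realType) (d : measure_display) (X : measurableType d)
  (mu : {sigma_finite_measure set X -> \bar R})
  (p : R -> X -> X -> R) (hp : heat_kernel mu p)
  (H : @graph d X R) (hH : heat_operator mu p H)
  (F1 : X -> R) (mF1 : measurable_fun setT F1) (F1_gt0 : forall x, 0 < F1 x)
  (F2 : R -> R) (mF2 : measurable_fun [set t : R | 0 < t] F2)
  (F2_gt0 : forall t : R, 0 < t -> 0 < F2 t)
  (q : R) (q_ge1 : 1 <= q)
  (p_le : forall (t : R) (x : X), 0 < t -> p t x x <= F1 x * F2 t)
  (F2_int : (\int[lebesgue_measure]_(t in `]0%R, +oo[%classic)
    (expR (- t) * F2 t `^ (1 / (2 * q)))%:E < +oo)%E)
  (V V1 V2 : X -> R) (mV : measurable_fun setT V)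
  (V_def : forall x, V x = V1 x + V2 x) :
  let F1mu := density mu mF1 (fun x => ltW (F1_gt0 x)) in
  let W1 x := (V1 x)%:C%C in
  let W2 x := (V2 x)%:C%C in
  ([/\ q = 1,
       in_Lp F1mu 2%:E W1,
       in_Lp mu +oo%E W2 /\ vanishes_weakly mu W2
     & vanishes_weakly F1mu W2]
   \/
   [/\ 1 < q,
       forall x, F1 x = 1,
       in_Lp mu (2 * q)%:E W1
     & in_Lp mu +oo%E W2 /\ vanishes_weakly mu W2]) ->
  compact_operator mu
    (compose (multiplication mu V) (inverse (plus_id H))).
Proof.
move=> F1mu W1 W2 hyp.
have q0 : 0 < q by exact: lt_le_trans q_ge1.
(* Both cases give the same condition: in (i) [2 q = 2] and the weight comes from the density, in
   (ii) the weight is 1. *)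
have [mV1 fV1] : measurable_fun setT V1 /\
    (\int[mu]_x (`|V1 x| `^ (2 * q) * F1 x)%:E < +oo)%E.
  case: hyp => [[q1 hV1 _ _]|[_ F11 hV1 _]].
    have [mV1 fV1] := in_Lp_real (ltr0n R 2) hV1; split => //.
    move: fV1; rewrite ge0_integral_density; first by rewrite q1 mulr1.
      by apply: (measurableT_comp (measurable_powR 2)); exact: measurableT_comp.
    by move=> x; exact: powR_ge0.
  have [//|mV1 fV1] := in_Lp_real _ hV1; first by rewrite mulr_gt0.
  by split => //; under eq_integral do rewrite F11 mulr1.
have hV2 : in_Lp mu +oo%E W2 by case: hyp => [[_ _ [? _] _]|[_ _ _ [? _]]].
have [mV2 [M M0 V2M]] := in_Loo_real hV2.
(* In (i) this is the measure [F1mu] of the level set, by definition of [density]; in (ii) it is its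
   [mu]-measure. *)
have V2F (c : R) : 0 < c -> (\int[mu]_(x in [set x | (c <= `|V2 x|)%R]) (F1 x)%:E < +oo)%E.
  move=> c0; case: hyp => [[_ _ _ hv]|[_ F11 _ [_ hv]]].
    exact: (vanishes_weakly_real hv c0).
  have mA : measurable [set x | (c <= `|V2 x|)%R].
    have -> : [set x | (c <= `|V2 x|)%R] = (fun x => `|V2 x|) @^-1` `[c, +oo[%classic.
      by apply/seteqP; split=> x /=; rewrite in_itv/= andbT.
    by rewrite -[X in measurable X]setTI; apply: (measurableT_comp _ mV2).
  under eq_integral do rewrite F11.
  by rewrite integral_cst// mul1e; exact: vanishes_weakly_real hv c0.
have [C C0 hC] : exists2 C : R, 0 < C &
    (\int[lebesgue_measure]_t (exp_weight t * time_weight F2 q t)%:E <= C%:E)%E.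
  have intE : (\int[lebesgue_measure]_t (exp_weight t * time_weight F2 q t)%:E =
      \int[lebesgue_measure]_(t in `]0%R, +oo[%classic)
        (expR (- t) * F2 t `^ (1 / (2 * q)))%:E)%E.
    rewrite [RHS]integral_mkcond; apply: eq_integral => t _.
    rewrite patchE mem_setE/= in_itv/= andbT /exp_weight /time_weight.
    by case: ifP => // _; rewrite mul0r.
  have h0 : (0 <= \int[lebesgue_measure]_t (exp_weight t * time_weight F2 q t)%:E)%E.
    apply: integral_ge0 => t _.
    by rewrite lee_fin mulr_ge0 ?exp_weight_ge0// ltW// time_weight_gt0.
  have fin : (\int[lebesgue_measure]_t (exp_weight t * time_weight F2 q t)%:E)%E \is a fin_num.
    by rewrite ge0_fin_numE// intE.
  exists (fine (\int[lebesgue_measure]_t (exp_weight t * time_weight F2 q t)%:E)%E + 1).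
    by rewrite ltr_wpDl// fine_ge0.
  by rewrite EFinD fineK// leeDl.
have GK (U f : X -> R) (S : R) : measurable_fun setT U -> rL2 mu f -> 0 < S ->
    (\int[mu]_x (`|U x| `^ (2 * q) * F1 x)%:E <= S%:E)%E ->
    (\int[mu]_x ((U x * kop mu (green p) f x) ^+ 2)%:E <=
      (2 * C ^+ 2 * S `^ q^-1 * ip mu f f)%:E)%E.
  move=> mU f2 S0 US.
  exact: (integral_potential_green hp mF1 F1_gt0 mF2 F2_gt0 q_ge1 p_le mU f2 S0 US C0 hC).
have K0 : 0 <= 2 * C ^+ 2 by rewrite mulr_ge0 ?sqr_ge0.
have approx := potential_approximation mF1 F1_gt0 q0 mV mV1 mV2 V_def fV1 M0 V2M V2F K0
  (fun f => rL2_green hp (f := f)) (fun f => ip_kop_le (subker_green hp) (f := f)) GK.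
apply: (compact_potential_resolvent hp hH).
  move=> f; exact: (rL2_potential_green hp mV approx).
move=> u N; exact: (potential_green_compact hp mF1 F1_gt0 F2_gt0 p_le mV approx).
Qed.
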